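(* Let $X,Y,A,B,F,V,\psi$ be as in the context, and suppose that $B$ is an entire function. Let $\alpha<0$ and suppose $F$ (restricted to the negative real axis) is of exponential order $-\alpha$ at $-\infty$. Suppose that the zeroes of $F$ with strictly negative real part, listed with multiplicity, have an enumeration $\{\zeta_n: n\in\mathbb Z\}$ such that $\zeta_{-n}=\overline{\zeta}_n$ for all $n$ and, as $n\to+\infty$, $\Re \zeta_n=o(n^{1/2})$ and $\Im \zeta_n=-2\pi n/\alpha+\beta+o(1)$ for a real constant $\beta$. Suppose that there exist $\eta>0$, $\epsilon>0$ and an $\eta$-sublinear sequence of radii $\{r_n,\ n\ge n_1\}$ with $r_n\to\infty$ such that $|F(\theta)|>\epsilon$ whenever $\Re\theta<0$ and $|\theta|=r_n$. Let $\{z_n: n\in\mathbb Z\}$, with $z_{-n}=\overline z_n$, enumerate the distinct zeroes of $F$ with strictly negative real part, let $k_n$ be the multiplicity of $z_n$, let $A_{n,j}$ be the coefficient of $(\theta-z_n)^{-j}$ in the Laurent expansion of $\psi$ around $z_n$, and put $a_{n,j}=A_{n,j}(-z_n)^{-j}$. Suppose that there exist $M_1<\infty$, $\gamma>0$ and $\gamma_0\in\mathbb R$ such that $|a_{n,j}|\le M_1|n|^{-1}$ for all $n\neq0$ and $1\le j\le k_n$, and $\Re z_n=-\gamma\log|n|+\gamma_0+o(1)$ as $|n|\to\infty$. Then for every $t>0$ the tail waiting probability is $$P(W>t)=\lim_{N\to\infty}\sum_{n=-N}^{N}\sum_{j=1}^{k_n}a_{n,j}\sum_{l=0}^{j-1}\exp(z_nt)\,\frac{(-tz_n)^l}{l!},$$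 where $W=V$.
   Context: $X\ge 0$ (interarrival time) and $Y\ge0$ (service time) are independent random variables with $E[Y]<E[X]$, at least one of which is non-lattice; $U=Y-X$. Their Laplace transforms are $A(\theta)=E[\exp(-\theta X)]$ and $B(\theta)=E[\exp(-\theta Y)]$, both assumed analytic in a strip $\{\theta:-\epsilon_0<\Re\theta<\epsilon_0\}$ with $\epsilon_0>0$. Put $F(\theta)=B(\theta)A(-\theta)-1$; when $B$ is entire, $F$ is analytic on $\{\Re\theta<\epsilon_0\}$. $V\ge 0$ is the steady-state unfinished workload just prior to an arrival (equivalently the stationary waiting time $W$), i.e. $V$ has the unique distribution such that $V$ and $(V+U)^+$ are equal in law, with $V$ and $U$ independent in the second expression; $\psi(\theta)=E[\exp(-\theta V)]$, continued meromorphically to the plane. Known fact (W. L. Smith): $\psi$ extends analytically and without zeroes to a half-plane $\{\Re\theta>-\epsilon_1\}$, $\epsilon_1>0$, and the poles of $\psi$ coincide with the zeroes of $F$ of negative real part. Exponential order: a real function $f$ is of exponential order $a$ at $b\in\{\pm\infty\}$ if for every $\epsilon>0$, $\lim_{x\to b}f(x)\exp(-(a+\epsilon)|x|)=\lim_{x\to b}\exp((a-\epsilon)|x|)/f(x)=0$. A non-decreasing sequence $\{r_n\}$ is $\eta$-sublinear if there is $n_0$ with $r_{n+1}-r_n<\eta$ whenever $n\ge n_0$. *)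

(* Defs.v *)
From mathcomp Require Export all_boot all_order all_algebra.
From mathcomp Require Export all_classical all_reals all_analysis.
From mathcomp Require Export measurable_realfun.
From mathcomp Require Export complex.
Export Order.TTheory GRing.Theory Num.Theory numFieldNormedType.Exports.

Set Implicit Arguments.
Unset Strict Implicit.
Unset Printing Implicit Defensive.

Local Open Scope classical_set_scope.
Local Open Scope complex_scope.
Local Open Scope ring_scope.

(* R[i] has no canonical topology; R[i]^o is the same type seen as a normed
   module over itself, hence the casts below.  The norm of R[i] is R[i]-valued;
   cmod is the R-valued modulus. *)

Section ComplexFunctions.
Context {R : realType}.
Implicit Types (f : R[i] -> R[i]) (z : R[i]) (c : int -> R[i]).

Definition cmod z : R := complex.Re `|z|.

Definition cexp z : R[i] :=
  (expR (complex.Re z))%:C * (cos (complex.Im z) +i* sin (complex.Im z)).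

Definition cderivable f z : Prop := @derivable R[i] R[i]^o R[i]^o f z 1.

Definition analytic_at f z : Prop :=
  \forall w \near (z : R[i]^o), cderivable f w.

(* The value of f at the point z itself is irrelevant. *)
Definition meromorphic_at f z : Prop :=
  exists (m : nat) (g : R[i] -> R[i]), analytic_at g z /\
    \forall w \near (z : R[i]^o)^', f w = (w - z) ^- m * g w.

(* k = 0 means that z is not a zero of f. *)
Definition zero_order f z (k : nat) : Prop :=
  exists g : R[i] -> R[i], [/\ analytic_at g z, g z != 0 &
    \forall w \near (z : R[i]^o), f w = (w - z) ^+ k * g w].

(* f w = \sum_(k >= - m) c k * (w - z) ^ k around z, for some m: the Laurent
   expansion of a function with at most a pole at z. *)
Definition laurent_expansion f z c : Prop :=
  exists m : nat, (forall k : int, k < - m%:Z -> c k = 0) /\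
    \forall w \near (z : R[i]^o)^',
      (fun N : nat => \sum_(0 <= i < N) c (i%:Z - m%:Z) * (w - z) ^ (i%:Z - m%:Z)
         : R[i]^o) @ \oo --> (f w : R[i]^o).

(* zeta lists the zeros of f in D, each one as often as its multiplicity. *)
Definition enum_zeros_with_mult f (D : set R[i]) (zeta : int -> R[i]) : Prop :=
  (forall n, D (zeta n)) /\
  forall z, D z ->
    exists2 k : nat, zero_order f z k & ([set n | zeta n = z] #= `I_k)%card.

Definition enum_distinct_zeros f (D : set R[i]) (z : int -> R[i]) : Prop :=
  injective z /\ range z = [set w | D w /\ f w = 0].

Definition left_half_plane : set R[i] := [set z | complex.Re z < 0].

End ComplexFunctions.

Section RealFunctions.
Context {R : realType}.

(* b is the filter of neighbourhoods of +oo or of -oo.  Since x / 0 = 0 here,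
   the second limit has to be completed by the eventual nonvanishing of f. *)
Definition exponential_order (f : R -> R) (a : R) (b : set_system R) : Prop :=
  (\forall x \near b, f x != 0) /\
  forall e : R, 0 < e ->
    f x * expR (- (a + e) * `|x|) @[x --> b] --> (0 : R) /\
    expR ((a - e) * `|x|) / f x @[x --> b] --> (0 : R).

(* The sequence is indexed by n >= n1. *)
Definition sublinear (eta : R) (n1 : nat) (r : nat -> R) : Prop :=
  (forall n, (n1 <= n)%N -> r n <= r n.+1) /\
  exists n0 : nat, forall n, (n1 <= n)%N -> (n0 <= n)%N -> r n.+1 - r n < eta.

End RealFunctions.

Section Queue.
Context {d : measure_display} {T : measurableType d} {R : realType}.
Variable P : probability T R.
Implicit Types X Y V : {RV P >-> R}.

Definition independent2 X Y : Prop :=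
  forall A B : set R, measurable A -> measurable B ->
    P (X @^-1` A `&` Y @^-1` B) = (P (X @^-1` A) * P (Y @^-1` B))%E.

Definition lattice X : Prop :=
  exists2 h : R, 0 < h & {ae P, forall w, exists m : int, X w = m%:~R * h}.

Definition cintegrable (f : T -> R[i]) : Prop :=
  P.-integrable setT (fun w => (complex.Re (f w))%:E) /\
  P.-integrable setT (fun w => (complex.Im (f w))%:E).

Definition cexpectation (f : T -> R[i]) : R[i] :=
  (\int[P]_w complex.Re (f w)) +i* (\int[P]_w complex.Im (f w)).

Definition laplace X (theta : R[i]) : R[i] :=
  cexpectation (fun w => cexp (- theta * (X w)%:C)).

(* Rocq functions being total, analyticity includes that the expectation which
   defines the transform exists. *)
Definition laplace_analytic_on X (D : set R[i]) : Prop :=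
  forall theta, D theta ->
    cintegrable (fun w => cexp (- theta * (X w)%:C)) /\
    cderivable (laplace X) theta.

Definition characteristic X Y (theta : R[i]) : R[i] :=
  laplace Y theta * laplace X (- theta) - 1.

(* V and (V + U)^+ with U = Y - X are equal in law, V and U being taken
   independent in the second expression: (V, U) has there the product law. *)
Definition stationary_workload X Y V : Prop :=
  forall A : set R, measurable A ->
    distribution P V A =
    pushforward (distribution P V \x distribution P ((Y : {mfun T >-> R}) - X)%R)%E
      (fun vu : R * R => Num.max (vu.1 + vu.2) 0) A.

Definition meromorphic_continuation V (psi : R[i] -> R[i]) : Prop :=
  (forall theta, 0 <= complex.Re theta -> psi theta = laplace V theta) /\
  (forall z, meromorphic_at psi z).

End Queue.

(* Main.v *)
Require Import Defs.
From mathcomp Require Import zify ring lra.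

(** Let [U = Y - X] and write [F] for [characteristic X Y].

    The identity [e^(- w x^+) = e^(- w x) + 1 - e^(w x^-)], integrated against
    the law of [V + U], turns the stationarity of [V] into the Wiener-Hopf
    equation [psi F = - H], where [1 - H (w) = E e^(w I)] is the transform of
    the idle time [I = (V + U)^-] ([wiener_hopf]).  On the left half-plane
    [|H| <= 2], so that the poles of [psi] are at most of the order of the zeros
    of [F] ([laurent_pole_order]), and on the circles [|w| = r n] the bound
    [|F| > eps] makes [psi] bounded.

    Fix [t > 0] and consider [J (w) = E e^(w (t - V)^+) - e^(w t) psi (w)]
    ([contour]).  By the same identity [J (w) = 1 - E e^(- w (V - t)^+)] on the
    right; hence [J 0 = 0], and [J] is bounded on the circles.  By the residue
    theorem for [J (w) / w] the mean of [J] over a circle is the sum of the terms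
    of the expansion that belong to the zeros inside it ([circle_mean_contour]).
    As the radius grows, [J] tends to [P (V > t)] in the directions of the right
    half-plane and to [P (V >= t)] in those of the left one.  By dominated
    convergence the sums over the discs tend to a number [S t] between these
    two probabilities ([contour_limit]).

    Two gaps remain: the sums of the theorem are symmetric in the index and do
    not follow the discs, and an atom of [V] at [t] leaves [S t] undetermined.
    The asymptotics of the zeros closes both.  Since their imaginary parts are
    asymptotically equidistant, all but finitely many zeros are simple
    ([eventually_distinct], [multiplicity_le1]), and then the logarithmic
    decrease of the real parts bounds the [n]-th term by a multiple of
    [|n|^(- 1 - gamma t)].  Therefore the expansion converges absolutely, and
    uniformly for [u] in [[t, t + 1]].  The order of summation is thus
    irrelevant, and [S t] is the limit of [S u <= P (V >= u) <= P (V > t)] as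
    [u] decreases to [t], which forces [S t = P (V > t)]
    ([symmetric_sum_limit]).

    The complex analysis is reduced to the mean value property on circles, which
    follows from Goursat's lemma for rectangles in logarithmic coordinates.  It
    yields the identity theorem, needed to continue the Wiener-Hopf equation to
    the left half-plane ([equation_continuation]), and the residue theorem
    above, because negative powers of [w - z] have mean zero on circles around
    the origin that enclose [z] ([circle_mean_pole]). *)

Set Implicit Arguments.
Unset Strict Implicit.
Unset Printing Implicit Defensive.
Local Open Scope classical_set_scope.
Local Open Scope complex_scope.
Local Open Scope ring_scope.

(** * The modulus and the topology of the complex numbers *)

Section Modulus.
Context {R : realType}.
Implicit Types (z w : R[i]) (x y : R).

Lemma normcE z : `|z| = (cmod z)%:C.
Proof. by rewrite /cmod; case: z => x y; rewrite normc_def /=. Qed.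

Lemma cmodE z : cmod z = Num.sqrt (complex.Re z ^+ 2 + complex.Im z ^+ 2).
Proof. by case: z => x y; rewrite /cmod normc_def. Qed.

Lemma sqr_cmod z : cmod z ^+ 2 = complex.Re z ^+ 2 + complex.Im z ^+ 2.
Proof. by rewrite cmodE sqr_sqrtr // addr_ge0 ?sqr_ge0. Qed.

Lemma cmod_ge0 z : 0 <= cmod z.
Proof. by rewrite cmodE sqrtr_ge0. Qed.

Lemma cmodM z w : cmod (z * w) = cmod z * cmod w.
Proof. by apply: (@complexI R); rewrite -normcE normrM !normcE rmorphM. Qed.

Lemma cmodN z : cmod (- z) = cmod z.
Proof. by rewrite /cmod normrN. Qed.

Lemma cmodB z w : cmod (z - w) = cmod (w - z).
Proof. by rewrite -cmodN opprB. Qed.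

Lemma cmodD z w : cmod (z + w) <= cmod z + cmod w.
Proof. by rewrite -lecR rmorphD /= -!normcE ler_normD. Qed.

Lemma cmod0 : cmod (0 : R[i]) = 0.
Proof. by rewrite /cmod normr0. Qed.

Lemma cmod1 : cmod (1 : R[i]) = 1.
Proof. by rewrite /cmod normr1. Qed.

Lemma cmod_eq0 z : (cmod z == 0) = (z == 0).
Proof. by rewrite -(inj_eq (@complexI R)) -normcE normr_eq0. Qed.

Lemma cmod_gt0 z : (0 < cmod z) = (z != 0).
Proof. by rewrite lt0r cmod_ge0 andbT cmod_eq0. Qed.

Lemma cmodX z n : cmod (z ^+ n) = cmod z ^+ n.
Proof. by elim: n => [|n IH]; rewrite ?expr0 ?cmod1 // !exprS cmodM IH. Qed.

Lemma cmodV z : cmod z^-1 = (cmod z)^-1.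
Proof. by apply: (@complexI R); rewrite -normcE normfV normcE fmorphV. Qed.

Lemma cmodC x : cmod x%:C = `|x|.
Proof. by rewrite cmodE /= expr0n addr0 sqrtr_sqr. Qed.

Lemma cmod_conj z : cmod z^* = cmod z.
Proof. by case: z => x y; rewrite !cmodE /= sqrrN. Qed.

Lemma abs_Re_le_cmod z : `|complex.Re z| <= cmod z.
Proof. by rewrite cmodE -sqrtr_sqr ler_wsqrtr // lerDl sqr_ge0. Qed.

Lemma abs_Im_le_cmod z : `|complex.Im z| <= cmod z.
Proof. by rewrite cmodE -sqrtr_sqr ler_wsqrtr // lerDr sqr_ge0. Qed.

Lemma Re_le_cmod z : complex.Re z <= cmod z.
Proof. exact: le_trans (ler_norm _) (abs_Re_le_cmod z). Qed.

Lemma cmod_le_ReIm z : cmod z <= `|complex.Re z| + `|complex.Im z|.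
Proof.
have -> : z = (complex.Re z)%:C + (complex.Im z)%:C * 'i.
  by case: z => x y; simpc.
apply: le_trans (cmodD _ _) _.
have -> : cmod ((complex.Im z)%:C * 'i) = `|complex.Im z|.
  by rewrite cmodM cmodC cmodE /= expr0n expr1n add0r sqrtr1 mulr1.
by rewrite cmodC; case: z => x y; simpc.
Qed.

Lemma ReD z w : complex.Re (z + w) = complex.Re z + complex.Re w.
Proof. by case: z w => [? ?] [? ?]. Qed.
Lemma ImD z w : complex.Im (z + w) = complex.Im z + complex.Im w.
Proof. by case: z w => [? ?] [? ?]. Qed.
Lemma ReN z : complex.Re (- z) = - complex.Re z.
Proof. by case: z. Qed.
Lemma ImN z : complex.Im (- z) = - complex.Im z.
Proof. by case: z. Qed.
Lemma ReM z w : complex.Re (z * w) =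
  complex.Re z * complex.Re w - complex.Im z * complex.Im w.
Proof. by case: z w => [? ?] [? ?]. Qed.
Lemma ImM z w : complex.Im (z * w) =
  complex.Re z * complex.Im w + complex.Im z * complex.Re w.
Proof. by case: z w => [? ?] [? ?]. Qed.

Lemma ReC x : complex.Re x%:C = x. Proof. by []. Qed.
Lemma ImC x : complex.Im x%:C = 0. Proof. by []. Qed.

Lemma complex_eq z w : complex.Re z = complex.Re w ->
  complex.Im z = complex.Im w -> z = w.
Proof. by case: z w => [? ?] [? ?] /= -> ->. Qed.

Lemma cmod_sub_le z w : cmod z - cmod w <= cmod (z - w).
Proof. by rewrite lerBlDr; apply: le_trans _ (cmodD _ _); rewrite subrK. Qed.

Lemma cmod_sum (I : Type) (s : seq I) (P : pred I) (f : I -> R[i]) :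
  cmod (\sum_(i <- s | P i) f i) <= \sum_(i <- s | P i) cmod (f i).
Proof.
elim/big_rec2: _ => [|i y1 y2 _ H]; first by rewrite cmod0.
by apply: le_trans (cmodD _ _) _; rewrite lerD2l.
Qed.

End Modulus.

Section Topology.
Context {R : realType}.
Implicit Types (z w : R[i]).

(** The balls of [R[i]^o] have radii in [R[i]]; from here on all limits are
    expressed by real radii. *)
Lemma near_cmodP z (P : R[i] -> Prop) :
  (\forall w \near (z : R[i]^o), P w) <->
  exists2 d : R, 0 < d & forall w, cmod (w - z) < d -> P w.
Proof.
split.
  move=> /(@nbhs_ballP _ R[i]^o) [e /= e0 He].
  exists (complex.Re e).
    by move: e0; case: (e) => a b; rewrite ltcE /= => /andP[_].
  move=> w Hw; apply: He; rewrite /ball /=.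
  rewrite -opprB normrN normcE.
  move: e0 Hw; case: (e) => a b; rewrite ltcE /= => /andP[/eqP -> _].
  by rewrite ltcR.
move=> [d d0 H]; apply/(@nbhs_ballP _ R[i]^o); exists d%:C; first by rewrite /= ltcR.
move=> w; rewrite /ball /= -opprB normrN normcE ltcR => ?; exact: H.
Qed.

Lemma near_dnbhs_cmodP z (P : R[i] -> Prop) :
  (\forall w \near (z : R[i]^o)^', P w) <->
  exists2 d : R, 0 < d & forall w, w != z -> cmod (w - z) < d -> P w.
Proof.
have -> : (\forall w \near (z : R[i]^o)^', P w) <->
   \forall w \near (z : R[i]^o), w != z -> P w.
  by rewrite /dnbhs /within /=.
rewrite near_cmodP; split=> -[d d0 H]; exists d => // w; [move=> *; exact: H|].
by move=> + wz; apply: H.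
Qed.

Lemma cvg_cmodP (u : nat -> R[i]) (l : R[i]) :
  ((u : nat -> R[i]^o) @ \oo --> (l : R[i]^o)) <->
  (forall e : R, 0 < e -> exists N : nat, forall n, (N <= n)%N -> cmod (u n - l) < e).
Proof.
split.
  move=> H e e0.
  have : \forall w \near (l : R[i]^o), cmod (w - l) < e.
    by apply/near_cmodP; exists e.
  by move=> /H /= [N _ HN]; exists N => n Nn; exact: HN.
move=> H; move=> A /near_cmodP [d d0 HA].
have [N HN] := H _ d0.
by exists N => // n /= Nn; apply: HA; apply: HN.
Qed.

(** The increments are compared through the real modulus, because the norm of
    [R[i]^o] takes its values in [R[i]]. *)
Definition cdiff (f : R[i] -> R[i]) z (c : R[i]) : Prop :=
  forall e : R, 0 < e -> exists2 d : R, 0 < d &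
    forall h, cmod h < d -> cmod (f (z + h) - f z - c * h) <= e * cmod h.

Lemma cderivableP f z : cderivable f z <-> exists c, cdiff f z c.
Proof.
split.
  move=> H; exists ('D_1 (f : R[i]^o -> R[i]^o) z : R[i]) => e e0.
  have /(@cvg_ex _) /= [l Hl] := H.
  have -> : ('D_1 (f : R[i]^o -> R[i]^o) z) = l by rewrite /derive; apply: cvg_lim.
  have : \forall w \near (l : R[i]^o), cmod (w - l) < e.
    by apply/near_cmodP; exists e.
  move=> /Hl /near_dnbhs_cmodP [d d0 Hd]; exists d => // h hd.
  have [->|h0] := eqVneq h 0.
    by rewrite mulr0 addr0 subrr subr0 cmod0 mulr0.
  have := Hd h h0; rewrite subr0 => /(_ hd) /ltW.
  rewrite -(ler_pM2r (_ : 0 < cmod h)) ?cmod_gt0 // -cmodM.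
  apply: le_trans; rewrite le_eqVlt; apply/orP; left; apply/eqP; congr cmod.
  rewrite /= /GRing.scale /= mulr1 mulrBl mulrAC mulVf // mul1r.
  by rewrite [h + z]addrC.
move=> [c Hc]; apply/cvg_ex; exists c.
move=> A /near_cmodP [d d0 HA]; apply/near_dnbhs_cmodP.
have d20 : 0 < d / 2 by rewrite divr_gt0.
have [d' d'0 Hd'] := Hc _ d20; exists d' => // h h0; rewrite subr0 => hd.
apply: HA; have := Hd' _ hd.
have -> : f (z + h) - f z - c * h =
   (h^-1 *: ((f (h *: (1 : R[i]^o) + z) : R[i]^o) - f z) - c) * h.
  by rewrite /GRing.scale /= mulr1 mulrBl mulrAC mulVf // mul1r [h + z]addrC.
rewrite cmodM ler_pM2r ?cmod_gt0 // => /le_lt_trans; apply.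
by rewrite gtr_pMr // invf_lt1 // ltr1n.
Qed.

End Topology.

(** * Complex differentiation and the exponential *)

Section Calculus.
Context {R : realType}.
Implicit Types (z w : R[i]) (f g : R[i] -> R[i]).

(** Gives access to the differentiation rules of normed modules. *)
Lemma cderivable_diffP f z :
  cderivable f z <-> differentiable (f : R[i]^o -> R[i]^o) (z : R[i]^o).
Proof. exact: (@derivable1_diffP R[i]). Qed.

Lemma cderivable_cst c z : cderivable (fun=> c) z.
Proof. exact: (@derivable_cst R[i]). Qed.

Lemma cderivable_id z : cderivable id z.
Proof. exact: (@derivable_id R[i]). Qed.

Lemma cderivableD f g z : cderivable f z -> cderivable g z ->
  cderivable (fun w => f w + g w) z.
Proof. exact: (@derivableD R[i]). Qed.

Lemma cderivableN f z : cderivable f z -> cderivable (fun w => - f w) z.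
Proof. exact: (@derivableN R[i]). Qed.

Lemma cderivableB f g z : cderivable f z -> cderivable g z ->
  cderivable (fun w => f w - g w) z.
Proof. by move=> df dg; exact: (cderivableD df (cderivableN dg)). Qed.

Lemma cderivableM f g z : cderivable f z -> cderivable g z ->
  cderivable (fun w => f w * g w) z.
Proof. exact: (@derivableM R[i]). Qed.

Lemma cderivableV f z : f z != 0 -> cderivable f z ->
  cderivable (fun w => (f w)^-1) z.
Proof. by move=> ? ?; apply: (@derivableV R[i]). Qed.

Lemma cderivable_comp f g z : cderivable f z -> cderivable g (f z) ->
  cderivable (fun w => g (f w)) z.
Proof.
move=> /cderivable_diffP df /cderivable_diffP dg; apply/cderivable_diffP.
exact: (differentiable_comp df dg).
Qed.

End Calculus.

(* Conversion attempts between two derivability statements would unfold the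
   whole normed-module structure of [R[i]^o]. *)
#[global] Opaque cderivable.

Section CalculusRules.
Context {R : realType}.
Implicit Types (z w : R[i]) (f g : R[i] -> R[i]).

Lemma cderivableX f z n : cderivable f z -> cderivable (fun w => f w ^+ n) z.
Proof.
move=> df; elim: n => [|n IH]; first exact: cderivable_cst.
rewrite (_ : (fun w => _) = (fun w => f w * f w ^+ n)).
  exact: cderivableM.
by apply/funext => w; rewrite exprS.
Qed.

Lemma cderivable_sum (I : Type) (s : seq I) (P : pred I) (F : I -> R[i] -> R[i]) z :
  (forall i, P i -> cderivable (F i) z) ->
  cderivable (fun w => \sum_(i <- s | P i) F i w) z.
Proof.
move=> H; elim: s => [|i s IH].
  rewrite (_ : (fun w => _) = fun=> 0); first exact: cderivable_cst.
  by apply/funext => w; rewrite big_nil.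
rewrite (_ : (fun w => _) = (fun w => (if P i then F i w else 0) + \sum_(i <- s | P i) F i w)).
  apply: cderivableD; last exact: IH.
  by case Pi: (P i); [exact: H | exact: cderivable_cst].
by apply/funext => w; rewrite big_cons; case: ifPn => //; rewrite add0r.
Qed.

Lemma cderivable_local f g z : (exists2 d : R, 0 < d & forall w, cmod (w - z) < d -> f w = g w) ->
  cderivable f z -> cderivable g z.
Proof.
move=> [d d0 H] /cderivableP [c Hc]; apply/cderivableP; exists c => e e0.
have [d' d'0 Hd'] := Hc e e0.
exists (Num.min d d'); first by rewrite lt_min d0.
move=> h; rewrite lt_min => /andP[hd hd'].
rewrite -(H (z + h)); last by rewrite addrC addKr.
by rewrite -(H z) ?Hd' // subrr cmod0.
Qed.

Lemma cderivable_continuous f z : cderivable f z ->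
  forall e : R, 0 < e -> exists2 d : R, 0 < d &
    forall w, cmod (w - z) < d -> cmod (f w - f z) < e.
Proof.
move=> /cderivableP [c Hc] e e0.
have [d d0 Hd] := Hc 1 ltr01.
have K0 : 0 < 1 + cmod c by rewrite ltr_pwDl // cmod_ge0.
exists (Num.min d (e / (1 + cmod c))); first by rewrite lt_min d0 divr_gt0.
move=> w; rewrite lt_min => /andP[/Hd]; rewrite mul1r ltr_pdivlMr // => H1 H2.
have E : z + (w - z) = w by rewrite addrC subrK.
rewrite E in H1.
apply: le_lt_trans H2.
have -> : f w - f z = (f w - f z - c * (w - z)) + c * (w - z) by rewrite subrK.
apply: le_trans (cmodD _ _) _.
by rewrite [leRHS]mulrDr mulr1 cmodM [cmod c * _]mulrC lerD2r.
Qed.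

(** A second-order bound is the form in which differentiability of integrals
    and of removable singularities is obtained below. *)
Lemma cderivable_quadratic f z (c : R[i]) (d K : R) : 0 < d ->
  (forall h, cmod h < d -> cmod (f (z + h) - f z - c * h) <= K * cmod h ^+ 2) ->
  cderivable f z.
Proof.
move=> d0 H; apply/cderivableP; exists c => e e0.
have K0 : 0 < 1 + `|K| by rewrite ltr_pwDl.
exists (Num.min d (e / (1 + `|K|))); first by rewrite lt_min d0 divr_gt0.
move=> h; rewrite lt_min => /andP[/H H1]; rewrite ltr_pdivlMr // => H2.
apply: le_trans H1 _; rewrite expr2 mulrA ler_wpM2r ?cmod_ge0 //.
apply: le_trans (ltW H2); rewrite mulrC ler_wpM2l ?cmod_ge0 //.
by rewrite (le_trans (ler_norm _)) // lerDr.
Qed.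

End CalculusRules.

Section ComplexExponential.
Context {R : realType}.
Implicit Types (z w : R[i]) (x y : R).

Lemma Re_cexp z : complex.Re (cexp z) = expR (complex.Re z) * cos (complex.Im z).
Proof. by case: z => x y; rewrite /cexp /= mul0r subr0. Qed.

Lemma Im_cexp z : complex.Im (cexp z) = expR (complex.Re z) * sin (complex.Im z).
Proof. by case: z => x y; rewrite /cexp /= mul0r addr0. Qed.

Lemma cmod_cexp z : cmod (cexp z) = expR (complex.Re z).
Proof.
rewrite cmodE Re_cexp Im_cexp !exprMn -mulrDr cos2Dsin2 mulr1 sqrtr_sqr ger0_norm //.
Qed.

Lemma cexpD z w : cexp (z + w) = cexp z * cexp w.
Proof.
apply: complex_eq.
  by rewrite (ReM (cexp z)) !Re_cexp !Im_cexp ReD ImD expRD cosD; ring.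
by rewrite (ImM (cexp z)) !Re_cexp !Im_cexp ReD ImD expRD sinD; ring.
Qed.

Lemma cexp0 : cexp (0 : R[i]) = 1.
Proof. by apply: complex_eq; rewrite ?Re_cexp ?Im_cexp /= expR0 ?cos0 ?sin0 mul1r. Qed.

Lemma cexpC x : cexp x%:C = (expR x)%:C.
Proof. by apply: complex_eq; rewrite ?Re_cexp ?Im_cexp /= ?cos0 ?sin0 ?mulr1 ?mulr0. Qed.

Definition cexp_rem (j : nat) (w : R[i]) : R[i] :=
  cexp w - \sum_(0 <= l < j) w ^+ l / (l`!)%:R.

Lemma cexp_rem0 w : cexp_rem 0 w = cexp w.
Proof. by rewrite /cexp_rem big_geq // subr0. Qed.

Lemma cexp_remS0 j : cexp_rem j.+1 0 = 0.
Proof.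
rewrite /cexp_rem cexp0 big_nat_recl // expr0 fact0 invr1 mulr1.
by rewrite big1 ?addr0 ?subrr // => l _; rewrite exprS mul0r mul0r.
Qed.

(** Reduces bounds on a complex number to bounds on real parts, to which the mean
    value theorem and the monotonicity of the integral apply. *)
Lemma cmod_le_rotations z (K : R) :
  (forall c : R[i], cmod c = 1 -> complex.Re (c * z) <= K) -> cmod z <= K.
Proof.
have [-> H|z0 H] := eqVneq z 0.
  by have := H 1 (cmod1 (R := R)); rewrite mulr0 cmod0.
have zm : cmod z != 0 by rewrite cmod_eq0.
have := H (z^* / (cmod z)%:C); rewrite cmodM cmodV cmodC cmod_conj ger0_norm ?cmod_ge0 //.
rewrite divff // => /(_ erefl); apply: le_trans.
rewrite mulrAC -fmorphV /= ReM /= mulr0 subr0.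
have -> : complex.Re (z^* * z) = cmod z ^+ 2.
  by rewrite sqr_cmod; case: (z) => a b /=; rewrite mulNr opprK -!expr2.
by rewrite expr2 mulfK.
Qed.

Lemma is_derive_mulr (f : R -> R) (s d a : R) :
  is_derive s 1 f d -> is_derive s 1 (fun x => f x * a) (d * a).
Proof.
move=> fd; have := is_deriveZ a fd; rewrite [a *: d]mulrC.
by rewrite (_ : a \*: f = fun x => f x * a) //; apply/funext => x; rewrite mulrC.
Qed.

Lemma is_derive_mul (f g : R -> R) (s c d : R) :
  is_derive s 1 f c -> is_derive s 1 g d ->
  is_derive s 1 (fun x => f x * g x) (f s * d + g s * c).
Proof. by move=> fc gd; have := is_deriveM fc gd. Qed.

Definition rderiv (f : R -> R[i]) (s : R) (d : R[i]) : Prop :=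
  is_derive s 1 (fun x => complex.Re (f x)) (complex.Re d) /\
  is_derive s 1 (fun x => complex.Im (f x)) (complex.Im d).

Lemma rderivD f g s c d : rderiv f s c -> rderiv g s d ->
  rderiv (fun x => f x + g x) s (c + d).
Proof.
move=> [f1 f2] [g1 g2]; split; rewrite ?ReD ?ImD.
- under eq_fun do rewrite ReD; exact: is_deriveD.
- under eq_fun do rewrite ImD; exact: is_deriveD.
Qed.

Lemma rderivMc f s c d : rderiv f s d -> rderiv (fun x => c * f x) s (c * d).
Proof.
move=> [f1 f2]; split; rewrite ?ReM ?ImM.
- under eq_fun do rewrite ReM.
  by apply: is_deriveB; apply: is_deriveZ.
- under eq_fun do rewrite ImM.
  by apply: is_deriveD; apply: is_deriveZ.
Qed.

Lemma rderiv_cst c s : rderiv (fun=> c) s 0.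
Proof. by split; apply: is_derive_cst. Qed.

Lemma rderiv_cexp w s :
  rderiv (fun x => cexp (x%:C * w)) s (w * cexp (s%:C * w)).
Proof.
have Dl (a : R) : is_derive s 1 (fun x : R => x * a) a.
  by apply: is_derive_eq; rewrite /GRing.scale /= !mulr1 mulr0 add0r.
have De (a : R) : is_derive s 1 (fun x : R => expR (x * a)) (a * expR (s * a)).
  by apply: (is_derive_eq (@is_derive1_comp R expR _ _ _ _ (is_derive_expR _) (Dl a))); rewrite mulrC.
have Dc (a : R) : is_derive s 1 (fun x : R => cos (x * a)) (a * - sin (s * a)).
  by apply: (is_derive_eq (@is_derive1_comp R cos _ _ _ _ (is_derive_cos _) (Dl a))); rewrite mulrC.
have Ds (a : R) : is_derive s 1 (fun x : R => sin (x * a)) (a * cos (s * a)).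
  by apply: (is_derive_eq (@is_derive1_comp R sin _ _ _ _ (is_derive_sin _) (Dl a))); rewrite mulrC.
split; rewrite ?(ReM w) ?(ImM w) !Re_cexp !Im_cexp !ReM !ImM ReC ImC !mul0r ?subr0 ?addr0.
- under eq_fun do rewrite Re_cexp ReM ImM ReC ImC !mul0r subr0 addr0.
  apply: (is_derive_eq (is_derive_mul (De _) (Dc _))).
  by rewrite /GRing.scale /=; ring.
- under eq_fun do rewrite Im_cexp ReM ImM ReC ImC !mul0r subr0 addr0.
  apply: (is_derive_eq (is_derive_mul (De _) (Ds _))).
  by rewrite /GRing.scale /=; ring.
Qed.

Lemma rderiv_powerS w l s :
  rderiv (fun x => (x%:C * w) ^+ l.+1 / (l.+1)`!%:R) s
    (w * ((s%:C * w) ^+ l / l`!%:R)).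
Proof.
have E k x : (x%:C * w) ^+ k / k`!%:R = (x ^+ k / k`!%:R)%:C * w ^+ k.
  by rewrite exprMn rmorphM rmorphXn /= fmorphV rmorph_nat mulrAC.
have Dp : is_derive s 1 (fun x : R => x ^+ l.+1 / (l.+1)`!%:R) (s ^+ l / l`!%:R).
  have -> : (fun x : R => x ^+ l.+1 / (l.+1)`!%:R) =
      (fun x => (l.+1)`!%:R^-1 *: x ^+ l.+1).
    by apply/funext => x; rewrite mulrC.
  have D : is_derive s 1 (fun x : R => x ^+ l.+1) (l.+1%:R * s ^+ l).
    by apply: DeriveDef; [exact: exprn_derivable | rewrite exp_derive [LHS]mulr1].
  apply: (is_derive_eq (is_deriveZ _ D)); rewrite /GRing.scale /=.
  rewrite factS natrM invfM mulrCA mulrA -mulrA.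
  rewrite -[X in _ = X]mul1r -[X in _ = X * _](@divff _ (l.+1)%:R) ?pnatr_eq0 //=.
  ring.
rewrite E mulrCA -exprS.
split; rewrite ?ReM ?ImM /= !mul0r ?subr0 ?addr0.
- under eq_fun do rewrite E ReM /= mul0r subr0.
  exact: is_derive_mulr.
- under eq_fun do rewrite E ImM /= mul0r addr0.
  exact: is_derive_mulr.
Qed.

Lemma rderiv_cexp_rem j w s :
  rderiv (fun x => cexp_rem j.+1 (x%:C * w)) s (w * cexp_rem j (s%:C * w)).
Proof.
elim: j => [|j IH].
  have -> : (fun x : R => cexp_rem 1 (x%:C * w)) = (fun x => cexp (x%:C * w) + (-1)).
    apply/funext => x; rewrite /cexp_rem big_nat_recl // big_geq // addr0.
    by rewrite expr0 fact0 divr1.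
  rewrite cexp_rem0 -[X in rderiv _ _ X]addr0.
  by apply: rderivD; [exact: rderiv_cexp | exact: rderiv_cst].
have -> : (fun x : R => cexp_rem j.+2 (x%:C * w)) = (fun x => cexp_rem j.+1 (x%:C * w)
    + (-1) * ((x%:C * w) ^+ j.+1 / (j.+1)`!%:R)).
  by apply/funext => x; rewrite /cexp_rem big_nat_recr //= opprD addrA mulN1r.
have -> : w * cexp_rem j.+1 (s%:C * w) = w * cexp_rem j (s%:C * w) +
    (-1) * (w * ((s%:C * w) ^+ j / j`!%:R)).
  by rewrite /cexp_rem big_nat_recr //= mulN1r -mulrBr opprD addrA.
by apply: rderivD; [exact: IH | apply: rderivMc; exact: rderiv_powerS].
Qed.

(** By induction on [j]: along the ray [s |-> s w] the derivative of the remainder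
    of order [j + 1] is [w] times the remainder of order [j]. *)
Lemma cmod_cexp_rem j w : cmod (cexp_rem j w) <= cmod w ^+ j * expR (cmod w).
Proof.
have H s : 0 <= s <= 1 ->
   cmod (cexp_rem j (s%:C * w)) <= cmod w ^+ j * expR (cmod w).
  move: s; elim: j => [|j IH] s /andP[s0 s1].
    rewrite cexp_rem0 expr0 mul1r cmod_cexp ler_expR ReM /= mul0r subr0.
    apply: (@le_trans _ _ (s * cmod w)); first by rewrite ler_wpM2l ?Re_le_cmod.
    by rewrite ler_piMl ?cmod_ge0.
  apply: cmod_le_rotations => c c1.
  have D x : is_derive x 1 (fun x : R => complex.Re (c * cexp_rem j.+1 (x%:C * w)))
     (complex.Re (c * (w * cexp_rem j (x%:C * w)))).
    by have [] := rderivMc c (rderiv_cexp_rem j w x).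
  have [|y /andP[y0 ys]] := @MVT_segment R _ _ 0 s s0 (fun x _ => D x).
    apply: continuous_subspaceT => x; apply: differentiable_continuous.
    by apply/derivable1_diffP; have [] := D x.
  rewrite mul0r cexp_remS0 mulr0 subr0 subr0 => ->.
  move: y0 ys; rewrite !bnd_simp => y0 ys.
  apply: le_trans (_ : cmod w * (cmod w ^+ j * expR (cmod w)) <= _); last first.
    by rewrite exprS mulrA.
  apply: le_trans (_ : cmod (c * (w * cexp_rem j (y%:C * w))) <= _).
    apply: le_trans (ler_norm _) _; rewrite normrM [X in _ * X]ger0_norm //.
    by apply: le_trans (abs_Re_le_cmod _); rewrite ler_piMr.
  rewrite !cmodM c1 mul1r ler_wpM2l ?cmod_ge0 // IH // y0 /=.
  exact: le_trans ys s1.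
by have := H 1; rewrite mul1r => ->; rewrite ?ler01 ?lexx.
Qed.

Lemma cderivable_cexp z : cderivable cexp z.
Proof.
apply: (@cderivable_quadratic _ _ _ (cexp z) 1 (expR (complex.Re z) * expR 1)) => //.
move=> h h1.
have -> : cexp (z + h) - cexp z - cexp z * h = cexp z * cexp_rem 2 h.
  rewrite cexpD /cexp_rem !big_nat_recr //= big_geq // add0r expr0 expr1 !divr1.
  ring.
rewrite cmodM cmod_cexp -mulrA ler_wpM2l ?expR_ge0 // mulrC.
apply: le_trans (cmod_cexp_rem _ _) _.
by rewrite ler_wpM2l ?exprn_ge0 ?cmod_ge0 // ler_expR ltW.
Qed.

End ComplexExponential.

(** * Integrals over segments and Goursat's lemma *)

Section SegmentIntegrals.
Context {R : realType}.
Implicit Types (a b c e k : R) (f g : R -> R).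

Definition segint a b f : R := \int[@lebesgue_measure R]_(x in `[a, b]) f x.

Definition cont_on a b f : Prop :=
  forall x, a <= x <= b -> forall e, 0 < e ->
    exists2 d : R, 0 < d & forall y, `|y - x| < d -> `|f y - f x| < e.

Lemma cont_on_within a b f : cont_on a b f -> {within `[a, b], continuous f}.
Proof.
move=> H; apply: continuous_in_subspaceT => x; rewrite inE /= in_itv /= => /H Hx.
apply/cvgrPdist_lt => e /Hx [d d0 Hd]; near=> y.
rewrite distrC; apply: Hd; rewrite distrC; near: y.
exact: (@cvgr_dist_lt _ _ _ _ _ id x cvg_id).
Unshelve. all: by end_near. Qed.

Lemma cont_onD a b f g : cont_on a b f -> cont_on a b g ->
  cont_on a b (fun x => f x + g x).
Proof.
move=> Hf Hg x xab e e0; have e20 : 0 < e / 2 by rewrite divr_gt0.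
have [d d0 Hd] := Hf x xab _ e20; have [d' d'0 Hd'] := Hg x xab _ e20.
exists (Num.min d d'); first by rewrite lt_min d0.
move=> y; rewrite lt_min => /andP[/Hd h1 /Hd' h2].
have -> : f y + g y - (f x + g x) = (f y - f x) + (g y - g x) by ring.
by rewrite (splitr e) (le_lt_trans (ler_normD _ _)) // ltrD.
Qed.

Lemma cont_onZ a b f k : cont_on a b f -> cont_on a b (fun x => k * f x).
Proof.
move=> Hf x xab e e0.
have k0 : 0 < `|k| + 1 by rewrite ltr_wpDl.
have [d d0 Hd] := Hf x xab _ (divr_gt0 e0 k0).
exists d => // y /Hd; rewrite ltr_pdivlMr // => h.
rewrite -mulrBr normrM; apply: le_lt_trans h.
by rewrite mulrC ler_wpM2l // lerDl.
Qed.

Lemma cont_onN a b f : cont_on a b f -> cont_on a b (fun x => - f x).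
Proof.
move=> /(@cont_onZ _ _ _ (-1)).
by rewrite (_ : (fun x => -1 * f x) = fun x => - f x) //; apply/funext => x; rewrite mulN1r.
Qed.

Lemma cont_onB a b f g : cont_on a b f -> cont_on a b g ->
  cont_on a b (fun x => f x - g x).
Proof. by move=> Hf Hg; apply: cont_onD => //; apply: cont_onN. Qed.

Lemma cont_on_cst a b k : cont_on a b (fun=> k).
Proof. by move=> x _ e e0; exists 1 => // y _; rewrite subrr normr0. Qed.

Lemma cont_on_integrable a b f : cont_on a b f ->
  (@lebesgue_measure R).-integrable `[a, b] (EFin \o f).
Proof.
move=> H; apply: continuous_compact_integrable; first exact: segment_compact.
exact: cont_on_within.
Qed.

Lemma segintD a b f g : cont_on a b f -> cont_on a b g ->
  segint a b (fun x => f x + g x) = segint a b f + segint a b g.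
Proof. by move=> Hf Hg; rewrite /segint RintegralD //; apply: cont_on_integrable. Qed.

Lemma segintB a b f g : cont_on a b f -> cont_on a b g ->
  segint a b (fun x => f x - g x) = segint a b f - segint a b g.
Proof. by move=> Hf Hg; rewrite /segint RintegralB //; apply: cont_on_integrable. Qed.

Lemma segintZ a b f k : cont_on a b f ->
  segint a b (fun x => k * f x) = k * segint a b f.
Proof. by move=> Hf; rewrite /segint RintegralZl //; apply: cont_on_integrable. Qed.

Lemma segint_cst a b k : a <= b -> segint a b (fun=> k) = k * (b - a).
Proof.
move=> ab; rewrite /segint Rintegral_cst //.
rewrite [X in fine X](_ : _ = lebesgue_measure [set` `[a, b]%R]) //.
rewrite lebesgue_measure_itv /= lte_fin.
case: ltP => //= ba; have -> : b = a by apply/eqP; rewrite eq_le ba ab.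
by rewrite subrr mulr0.
Qed.

Lemma eq_segint a b f g : (forall x, a <= x <= b -> f x = g x) ->
  segint a b f = segint a b g.
Proof. by move=> H; apply: eq_Rintegral => x; rewrite inE /= in_itv /=; exact: H. Qed.

Lemma segint_split a b c f : a <= b <= c -> cont_on a c f ->
  segint a c f = segint a b f + segint b c f.
Proof.
move=> /andP[ab bc] /cont_on_integrable fi; apply/eqP; rewrite addrC -subr_eq; apply/eqP.
rewrite /segint (@Rintegral_itvB _ f (BLeft a) (BRight c) b) ?bnd_simp //.
rewrite Rintegral_itv_obnd_cbnd //; apply: integrableS fi => //.
by apply: subset_itvr; rewrite bnd_simp.
Qed.

Lemma le_segint a b f g : cont_on a b f -> cont_on a b g ->
  (forall x, a <= x <= b -> f x <= g x) -> segint a b f <= segint a b g.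
Proof.
move=> Hf Hg H; apply: le_Rintegral => //; exact: cont_on_integrable.
Qed.

Lemma segint_near_cst a b f k e : a <= b -> cont_on a b f ->
  (forall x, a <= x <= b -> `|f x - k| <= e) ->
  `|segint a b f - k * (b - a)| <= e * (b - a).
Proof.
move=> ab Hf H; rewrite -!segint_cst // -segintB //; last exact: cont_on_cst.
rewrite ler_norml -[X in X <= _]mulN1r -segintZ; last exact: cont_on_cst.
have Ck : cont_on a b (fun=> e) := @cont_on_cst a b e.
have Cf : cont_on a b (fun x => f x - k) := cont_onB Hf (@cont_on_cst a b k).
apply/andP; split; apply: le_segint => //; first exact: cont_onZ.
  by move=> x /H; rewrite ler_norml mulN1r => /andP[].
by move=> x /H; rewrite ler_norml => /andP[].
Qed.

End SegmentIntegrals.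

Section Goursat.
Context {R : realType}.
Variables (u v : R -> R -> R).
Implicit Types (a c w h x y : R).

(** First-order expansion of [u + i v] at a point, the Cauchy-Riemann equations
    being built into the shape of its linear part. *)
Definition cr_at x0 y0 : Prop := exists p q : R, forall e : R, 0 < e ->
  exists2 d : R, 0 < d & forall x y, `|x - x0| < d -> `|y - y0| < d ->
    `|u x y - (u x0 y0 + p * (x - x0) - q * (y - y0))| <= e * (`|x - x0| + `|y - y0|)
 /\ `|v x y - (v x0 y0 + q * (x - x0) + p * (y - y0))| <= e * (`|x - x0| + `|y - y0|).

(** Real part of the integral of [u + i v] along the boundary of
    [[a, a + w]] x [[c, c + h]]. *)
Definition rectint a c w h : R :=
  segint a (a + w) (fun x => u x c - u x (c + h)) -
  segint c (c + h) (fun y => v (a + w) y - v a y).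

Definition cr_on a c w h := forall x y, a <= x <= a + w -> c <= y <= c + h -> cr_at x y.

Lemma cr_cont x0 y0 : cr_at x0 y0 -> forall e : R, 0 < e ->
  exists2 d : R, 0 < d & forall x y, `|x - x0| < d -> `|y - y0| < d ->
    `|u x y - u x0 y0| < e /\ `|v x y - v x0 y0| < e.
Proof.
move=> [p [q Hpq]] e e0; have [d d0 Hd] := Hpq 1 ltr01.
pose K := 2 * (`|p| + `|q| + 1).
have K0 : 0 < K by rewrite mulr_gt0 // ltr_wpDl // addr_ge0.
exists (Num.min d (e / K)); first by rewrite lt_min d0 divr_gt0.
move=> x y; rewrite !lt_min => /andP[xd xe] /andP[yd ye].
have [Hu Hv] := Hd x y xd yd.
rewrite ltr_pdivlMr // in xe; rewrite ltr_pdivlMr // in ye.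
have Px : `|p * (x - x0)| <= `|p| * `|x - x0| by rewrite normrM.
have Py : `|p * (y - y0)| <= `|p| * `|y - y0| by rewrite normrM.
have Qx : `|q * (x - x0)| <= `|q| * `|x - x0| by rewrite normrM.
have Qy : `|q * (y - y0)| <= `|q| * `|y - y0| by rewrite normrM.
have B : (`|p| + `|q| + 1) * (`|x - x0| + `|y - y0|) < e.
  move: xe ye; rewrite /K; set s := `|p| + _ + _; set X := `|x - x0|; set Y := `|y - y0|.
  by lra.
have nx := normr_ge0 (x - x0); have ny := normr_ge0 (y - y0).
have np := normr_ge0 p; have nq := normr_ge0 q.
have m1 := mulr_ge0 np nx. have m2 := mulr_ge0 np ny.
have m3 := mulr_ge0 nq nx. have m4 := mulr_ge0 nq ny.
split.
  rewrite (_ : u x y - u x0 y0 = (u x y - (u x0 y0 + p * (x - x0) - q * (y - y0)))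
     + p * (x - x0) - q * (y - y0)); last by ring.
  apply: le_lt_trans (ler_normB _ _) _.
  apply: le_lt_trans (lerD (ler_normD _ _) (lexx _)) _.
  lra.
rewrite (_ : v x y - v x0 y0 = (v x y - (v x0 y0 + q * (x - x0) + p * (y - y0)))
     + q * (x - x0) + p * (y - y0)); last by ring.
apply: le_lt_trans (ler_normD _ _) _.
apply: le_lt_trans (lerD (ler_normD _ _) (lexx _)) _.
lra.
Qed.

Lemma cr_cont_sections a c w h : cr_on a c w h ->
  (forall y, c <= y <= c + h -> cont_on a (a + w) (u^~ y)) /\
  (forall x, a <= x <= a + w -> cont_on c (c + h) (v x)).
Proof.
move=> H; split.
  move=> y yc x xa e e0; have [d d0 Hd] := cr_cont (H x y xa yc) e0.
  by exists d => // x' Hx'; have [] := Hd x' y Hx'; rewrite ?subrr ?normr0.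
move=> x xa y yc e e0; have [d d0 Hd] := cr_cont (H x y xa yc) e0.
by exists d => // y' Hy'; have [] := Hd x y'; rewrite ?subrr ?normr0.
Qed.

(** The boundary integral of an affine holomorphic function vanishes, so that only
    the error of the first-order expansion contributes. *)
Lemma rectint_local x0 y0 : cr_at x0 y0 -> forall e : R, 0 < e ->
  exists2 d : R, 0 < d & forall a c w h, cr_on a c w h ->
    a <= x0 <= a + w -> c <= y0 <= c + h -> w + h < d ->
    `|rectint a c w h| <= e * (w + h) ^+ 2.
Proof.
move=> [p [q Hpq]] e e0.
have e20 : 0 < e / 2 by rewrite divr_gt0.
have [d d0 Hd] := Hpq _ e20; exists d => // a c w h cr /andP[ax xa] /andP[cy yc] whd.
have [Hu Hv] := cr_cont_sections cr.
have w0 : 0 <= w by lra.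
have h0 : 0 <= h by lra.
have cc : c <= c <= c + h by lra.
have cch : c <= c + h <= c + h by lra.
have aa : a <= a <= a + w by lra.
have aaw : a <= a + w <= a + w by lra.
have dist x y : a <= x <= a + w -> c <= y <= c + h ->
    [/\ `|x - x0| < d, `|y - y0| < d & `|x - x0| + `|y - y0| <= w + h].
  move=> /andP[x1 x2] /andP[y1 y2].
  have X : `|x - x0| <= w by rewrite ler_norml; lra.
  have Y : `|y - y0| <= h by rewrite ler_norml; lra.
  by split; lra.
have bd x y : a <= x <= a + w -> c <= y <= c + h ->
   `|u x y - (u x0 y0 + p * (x - x0) - q * (y - y0))| <= e / 2 * (w + h) /\
   `|v x y - (v x0 y0 + q * (x - x0) + p * (y - y0))| <= e / 2 * (w + h).
  move=> xa' yc'; have [X Y XY] := dist x y xa' yc'; have [U V] := Hd x y X Y.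
  by split; [apply: le_trans U _ | apply: le_trans V _]; rewrite ler_wpM2l // ltW.
(* The affine part contributes [q h w] to both integrals, hence nothing to
   their difference. *)
have I1 : `|segint a (a + w) (fun x => u x c - u x (c + h)) - q * h * w| <= e * (w + h) * w.
  have := @segint_near_cst R a (a + w) (fun x => u x c - u x (c + h)) (q * h) (e * (w + h)).
  rewrite [a + w - a]addrAC subrr add0r; apply; first by lra.
    by apply: cont_onB; apply: Hu.
  move=> x xa'; have [U1 _] := bd x c xa' cc; have [U2 _] := bd x (c + h) xa' cch.
  rewrite (_ : _ - _ = (u x c - (u x0 y0 + p * (x - x0) - q * (c - y0)))
     - (u x (c + h) - (u x0 y0 + p * (x - x0) - q * (c + h - y0)))); last by ring.
  by apply: le_trans (ler_normB _ _) _; lra.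
have I2 : `|segint c (c + h) (fun y => v (a + w) y - v a y) - q * w * h| <= e * (w + h) * h.
  have := @segint_near_cst R c (c + h) (fun y => v (a + w) y - v a y) (q * w) (e * (w + h)).
  rewrite [c + h - c]addrAC subrr add0r; apply; first by lra.
    by apply: cont_onB; apply: Hv.
  move=> y yc'; have [_ U1] := bd a y aa yc'; have [_ U2] := bd (a + w) y aaw yc'.
  rewrite (_ : _ - _ = (v (a + w) y - (v x0 y0 + q * (a + w - x0) + p * (y - y0)))
     - (v a y - (v x0 y0 + q * (a - x0) + p * (y - y0)))); last by ring.
  by apply: le_trans (ler_normB _ _) _; lra.
rewrite /rectint; set A := segint _ _ _ in I1 *; set B := segint _ _ _ in I2 *.
rewrite (_ : A - B = (A - q * h * w) - (B - q * w * h)); last by ring.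
apply: le_trans (ler_normB _ _) _; apply: le_trans (lerD I1 I2) _.
by rewrite -mulrDr expr2 mulrA.
Qed.

Lemma rectint_splitx a c w h : 0 <= w -> 0 <= h -> cr_on a c w h ->
  rectint a c w h = rectint a c (w / 2) h + rectint (a + w / 2) c (w / 2) h.
Proof.
move=> w0 h0 cr; have [Hu Hv] := cr_cont_sections cr.
have cc : c <= c <= c + h by lra.
have cch : c <= c + h <= c + h by lra.
have E : a + w / 2 + w / 2 = a + w by rewrite -addrA -splitr.
rewrite /rectint E.
rewrite (@segint_split _ a (a + w / 2) (a + w)); last 2 first.
- by lra.
- by apply: cont_onB; apply: Hu.
rewrite (@eq_segint _ c (c + h) (fun y => v (a + w) y - v a y)
  (fun y => (v (a + w / 2) y - v a y) + (v (a + w) y - v (a + w / 2) y))); last first.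
  by move=> y _; ring.
rewrite [X in _ - X = _]segintD; last 2 first.
- by apply: cont_onB; apply: Hv; lra.
- by apply: cont_onB; apply: Hv; lra.
by ring.
Qed.

Lemma rectint_splity a c w h : 0 <= w -> 0 <= h -> cr_on a c w h ->
  rectint a c w h = rectint a c w (h / 2) + rectint a (c + h / 2) w (h / 2).
Proof.
move=> w0 h0 cr; have [Hu Hv] := cr_cont_sections cr.
have E : c + h / 2 + h / 2 = c + h by rewrite -addrA -splitr.
rewrite /rectint E.
rewrite (@segint_split _ c (c + h / 2) (c + h)); last 2 first.
- by lra.
- by apply: cont_onB; apply: Hv; lra.
rewrite (@eq_segint _ a (a + w) (fun x => u x c - u x (c + h))
  (fun x => (u x c - u x (c + h / 2)) + (u x (c + h / 2) - u x (c + h)))); last first.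
  by move=> y _; ring.
rewrite [X in X - _ = _]segintD; last 2 first.
- by apply: cont_onB; apply: Hu; lra.
- by apply: cont_onB; apply: Hu; lra.
by ring.
Qed.

Lemma cr_on_sub a c w h a' c' w' h' : a <= a' -> a' + w' <= a + w ->
  c <= c' -> c' + h' <= c + h -> cr_on a c w h -> cr_on a' c' w' h'.
Proof. by move=> *; move=> x y *; match goal with H : cr_on _ _ _ _ |- _ => apply: H end; lra. Qed.

Lemma rectint_split4 a c w h : 0 <= w -> 0 <= h -> cr_on a c w h ->
  rectint a c w h = rectint a c (w / 2) (h / 2) + rectint a (c + h / 2) (w / 2) (h / 2) +
    (rectint (a + w / 2) c (w / 2) (h / 2) + rectint (a + w / 2) (c + h / 2) (w / 2) (h / 2)).
Proof.
move=> w0 h0 cr; have w20 : 0 <= w / 2 by rewrite divr_ge0.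
rewrite rectint_splitx // (rectint_splity w20 h0); last by apply: cr_on_sub cr; lra.
by rewrite (rectint_splity w20 h0) //; apply: cr_on_sub cr; lra.
Qed.

Let half_side (A W a w w' : R) : A <= a -> a + w <= A + W -> 0 <= w -> w' = w / 2 ->
  [/\ a + w' <= A + W, A <= a + w' & a + w' + w' <= A + W].
Proof. by move=> *; split; lra. Qed.

Section Bisection.
Variables (A C W H e : R).
Hypotheses (W0 : 0 <= W) (H0 : 0 <= H) (crD : cr_on A C W H).

Let wd n : R := W / 2 ^+ n.
Let hd n : R := H / 2 ^+ n.

Let bad n (s : R * R) : Prop :=
  [/\ A <= s.1, s.1 + wd n <= A + W, C <= s.2, s.2 + hd n <= C + H &
      e * (wd n + hd n) ^+ 2 < `|rectint s.1 s.2 (wd n) (hd n)|].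

Let step n (s : R * R) : R * R :=
  let s1 := (s.1, s.2) in let s2 := (s.1 + wd n.+1, s.2) in
  let s3 := (s.1, s.2 + hd n.+1) in let s4 := (s.1 + wd n.+1, s.2 + hd n.+1) in
  if `[< bad n.+1 s1 >] then s1 else if `[< bad n.+1 s2 >] then s2
  else if `[< bad n.+1 s3 >] then s3 else s4.

Let corner := fix corner n := if n is m.+1 then step m (corner m) else (A, C).

Let wdS n : wd n.+1 = wd n / 2.
Proof. by rewrite /wd exprSr invfM mulrA. Qed.
Let hdS n : hd n.+1 = hd n / 2.
Proof. by rewrite /hd exprSr invfM mulrA. Qed.
Let wd_ge0 n : 0 <= wd n.
Proof. by rewrite divr_ge0 // exprn_ge0. Qed.
Let hd_ge0 n : 0 <= hd n.
Proof. by rewrite divr_ge0 // exprn_ge0. Qed.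

Let step_bad n s : bad n s -> bad n.+1 (step n s).
Proof.
case: s => a c [/= a1 a2 c1 c2 B]; rewrite /step /=.
have w0 := wd_ge0 n; have h0 := hd_ge0 n.
case: asboolP => [//|n1]; case: asboolP => [//|n2]; case: asboolP => [//|n3].
apply: contrapT => n4; move: B; apply/negP; rewrite -leNgt.
have cr : cr_on a c (wd n) (hd n) by apply: cr_on_sub crD.
rewrite (rectint_split4 w0 h0 cr) -!wdS -!hdS.
have good a' c' : ~ bad n.+1 (a', c') -> A <= a' -> a' + wd n.+1 <= A + W ->
    C <= c' -> c' + hd n.+1 <= C + H ->
    `|rectint a' c' (wd n.+1) (hd n.+1)| <= e * (wd n.+1 + hd n.+1) ^+ 2.
  by move=> nb ? ? ? ?; rewrite leNgt; apply/negP => B; apply: nb; split.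
have w2 := wdS n; have h2 := hdS n.
have g1 := good _ _ n1; have g2 := good _ _ n2.
have g3 := good _ _ n3; have g4 := good _ _ n4.
have [x1 x2 x3] := half_side a1 a2 w0 w2.
have [y1 y2 y3] := half_side c1 c2 h0 h2.
have {}g1 := g1 a1 x1 c1 y1; have {}g2 := g2 x2 x3 c1 y1.
have {}g3 := g3 a1 x1 y2 y3; have {}g4 := g4 x2 x3 y2 y3.
have -> : e * (wd n + hd n) ^+ 2 = 4 * (e * (wd n.+1 + hd n.+1) ^+ 2).
  by rewrite w2 h2; field.
apply: le_trans (ler_normD _ _) _.
apply: le_trans (lerD (ler_normD _ _) (ler_normD _ _)) _.
lra.
Qed.

Let corner_bad n : bad 0 (A, C) -> bad n (corner n).
Proof. by move=> b0; elim: n => [//|n IH]; apply: step_bad. Qed.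

Let step_le n s : s.1 <= (step n s).1 /\ (step n s).1 + wd n.+1 <= s.1 + wd n /\
  s.2 <= (step n s).2 /\ (step n s).2 + hd n.+1 <= s.2 + hd n.
Proof.
have w0 := wd_ge0 n; have h0 := hd_ge0 n; have w2 := wdS n; have h2 := hdS n.
by rewrite /step; do 3 (case: ifP => _ /=; first (repeat split; lra)); repeat split; lra.
Qed.

Let corner_mono m n : (m <= n)%N ->
  [/\ (corner m).1 <= (corner n).1, (corner n).1 + wd n <= (corner m).1 + wd m,
  (corner m).2 <= (corner n).2 & (corner n).2 + hd n <= (corner m).2 + hd m].
Proof.
move=> /subnK <-; elim: (n - m)%N => [|k [IH1 IH2 IH3 IH4]]; first by rewrite add0n.
have [s1 [s2 [s3 s4]]] := step_le (k + m) (corner (k + m)).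
by rewrite addSn /=; split; lra.
Qed.

Let corner_sandwich m n :
  (corner m).1 <= (corner n).1 + wd n /\ (corner m).2 <= (corner n).2 + hd n.
Proof.
have w0 := wd_ge0; have h0 := hd_ge0.
have [mn|/ltnW nm] := leqP m n.
  by have [a b c d] := corner_mono mn; have := w0 n; have := h0 n; lra.
by have [a b c d] := corner_mono nm; have := w0 m; have := h0 m; lra.
Qed.

Lemma rectint_le : 0 < e -> `|rectint A C W H| <= e * (W + H) ^+ 2.
Proof.
move=> e0; rewrite leNgt; apply/negP => B.
have b0 : bad 0 (A, C) by rewrite /bad /wd /hd expr0 !divr1; split.
pose X := [set (corner n).1 | n in setT]; pose Y := [set (corner n).2 | n in setT].
have X_ub n : ubound X ((corner n).1 + wd n).
  by move=> _ [m _ <-]; have [] := corner_sandwich m n.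
have Y_ub n : ubound Y ((corner n).2 + hd n).
  by move=> _ [m _ <-]; have [] := corner_sandwich m n.
have X0 n : (corner n).1 <= sup X by apply: ub_le_sup; [exists ((corner 0).1 + wd 0) | exists n].
have Y0 n : (corner n).2 <= sup Y by apply: ub_le_sup; [exists ((corner 0).2 + hd 0) | exists n].
have X1 n : sup X <= (corner n).1 + wd n.
  by apply: ge_sup; [exists (corner 0).1, 0%N | exact: X_ub].
have Y1 n : sup Y <= (corner n).2 + hd n.
  by apply: ge_sup; [exists (corner 0).2, 0%N | exact: Y_ub].
(* The suprema of the lower left corners are the coordinates of the common
   point of the nested rectangles. *)
have crXY : cr_at (sup X) (sup Y).
  apply: crD.
  - by have := X0 0%N; have := X1 0%N; rewrite /= /wd expr0 divr1 => -> ->.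
  - by have := Y0 0%N; have := Y1 0%N; rewrite /= /hd expr0 divr1 => -> ->.
have [d d0 Hd] := rectint_local crXY e0.
have [n Hn] : exists n, wd n + hd n < d.
  have WH : 0 <= W + H by rewrite addr_ge0.
  exists (Num.bound ((W + H) / d)).
  rewrite /wd /hd -mulrDl ltr_pdivrMr ?exprn_gt0 // mulrC -ltr_pdivrMr //.
  apply: lt_le_trans (archi_boundP _) _; first by rewrite divr_ge0 // ltW.
  by rewrite -natrX ler_nat ltnW // ltn_expl.
have [a1 a2 c1 c2] := corner_bad n b0; apply/negP; rewrite -leNgt.
by apply: Hd => //; [apply: cr_on_sub crD | rewrite X0 X1 | rewrite Y0 Y1].
Qed.

End Bisection.

(** Goursat: a rectangle with a large boundary integral could be bisected into
    ever smaller rectangles around one point, where the first-order expansion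
    makes the integral negligible against the area. *)
Lemma goursat A C W H : 0 <= W -> 0 <= H -> cr_on A C W H -> rectint A C W H = 0.
Proof.
move=> W0 H0 cr; apply/eqP; rewrite -normr_le0; apply/ler_addgt0Pl => e e0.
rewrite addr0.
have K0 : 0 < (W + H) ^+ 2 + 1 by rewrite ltr_wpDl // sqr_ge0.
apply: le_trans (rectint_le W0 H0 cr (divr_gt0 e0 K0)) _.
rewrite mulrAC ler_pdivrMr // ler_wpM2l ?ltW //.
by rewrite ltrDl ltr01.
Qed.

End Goursat.

(** * The mean value property and the identity theorem *)

Section MeanValue.
Context {R : realType}.
Implicit Types (f g : R[i] -> R[i]) (z w a b : R[i]) (r s x y : R).

Lemma cderivable_cr g x0 y0 : cderivable g (x0 +i* y0) ->
  cr_at (fun x y => complex.Re (g (x +i* y))) (fun x y => complex.Im (g (x +i* y))) x0 y0.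
Proof.
move=> /cderivableP [c Hc]; exists (complex.Re c), (complex.Im c) => e e0.
have [d d0 Hd] := Hc _ e0; have d20 : 0 < d / 2 by rewrite divr_gt0.
exists (d / 2) => // x y xd yd.
pose h : R[i] := (x - x0) +i* (y - y0).
have hle : cmod h <= `|x - x0| + `|y - y0| by exact: cmod_le_ReIm.
have hd : cmod h < d by apply: le_lt_trans hle _; rewrite (splitr d) ltrD.
have E : (x0 +i* y0) + h = x +i* y.
  by rewrite /h; apply/eqP; rewrite eq_complex /= ![_ + (_ - _)]addrC !subrK !eqxx.
have H := Hd h hd; rewrite E in H.
have {}H : cmod (g (x +i* y) - g (x0 +i* y0) - c * h) <= e * (`|x - x0| + `|y - y0|).
  by apply: le_trans H _; rewrite ler_wpM2l // ltW.
split.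
  apply: le_trans (le_trans (abs_Re_le_cmod _) H).
  rewrite !ReD !ReN ReM /= le_eqVlt; apply/orP; left; apply/eqP; congr `|_|; ring.
apply: le_trans (le_trans (abs_Im_le_cmod _) H).
rewrite !ImD !ImN ImM /= le_eqVlt; apply/orP; left; apply/eqP; congr `|_|; ring.
Qed.

Definition circ r y : R[i] := (r * cos y) +i* (r * sin y).

Lemma circE r y : 0 < r -> circ r y = cexp (ln r +i* y).
Proof.
move=> r0; apply/eqP; rewrite eq_complex Re_cexp Im_cexp /= lnK ?posrE //.
by rewrite !eqxx.
Qed.

Lemma cmod_circ r y : 0 <= r -> cmod (circ r y) = r.
Proof.
move=> r0; rewrite cmodE /circ /= !exprMn -mulrDr cos2Dsin2 mulr1.
by rewrite sqrtr_sqr ger0_norm.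
Qed.

Lemma cont_on_circ f r c d : 0 < r ->
  (forall y, c <= y <= d -> cderivable f (circ r y)) ->
  cont_on c d (fun y => complex.Re (f (circ r y))) /\
  cont_on c d (fun y => complex.Im (f (circ r y))).
Proof.
move=> r0 H.
have C y : c <= y <= d -> cr_at (fun x y => complex.Re (f (cexp (x +i* y))))
    (fun x y => complex.Im (f (cexp (x +i* y)))) (ln r) y.
  move=> /H; rewrite circE // => Hy.
  apply: (@cderivable_cr (fun w => f (cexp w))).
  by apply: cderivable_comp; [exact: cderivable_cexp | exact: Hy].
split=> y /C Cy e e0; have [eta eta0 Heta] := cr_cont Cy e0; exists eta => // y' Hy'.
  by rewrite !circE //; have [] := Heta (ln r) y' _ Hy'; rewrite ?subrr ?normr0.
by rewrite !circE //; have [] := Heta (ln r) y' _ Hy'; rewrite ?subrr ?normr0.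
Qed.

Lemma two_pi_ge0 : 0 <= 2 * pi :> R.
Proof. by rewrite mulr_ge0 // pi_ge0. Qed.

(** In logarithmic coordinates the horizontal sides of a rectangle of height
    [2 pi] cancel, so that the mean over a circle does not depend on its radius;
    it tends to the value at the centre as the radius shrinks. *)
Lemma mean_value_Im f r : 0 < r -> (forall w, cmod w <= r -> cderivable f w) ->
  segint 0 (2 * pi) (fun y => complex.Im (f (circ r y))) = 2 * pi * complex.Im (f 0).
Proof.
move=> r0 H.
have inv r' : 0 < r' -> r' <= r ->
    segint 0 (2 * pi) (fun y => complex.Im (f (circ r y))) =
    segint 0 (2 * pi) (fun y => complex.Im (f (circ r' y))).
  move=> r'0 r'r.
  have lnle : 0 <= ln r - ln r' by rewrite subr_ge0 ler_ln ?posrE.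
  have C x y : ln r' <= x <= ln r' + (ln r - ln r') -> 0 <= y <= 0 + 2 * pi ->
     cr_at (fun x y => complex.Re (f (cexp (x +i* y))))
    (fun x y => complex.Im (f (cexp (x +i* y)))) x y.
    rewrite [ln r' + _]addrC subrK => /andP[_ xr] _.
    apply: (@cderivable_cr (fun w => f (cexp w))).
    apply: cderivable_comp; [exact: cderivable_cexp | apply: H].
    by rewrite cmod_cexp /= -(@lnK _ r) ?posrE // ler_expR.
  have := goursat lnle two_pi_ge0 C; rewrite /rectint [ln r' + _]addrC subrK add0r.
  rewrite (@eq_segint _ _ _ _ (fun=> 0)); last first.
    move=> x _; have -> : cexp (x +i* (2 * pi)) = cexp (x +i* 0) :> R[i].
      apply: complex_eq; rewrite !(Re_cexp, Im_cexp) /=.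
        by rewrite -[2 * pi]add0r mulr_natl cosD2pi.
      by rewrite -[2 * pi]add0r mulr_natl sinD2pi.
    by rewrite subrr.
  rewrite segint_cst; last by rewrite -subr_ge0.
  rewrite mul0r sub0r => /eqP; rewrite oppr_eq0 => /eqP.
  have Cr : cont_on 0 (2 * pi) (fun y => complex.Im (f (circ r y))).
    by apply: (cont_on_circ r0 _).2 => y _; apply: H; rewrite cmod_circ // ltW.
  have Cr' : cont_on 0 (2 * pi) (fun y => complex.Im (f (circ r' y))).
    by apply: (cont_on_circ r'0 _).2 => y _; apply: H; rewrite cmod_circ // ltW.
  rewrite (@eq_segint _ _ _ _ (fun y => complex.Im (f (circ r y)) - complex.Im (f (circ r' y)))).
    by rewrite segintB // => /eqP; rewrite subr_eq0 => /eqP.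
  by move=> y _; rewrite !circE.
(* Continuity at the centre, on a circle of sufficiently small radius [r']. *)
apply/eqP; rewrite -subr_eq0 -normr_le0; apply/ler_addgt0Pl => e e0; rewrite addr0.
have K0 : 0 < 2 * pi + 1 :> R by rewrite ltr_wpDl // two_pi_ge0.
have f0 : cderivable f 0 by apply: H; rewrite cmod0 ltW.
have [d d0 Hd] := cderivable_continuous f0 (divr_gt0 e0 K0).
pose r' := Num.min r (d / 2).
have r'0 : 0 < r' by rewrite lt_min r0 divr_gt0.
rewrite (inv r' r'0) ?ge_min ?lexx //.
have := @segint_near_cst R 0 (2 * pi) (fun y => complex.Im (f (circ r' y)))
  (complex.Im (f 0)) (e / (2 * pi + 1)) two_pi_ge0.
rewrite subr0 [_ * (2 * pi)]mulrC => bound; apply: le_trans (bound _ _) _.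
- apply: (cont_on_circ r'0 _).2 => y _; apply: H; rewrite cmod_circ ?(ltW r'0) //.
  by rewrite ge_min lexx.
- move=> y _; rewrite -ImN -ImD; apply: le_trans (abs_Im_le_cmod _) _.
  apply/ltW/Hd; rewrite subr0 cmod_circ; last exact: ltW.
  by rewrite gt_min [X in _ || X]ltr_pdivrMr // ltr_pMr // ltr1n orbT.
rewrite mulrAC ler_pdivrMr // ler_wpM2l ?ltW //.
by rewrite ltrDl ltr01.
Qed.

Lemma mean_value_Re f r : 0 < r -> (forall w, cmod w <= r -> cderivable f w) ->
  segint 0 (2 * pi) (fun y => complex.Re (f (circ r y))) = 2 * pi * complex.Re (f 0).
Proof.
move=> r0 H.
have E w : complex.Re w = complex.Im ('i * w) :> R by rewrite ImM /= mul0r mul1r add0r.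
rewrite E -(@mean_value_Im (fun w => 'i * f w) r r0).
  by apply: eq_segint => y _; rewrite E.
by move=> w wr; apply: cderivableM; [exact: cderivable_cst | exact: H].
Qed.

Definition fset_at f z c : R[i] -> R[i] := fun w => if w == z then c else f w.

(** The mean value property is not affected by finitely many removable
    singularities; only the value at the centre matters. *)
Lemma mean_value_removable (s : seq R[i]) f r (c : R[i]) : 0 < r ->
  (forall w, cmod w <= r -> w \notin s -> cderivable f w) ->
  (forall w, w \in s -> w != 0 /\ cmod w != r) ->
  (forall w, w \in s -> exists v, cderivable (fset_at f w v) w) ->
  segint 0 (2 * pi) (fun y => complex.Re (c * f (circ r y))) = 2 * pi * complex.Re (c * f 0).
Proof.
move=> r0; elim: s f => [|z s IH] f Hf Hs Hv.
  rewrite -(@mean_value_Re (fun w => c * f w) r r0) // => w wr.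
  by apply: cderivableM; [exact: cderivable_cst | exact: Hf].
have [v Dv] := Hv z (mem_head _ _).
have [z0 zr] := Hs z (mem_head _ _).
have E w : w != z -> fset_at f z v w = f w by rewrite /fset_at => /negbTE ->.
have near_ne w : w != z -> exists2 d : R, 0 < d & forall w', cmod (w' - w) < d -> w' != z.
  rewrite -subr_eq0 -cmod_gt0 => wz; exists (cmod (w - z)) => // w' Hw'.
  by apply: contraTneq Hw' => ->; rewrite cmodB ltxx.
rewrite -(E 0); last by rewrite eq_sym.
rewrite -(IH (fset_at f z v)).
- apply: eq_segint => y _; rewrite E //; apply: contra_neq zr => <-.
  by rewrite cmod_circ // ltW.
- move=> w wr ws; have [->|wz] := eqVneq w z; first exact: Dv.
  have [d d0 Hd] := near_ne w wz.
  apply: (@cderivable_local _ f); first by exists d => // w' /Hd /E.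
  by apply: Hf; rewrite // in_cons negb_or wz.
- by move=> w ws; apply: Hs; rewrite in_cons ws orbT.
- move=> w ws; have [->|wz] := eqVneq w z.
    exists v; apply: (@cderivable_local _ (fset_at f z v)); last exact: Dv.
    by exists 1 => // w' _; rewrite /fset_at; case: eqP.
  have [|v' Dv'] := Hv w; first by rewrite in_cons ws orbT.
  exists v'.
  have [d d0 Hd] := near_ne w wz.
  apply: (@cderivable_local _ (fset_at f w v')); last exact: Dv'.
  by exists d => // w' /Hd /E Ew; rewrite {1}/fset_at [RHS]/fset_at Ew.
Qed.

End MeanValue.

Section IdentityTheorem.
Context {R : realType}.
Implicit Types (f q : R[i] -> R[i]) (z w a b : R[i]) (r : R).

Lemma cont_on_bounded (c d : R) (f : R -> R) : c <= d -> cont_on c d f ->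
  exists K : R, forall x, c <= x <= d -> `|f x| <= K.
Proof.
move=> cd H.
have [M _ HM] := EVT_max cd (cont_on_within H).
have [m _ Hm] := EVT_min cd (cont_on_within H).
exists (Num.max `|f M| `|f m|) => x xcd.
have x1 : f x <= f M by apply: HM; rewrite in_itv.
have x2 : f m <= f x by apply: Hm; rewrite in_itv.
rewrite ler_norml; apply/andP; split.
  rewrite lerNl (@le_trans _ _ (- f m)) ?lerN2 // le_max; apply/orP; right.
  by rewrite -normrN ler_norm.
by rewrite (le_trans x1) // le_max ler_norm.
Qed.

(** An automorphism of the disc of radius [r] that sends [0] to [b]. *)
Definition mobius r b w : R[i] := (r ^+ 2)%:C * (w + b) / ((r ^+ 2)%:C + b^* * w).

Section Mobius.
Variables (r : R) (b : R[i]).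
Hypotheses (r0 : 0 < r) (br : cmod b < r).

Lemma mobius0 : mobius r b 0 = b.
Proof.
rewrite /mobius add0r mulr0 addr0 mulrAC divff ?mul1r //.
by rewrite (inj_eq (@complexI R) _ 0) gt_eqF // exprn_gt0.
Qed.

Lemma mobius_den w : cmod w <= r -> (r ^+ 2)%:C + b^* * w != 0.
Proof.
move=> wr; apply/negP => /eqP /(congr1 (fun x => - (b^* * w) + x)).
rewrite addr0 addrC -addrA subrr addr0 => /(congr1 (@cmod R)).
rewrite cmodN cmodM cmod_conj cmodC ger0_norm ?sqr_ge0 // => E.
suff : cmod b * cmod w < r ^+ 2 by rewrite E ltxx.
rewrite expr2; apply: le_lt_trans (_ : cmod b * r < _).
  by rewrite ler_wpM2l ?cmod_ge0.
by rewrite ltr_pM2r.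
Qed.

(** The difference is nonnegative in the disc and vanishes on its boundary, so that
    [mobius r b] preserves both. *)
Lemma sqr_cmod_mobius w : cmod ((r ^+ 2)%:C + b^* * w) ^+ 2 - r ^+ 2 * cmod (w + b) ^+ 2 =
  (r ^+ 2 - cmod w ^+ 2) * (r ^+ 2 - cmod b ^+ 2).
Proof.
by rewrite !sqr_cmod; case: (b) => b1 b2; case: w => w1 w2 /=; ring.
Qed.

Lemma cmod_mobius w : cmod w <= r -> cmod (mobius r b w) <= r.
Proof.
move=> wr; have D := mobius_den wr.
rewrite /mobius !cmodM cmodV cmodC ger0_norm ?sqr_ge0 // expr2.
rewrite ler_pdivrMr ?cmod_gt0 // -mulrA ler_wpM2l ?(ltW r0) //.
rewrite -(@ler_pXn2r _ 2) ?nnegrE ?mulr_ge0 ?cmod_ge0 ?(ltW r0) //.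
rewrite exprMn -subr_ge0 sqr_cmod_mobius mulr_ge0 // subr_ge0.
  by rewrite ler_pXn2r ?nnegrE ?cmod_ge0 ?(ltW r0).
by rewrite ler_pXn2r ?nnegrE ?cmod_ge0 ?(ltW r0) // ltW.
Qed.

Lemma cmod_mobius_circle w : cmod w = r -> cmod (mobius r b w) = r.
Proof.
move=> wr; have D : (r ^+ 2)%:C + b^* * w != 0 by rewrite mobius_den // wr.
rewrite /mobius !cmodM cmodV cmodC ger0_norm ?sqr_ge0 // expr2.
apply: (@mulIf _ (cmod ((r ^+ 2)%:C + b^* * w))); first by rewrite cmod_eq0.
rewrite mulfVK ?cmod_eq0 // -mulrA; congr (_ * _).
apply/eqP; rewrite -(@eqrXn2 _ 2) ?mulr_ge0 ?cmod_ge0 ?(ltW r0) //.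
by rewrite exprMn -subr_eq0 -oppr_eq0 opprB sqr_cmod_mobius wr subrr mul0r.
Qed.

Lemma cderivable_mobius w : cmod w <= r -> cderivable (mobius r b) w.
Proof.
move=> wr; apply: cderivableM.
  apply: cderivableM; first exact: cderivable_cst.
  by apply: cderivableD; [exact: cderivable_id | exact: cderivable_cst].
apply: cderivableV; first exact: mobius_den.
apply: cderivableD; first exact: cderivable_cst.
by apply: cderivableM; [exact: cderivable_cst | exact: cderivable_id].
Qed.

End Mobius.

Lemma le0_geometric (A K x : R) : 0 <= x < 1 -> (forall m, A <= K * x ^+ m) -> A <= 0.
Proof.
move=> /andP[x0 x1] H.
have C : (fun m => K * x ^+ m) @ \oo --> (K * 0 : R).
  by apply: cvgM; [exact: cvg_cst | apply: cvg_expr; rewrite ger0_norm].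
rewrite mulr0 in C; rewrite -(cvg_lim _ C) //.
by apply: limr_ge; [apply/cvg_ex; exists 0 | near=> n; exact: H].
Unshelve. all: by end_near. Qed.

(** [q] vanishes to infinite order at [a]: the quotients [q w / (w - a) ^+ m] are
    all derivable, and the mean value property, transported to the point [b] by
    an automorphism of the disc, bounds them by their size on the circle. *)
Lemma identity_disc q a r (d : R) : 0 < d ->
  (forall w, cmod (w - a) <= r -> cderivable q w) ->
  (forall w, cmod (w - a) < d -> q w = 0) ->
  forall w, cmod (w - a) < r -> q w = 0.
Proof.
move=> d0 Hq q0 w; pose b := w - a.
have -> : w = a + b by rewrite addrC subrK.
move: b => b; rewrite [a + b - a]addrAC subrr add0r => br.
have r0 : 0 < r by apply: le_lt_trans br; exact: cmod_ge0.
have [->|b0] := eqVneq b 0; first by apply: q0; rewrite addr0 subrr cmod0.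
pose Q m w := q (a + mobius r b w) / mobius r b w ^+ m.
have DQ m v : cmod v <= r -> cderivable (Q m) v.
  move=> vr; apply: (@cderivable_comp _ (mobius r b) (fun w => q (a + w) / w ^+ m)).
    exact: cderivable_mobius.
  set u := mobius r b v; have ur : cmod u <= r by exact: cmod_mobius.
  have [u0|u0] := eqVneq u 0.
    apply: (@cderivable_local _ (fun=> 0)); last exact: cderivable_cst.
    exists d => // w'; rewrite u0 subr0 => w'd.
    by rewrite q0 ?mul0r // addrAC subrr add0r.
  apply: cderivableM; last first.
    by apply: cderivableV; [rewrite expf_neq0 | apply: cderivableX; exact: cderivable_id].
  apply: (@cderivable_comp _ (fun w => a + w) q).
    by apply: cderivableD; [exact: cderivable_cst | exact: cderivable_id].
  by apply: Hq; rewrite addrAC subrr add0r.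
have cy y : cmod (circ r y) = r by rewrite cmod_circ // ltW.
have [C1 C2] : cont_on 0 (2 * pi) (fun y => complex.Re (Q 0%N (circ r y))) /\
    cont_on 0 (2 * pi) (fun y => complex.Im (Q 0%N (circ r y))).
  by apply: cont_on_circ => // y _; apply: DQ; rewrite cy.
have [K1 HK1] := cont_on_bounded two_pi_ge0 C1.
have [K2 HK2] := cont_on_bounded two_pi_ge0 C2.
have p0 : 0 < 2 * pi :> R by rewrite mulr_gt0 // pi_gt0.
have B m y : 0 <= y <= 2 * pi -> cmod (Q m (circ r y)) <= (K1 + K2) * r ^- m.
  move=> yI; have -> : Q m (circ r y) = Q 0%N (circ r y) / mobius r b (circ r y) ^+ m.
    by rewrite /Q expr0 divr1.
  rewrite cmodM cmodV cmodX cmod_mobius_circle // ler_wpM2r ?invr_ge0 ?exprn_ge0 ?(ltW r0) //.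
  by apply: le_trans (cmod_le_ReIm _) _; rewrite lerD ?HK1 ?HK2.
(* The mean value property bounds [Q m 0] by a multiple of [r ^- m], so that
   [|q (a + b)|] is at most a multiple of [(|b| / r) ^ m] for every [m]. *)
have E m : q (a + b) = Q m 0 * b ^+ m by rewrite /Q mobius0 // mulfVK // expf_neq0.
have bound m : cmod (q (a + b)) <= (K1 + K2) * (cmod b / r) ^+ m.
  rewrite (E m) cmodM cmodX expr_div_n mulrCA [leRHS]mulrC.
  rewrite ler_wpM2r ?exprn_ge0 ?cmod_ge0 //.
  apply: cmod_le_rotations => c c1.
  have DcQ v : cmod v <= r -> cderivable (fun v => c * Q m v) v.
    by move=> vr; apply: cderivableM; [exact: cderivable_cst | exact: DQ].
  rewrite -(ler_pM2l p0) -(mean_value_Re r0 DcQ) [leRHS]mulrC -[2 * pi in leRHS]subr0.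
  rewrite -segint_cst ?two_pi_ge0 //; apply: le_segint; last first.
  - move=> y /(B m); apply: le_trans; apply: le_trans (Re_le_cmod _) _.
    by rewrite cmodM c1 mul1r.
  - exact: cont_on_cst.
  by apply: (cont_on_circ (f := fun v => c * Q m v) r0 _).1 => y _; apply: DcQ; rewrite cy.
apply/eqP; rewrite -cmod_eq0 eq_le cmod_ge0 andbT.
apply: le0_geometric bound; rewrite divr_ge0 ?cmod_ge0 ?(ltW r0) //=.
by rewrite ltr_pdivrMr // mul1r.
Qed.

End IdentityTheorem.

(** * Integrals of complex functions and exponential transforms *)

Section ComplexIntegral.
Context {d : measure_display} {T : measurableType d} {R : realType}.
Variable mu : {measure set T -> \bar R}.
Implicit Types (f g : T -> R[i]) (h k Z : T -> R) (c w : R[i]).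

Definition rintble h : Prop := mu.-integrable setT (EFin \o h).

Definition cintble f : Prop :=
  rintble (fun x => complex.Re (f x)) /\ rintble (fun x => complex.Im (f x)).

Definition cint f : R[i] :=
  (\int[mu]_x complex.Re (f x)) +i* (\int[mu]_x complex.Im (f x)).

Definition cmeas f : Prop :=
  measurable_fun setT (fun x => complex.Re (f x)) /\
  measurable_fun setT (fun x => complex.Im (f x)).

Lemma rintble_meas h : rintble h -> measurable_fun setT h.
Proof. by move=> /measurable_int /measurable_EFinP. Qed.

Lemma rintbleD h k : rintble h -> rintble k -> rintble (fun x => h x + k x).
Proof. by move=> ih ik; have := integrableD measurableT ih ik. Qed.

Lemma rintbleB h k : rintble h -> rintble k -> rintble (fun x => h x - k x).
Proof. by move=> ih ik; have := integrableB measurableT ih ik. Qed.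

Lemma rintbleZ (a : R) h : rintble h -> rintble (fun x => a * h x).
Proof. by move=> ih; have := integrableZl measurableT a ih. Qed.

Lemma rintble_le h k : measurable_fun setT h -> (forall x, `|h x| <= k x) ->
  rintble k -> rintble h.
Proof.
move=> mh hk ik; apply: (le_integrable measurableT _ _ ik).
  exact/measurable_EFinP.
by move=> x _ /=; rewrite lee_fin (le_trans (hk x)) // ler_norm.
Qed.

Lemma rintD h k : rintble h -> rintble k ->
  \int[mu]_x (h x + k x) = \int[mu]_x h x + \int[mu]_x k x.
Proof. by move=> *; rewrite RintegralD. Qed.

Lemma rintB h k : rintble h -> rintble k ->
  \int[mu]_x (h x - k x) = \int[mu]_x h x - \int[mu]_x k x.
Proof. by move=> *; rewrite RintegralB. Qed.

Lemma rintZ (a : R) h : rintble h -> \int[mu]_x (a * h x) = a * \int[mu]_x h x.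
Proof. by move=> *; rewrite RintegralZl. Qed.

Lemma rint_le h k : rintble h -> rintble k -> (forall x, h x <= k x) ->
  \int[mu]_x h x <= \int[mu]_x k x.
Proof. by move=> ? ? hk; apply: le_Rintegral. Qed.

Lemma cintble_meas f : cintble f -> cmeas f.
Proof. by move=> [/rintble_meas ? /rintble_meas ?]. Qed.

Lemma cintble_le f k : cmeas f -> (forall x, cmod (f x) <= k x) ->
  rintble k -> cintble f.
Proof.
move=> [m1 m2] fk ik; split; apply: rintble_le ik => // x.
  exact: le_trans (abs_Re_le_cmod _) (fk x).
exact: le_trans (abs_Im_le_cmod _) (fk x).
Qed.

Lemma cintbleD f g : cintble f -> cintble g -> cintble (fun x => f x + g x).
Proof.
move=> [f1 f2] [g1 g2]; split.
  by under [X in rintble X]eq_fun do rewrite ReD; exact: rintbleD.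
by under [X in rintble X]eq_fun do rewrite ImD; exact: rintbleD.
Qed.

Lemma cintbleZ c f : cintble f -> cintble (fun x => c * f x).
Proof.
move=> [f1 f2]; split.
  by under [X in rintble X]eq_fun do rewrite ReM; apply: rintbleB; exact: rintbleZ.
by under [X in rintble X]eq_fun do rewrite ImM; apply: rintbleD; exact: rintbleZ.
Qed.

Lemma cintbleB f g : cintble f -> cintble g -> cintble (fun x => f x - g x).
Proof.
move=> fi gi; have := cintbleD fi (cintbleZ (-1) gi).
by under eq_fun do rewrite mulN1r.
Qed.

Lemma cintD f g : cintble f -> cintble g ->
  cint (fun x => f x + g x) = cint f + cint g.
Proof.
move=> [f1 f2] [g1 g2]; apply: complex_eq; rewrite /cint ?ReD ?ImD /=.
  by under eq_Rintegral do rewrite ReD; rewrite rintD.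
by under eq_Rintegral do rewrite ImD; rewrite rintD.
Qed.

Lemma cintZ c f : cintble f -> cint (fun x => c * f x) = c * cint f.
Proof.
move=> [f1 f2]; apply: complex_eq; rewrite /cint ?ReM ?ImM /=.
  under eq_Rintegral do rewrite ReM.
  by rewrite rintB ?rintZ //; exact: rintbleZ.
under eq_Rintegral do rewrite ImM.
by rewrite rintD ?rintZ //; exact: rintbleZ.
Qed.

Lemma cintB f g : cintble f -> cintble g ->
  cint (fun x => f x - g x) = cint f - cint g.
Proof.
move=> fi gi; have gi' := cintbleZ (-1) gi.
rewrite -[in RHS]mulN1r -cintZ // -cintD //; congr cint.
by apply/funext => x; rewrite mulN1r.
Qed.

Lemma Re_cint f : complex.Re (cint f) = \int[mu]_x complex.Re (f x).
Proof. by []. Qed.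

Lemma cmod_cint_le f k : cintble f -> rintble k -> (forall x, cmod (f x) <= k x) ->
  cmod (cint f) <= \int[mu]_x k x.
Proof.
move=> fi ik fk; apply: cmod_le_rotations => c c1.
rewrite -cintZ // Re_cint; apply: rint_le => //; first exact: (cintbleZ c fi).1.
by move=> x; apply: le_trans (Re_le_cmod _) _; rewrite cmodM c1 mul1r.
Qed.

Lemma cint_ae f g : cmeas f -> cmeas g -> {ae mu, forall x, f x = g x} ->
  cint f = cint g.
Proof.
move=> [f1 f2] [g1 g2] fg.
by apply: complex_eq; rewrite /cint /=; congr fine; apply: ae_eq_integral => //=;
  [exact/measurable_EFinP | exact/measurable_EFinP | |
   exact/measurable_EFinP | exact/measurable_EFinP | ];
  apply: filterS fg => x -> _.
Qed.

Lemma rintble_ae h k : measurable_fun setT h -> measurable_fun setT k ->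
  {ae mu, forall x, h x = k x} -> rintble h -> rintble k.
Proof.
move=> mh mk hk ih; apply/integrableP; split; first exact/measurable_EFinP.
move/integrableP : (ih) => [_]; congr (_ < _)%E.
apply: ae_eq_integral => //=.
- by apply/measurable_EFinP; apply: measurableT_comp.
- by apply/measurable_EFinP; apply: measurableT_comp.
- by apply: filterS hk => x ->.
Qed.

Lemma measurable_expR_comp h : measurable_fun setT h ->
  measurable_fun setT (fun x => expR (h x)).
Proof. by move=> mh; apply: measurableT_comp. Qed.

Lemma cmeas_cexp w Z : measurable_fun setT Z -> cmeas (fun x => cexp (w * (Z x)%:C)).
Proof.
move=> mZ.
have mr : measurable_fun setT (fun x => expR (complex.Re w * Z x)).
  by apply: measurable_expR_comp; exact: measurable_funM.
have mi : measurable_fun setT (fun x => complex.Im w * Z x) by exact: measurable_funM.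
split.
  under eq_fun do rewrite Re_cexp ReM ImM ReC ImC !mulr0 subr0 add0r.
  apply: measurable_funM => //; apply: (measurableT_comp _ mi).
  by apply: continuous_measurable_fun; exact: continuous_cos.
under eq_fun do rewrite Im_cexp ReM ImM ReC ImC !mulr0 subr0 add0r.
apply: measurable_funM => //; apply: (measurableT_comp _ mi).
by apply: continuous_measurable_fun; exact: continuous_sin.
Qed.

Lemma cmod_cexpM w (x : R) : cmod (cexp (w * x%:C)) = expR (complex.Re w * x).
Proof. by rewrite cmod_cexp ReM ReC ImC mulr0 subr0. Qed.

Definition expint Z w : R[i] := cint (fun x => cexp (w * (Z x)%:C)).

Lemma cintble_cexp Z w : measurable_fun setT Z ->
  rintble (fun x => expR (complex.Re w * Z x)) ->
  cintble (fun x => cexp (w * (Z x)%:C)).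
Proof.
move=> mZ iZ; apply: cintble_le iZ; first exact: cmeas_cexp.
by move=> x; rewrite cmod_cexpM.
Qed.

Section Laplace.
Variables (Z : T -> R) (c : R).
Hypotheses (mZ : measurable_fun setT Z) (Z0 : forall x, 0 <= Z x).
Hypothesis (iZ : rintble (fun x => expR (c * Z x))).

Lemma rintble_exp_le (a : R) : a <= c -> rintble (fun x => expR (a * Z x)).
Proof.
move=> ac; apply: rintble_le iZ.
  by apply: measurable_expR_comp; exact: measurable_funM.
by move=> x; rewrite ger0_norm ?expR_ge0 // ler_expR ler_wpM2r.
Qed.

Lemma mulr_exp_le (x k : R) : 0 < k -> 0 <= x -> x <= k^-1 * expR (k * x).
Proof.
move=> k0 x0; rewrite mulrC ler_pdivlMr // mulrC.
by apply: le_trans (expR_ge1Dx _); rewrite lerDr.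
Qed.

Lemma sqr_exp_le (x k : R) : 0 < k -> 0 <= x -> x ^+ 2 <= k ^- 2 * 4 * expR (k * x).
Proof.
move=> k0 x0; have xk := mulr_exp_le (divr_gt0 k0 (ltr0Sn R 1)) x0.
apply: le_trans (_ : ((k / 2)^-1 * expR (k / 2 * x)) ^+ 2 <= _).
  by rewrite ler_pXn2r ?nnegrE // (le_trans x0).
rewrite exprMn -expRM_natl mulr_natl -mulrnAl -[k / 2 *+ 2]mulr_natr divfK ?pnatr_eq0 //.
rewrite invf_div exprMn; have -> : 2 ^+ 2 = 4 :> R by rewrite expr2 -natrM.
by rewrite exprVn [4 * _]mulrC.
Qed.

(** Differentiation under the integral sign: the remainder of order two of the
    exponential is dominated by the integrable [exp (c Z)]. *)
Lemma cderivable_expint w : complex.Re w < c -> cderivable (expint Z) w.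
Proof.
move=> wc; pose k := (c - complex.Re w) / 2.
have k0 : 0 < k by rewrite divr_gt0 // subr_gt0.
have kc : complex.Re w + k <= c by rewrite /k; lra.
have kkc : complex.Re w + k + k <= c by rewrite /k; lra.
have i1 (h : R[i]) : cmod h < k -> cintble (fun x => cexp ((w + h) * (Z x)%:C)).
  move=> hk; apply: cintble_cexp => //; apply: rintble_exp_le.
  by rewrite ReD; have := Re_le_cmod h; lra.
have i0 : cintble (fun x => cexp (w * (Z x)%:C)).
  by apply: cintble_cexp => //; apply: rintble_exp_le; exact: ltW.
have iD : cintble (fun x => (Z x)%:C * cexp (w * (Z x)%:C)).
  apply: (@cintble_le _ (fun x => k^-1 * expR (c * Z x))).
  - have [m1 m2] := cmeas_cexp w mZ; split.
      under eq_fun do rewrite ReM ReC ImC mul0r subr0.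
      exact: measurable_funM.
    under eq_fun do rewrite ImM ReC ImC mul0r addr0.
    exact: measurable_funM.
  - move=> x; rewrite cmodM cmodC ger0_norm // cmod_cexpM.
    apply: (@le_trans _ _ (k^-1 * expR (k * Z x) * expR (complex.Re w * Z x))).
      by rewrite ler_wpM2r ?expR_ge0 // mulr_exp_le.
    rewrite -mulrA -expRD -mulrDl ler_wpM2l ?invr_ge0 ?(ltW k0) //.
    by rewrite ler_expR ler_wpM2r // addrC.
  - exact: rintbleZ.
(* The constant is that of [z ^ 2 <= (4 / k ^ 2) exp (k z)]; half of the gap
   between [Re w] and [c] absorbs this factor and the other half the
   [exp (|h| z)] of the remainder. *)
apply: (@cderivable_quadratic _ _ _ (cint (fun x => (Z x)%:C * cexp (w * (Z x)%:C))) k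
  (k ^- 2 * 4 * \int[mu]_x expR (c * Z x))) => // h hk.
have iS := cintbleB (cintbleB (i1 h hk) i0) (cintbleZ h iD).
have E : expint Z (w + h) - expint Z w - cint (fun x => (Z x)%:C * cexp (w * (Z x)%:C)) * h =
    cint (fun x => cexp ((w + h) * (Z x)%:C) - cexp (w * (Z x)%:C)
      - h * ((Z x)%:C * cexp (w * (Z x)%:C))).
  have ih := i1 h hk; rewrite cintB ?cintB ?cintZ // 1?[_ * h]mulrC //.
    exact: cintbleB.
  exact: cintbleZ.
rewrite E.
rewrite mulrAC -rintZ //.
apply: cmod_cint_le => //; first exact: rintbleZ.
move=> x.
have -> : cexp ((w + h) * (Z x)%:C) - cexp (w * (Z x)%:C) - h * ((Z x)%:C * cexp (w * (Z x)%:C))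
   = cexp (w * (Z x)%:C) * cexp_rem 2 (h * (Z x)%:C).
  rewrite mulrDl cexpD /cexp_rem !big_nat_recr //= big_geq // add0r expr0 expr1 !divr1.
  ring.
rewrite cmodM cmod_cexpM; have z0 := Z0 x; set z := Z x in z0 *.
have h0 := cmod_ge0 h.
apply: le_trans (ler_wpM2l (expR_ge0 _) (cmod_cexp_rem _ _)) _.
rewrite cmodM cmodC ger0_norm // exprMn.
have B : z ^+ 2 <= k ^- 2 * 4 * expR (k * z) by exact: sqr_exp_le.
apply: (@le_trans _ _ (expR (complex.Re w * z) *
   (cmod h ^+ 2 * (k ^- 2 * 4 * expR (k * z)) * expR (k * z)))).
  rewrite ler_wpM2l ?expR_ge0 // ler_pM ?expR_ge0 ?mulr_ge0 ?exprn_ge0 //.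
    by rewrite ler_wpM2l ?exprn_ge0.
  by rewrite ler_expR ler_wpM2r // ltW.
have -> : expR (complex.Re w * z) * (cmod h ^+ 2 * (k ^- 2 * 4 * expR (k * z)) * expR (k * z))
  = k ^- 2 * 4 * cmod h ^+ 2 * (expR (complex.Re w * z) * expR (k * z) * expR (k * z)) by ring.
rewrite -!expRD -!mulrDl ler_wpM2l ?mulr_ge0 ?invr_ge0 ?exprn_ge0 ?(ltW k0) //.
by rewrite ler_expR ler_wpM2r.
Qed.

End Laplace.

End ComplexIntegral.

(** * Laws, product measures and independence *)

Section SameLaw.
Context {d1 d2 d3 : measure_display} {S : measurableType d1} {S' : measurableType d2}
  {Y : measurableType d3} {R : realType}.
Variables (mu : {measure set S -> \bar R}) (nu : {measure set S' -> \bar R}).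
Variables (phi : S -> Y) (phi' : S' -> Y).
Hypotheses (mphi : measurable_fun setT phi) (mphi' : measurable_fun setT phi').
Hypothesis same_law : forall A, measurable A -> mu (phi @^-1` A) = nu (phi' @^-1` A).

Let eq_push (h : Y -> \bar R) :
  (\int[pushforward mu phi]_y h y = \int[pushforward nu phi']_y h y)%E.
Proof.
pose m1 := measure_function_pushforward__canonical__measure_function_Measure mu mphi.
pose m2 := measure_function_pushforward__canonical__measure_function_Measure nu mphi'.
by apply: (@eq_measure_integral _ _ _ setT m2 m1) => A mA _; exact: same_law.
Qed.

Lemma rintble_law (h : Y -> R) : measurable_fun setT h ->
  rintble mu (fun x => h (phi x)) -> rintble nu (fun x => h (phi' x)).
Proof.
move=> mh ih.
have mah : measurable_fun setT (fun y => `|(h y)%:E|%E).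
  by apply: measurableT_comp => //; exact/measurable_EFinP.
apply/integrableP; split; first by apply/measurable_EFinP; exact: measurableT_comp.
move/integrableP : (ih) => [_]; congr (_ < _)%E.
have E1 := ge0_integral_pushforward mphi mu measurableT mah (fun y _ => abse_ge0 (h y)%:E).
have E2 := ge0_integral_pushforward mphi' nu measurableT mah (fun y _ => abse_ge0 (h y)%:E).
by have := eq_push (fun y => `|(h y)%:E|%E); rewrite E1 E2.
Qed.

(** Both integrals are integrals of [h] against the common image measure. *)
Lemma rint_law (h : Y -> R) : measurable_fun setT h ->
  rintble mu (fun x => h (phi x)) ->
  \int[nu]_x h (phi' x) = \int[mu]_x h (phi x).
Proof.
move=> mh ih; have ih' := rintble_law mh ih.
have mh' : measurable_fun setT (EFin \o h) by exact/measurable_EFinP.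
congr fine; have := eq_push (EFin \o h).
rewrite (integral_pushforward mphi mh' (mu := mu)) //.
by rewrite (integral_pushforward mphi' mh' (mu := nu)).
Qed.

Lemma cintble_law (f : Y -> R[i]) : cmeas f ->
  cintble mu (fun x => f (phi x)) -> cintble nu (fun x => f (phi' x)).
Proof.
move=> [m1 m2] [i1 i2].
by split; [exact: (rintble_law m1 i1) | exact: (rintble_law m2 i2)].
Qed.

Lemma cint_law (f : Y -> R[i]) : cmeas f ->
  cintble mu (fun x => f (phi x)) ->
  cint nu (fun x => f (phi' x)) = cint mu (fun x => f (phi x)).
Proof.
move=> [m1 m2] [i1 i2]; apply: complex_eq.
  exact: (rint_law m1 i1).
exact: (rint_law m2 i2).
Qed.

End SameLaw.

Section ProductIntegral.
Context {d1 d2 : measure_display} {S : measurableType d1} {S' : measurableType d2}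
  {R : realType}.
Variables (mu : probability S R) (nu : probability S' R).

Lemma rint_prod (h : S -> R) (k : S' -> R) : rintble mu h -> rintble nu k ->
  rintble (mu \x nu)%E (fun p => h p.1 * k p.2) /\
  \int[(mu \x nu)%E]_p (h p.1 * k p.2) = (\int[mu]_x h x) * (\int[nu]_y k y).
Proof.
move=> ih ik.
have mh := rintble_meas ih; have mk := rintble_meas ik.
have mhk : measurable_fun setT (fun p : S * S' => (h p.1 * k p.2)%:E).
  apply/measurable_EFinP; apply: measurable_funM.
    exact: (measurableT_comp mh measurable_fst).
  exact: (measurableT_comp mk measurable_snd).
have ihk : rintble (mu \x nu)%E (fun p => h p.1 * k p.2).
  have [_ I] := @integrable12ltyP _ _ _ _ _ mu nu _ mhk; apply: I.
  have E x : (\int[nu]_y `|(h x * k y)%:E| = `|h x|%:E * \int[nu]_y `|(k y)%:E|)%E.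
    rewrite -ge0_integralZl //; last by apply: measurableT_comp => //; exact/measurable_EFinP.
    by apply: eq_integral => y _; rewrite EFinM abseM.
  under eq_integral do rewrite E.
  move/integrableP : (ih) => [_ hoo]; move/integrableP : (ik) => [_ koo].
  rewrite ge0_integralZr //; last 2 first.
    by apply: measurableT_comp => //; exact: measurableT_comp.
    exact: integral_ge0.
  by rewrite lte_mul_pinfty ?integral_ge0 // ge0_fin_numE ?integral_ge0.
split=> //; rewrite /Rintegral.
rewrite -(@integral12_prod_meas1 _ _ _ _ _ mu nu _ ihk) /fubini_F /=.
have fk : (\int[nu]_y (k y)%:E)%E \is a fin_num by apply: integrable_fin_num.
have fh : (\int[mu]_y (h y)%:E)%E \is a fin_num by apply: integrable_fin_num.
have E x : (\int[nu]_y (h x * k y)%:E = (h x)%:E * \int[nu]_y (k y)%:E)%E.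
  by rewrite -integralZl //; apply: eq_integral => y _; rewrite EFinM.
under eq_integral do rewrite E -(fineK fk).
by rewrite integralZr // fineM // fineK.
Qed.

Lemma cint_prod (f : S -> R[i]) (g : S' -> R[i]) : cintble mu f -> cintble nu g ->
  cintble (mu \x nu)%E (fun p => f p.1 * g p.2) /\
  cint (mu \x nu)%E (fun p => f p.1 * g p.2) = cint mu f * cint nu g.
Proof.
move=> [f1 f2] [g1 g2].
have [a1 b1] := rint_prod f1 g1; have [a2 b2] := rint_prod f2 g2.
have [a3 b3] := rint_prod f1 g2; have [a4 b4] := rint_prod f2 g1.
split.
  split.
    by under [X in rintble _ X]eq_fun do rewrite ReM; exact: rintbleB.
  by under [X in rintble _ X]eq_fun do rewrite ImM; exact: rintbleD.
apply: complex_eq; rewrite ?ReM ?ImM /cint /=.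
  rewrite -b1 -b2 -rintB //; congr (Rintegral _ _ _).
  by apply/funext => p; rewrite ReM.
rewrite -b3 -b4 -rintD //; congr (Rintegral _ _ _).
by apply/funext => p; rewrite ImM.
Qed.

Lemma product_setT : (mu \x nu)%E setT = 1%E.
Proof. rewrite -setXTT product_measure1E //.
transitivity (1 * 1 : \bar R)%E; last by rewrite mule1.
by congr (_ * _)%E; exact: probability_setT. Qed.

End ProductIntegral.

Section Independence.
Context {d : measure_display} {T : measurableType d} {R : realType}.
Variable P : probability T R.
Variables (X Y : {RV P >-> R}).
Hypothesis XY : independent2 X Y.

(** The joint law of [X] and [Y] is the product of their laws, because they agree
    on rectangles. *)
Lemma cint_independent (f g : R -> R[i]) : cmeas f -> cmeas g ->
  cintble P (fun w => f (X w)) -> cintble P (fun w => g (Y w)) ->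
  cintble P (fun w => f (X w) * g (Y w)) /\
  cint P (fun w => f (X w) * g (Y w)) =
    cint P (fun w => f (X w)) * cint P (fun w => g (Y w)).
Proof.
move=> mf mg fi gi.
pose dX := [the probability _ R of distribution P X].
pose dY := [the probability _ R of distribution P Y].
have mX : measurable_fun setT X by [].
have mY : measurable_fun setT Y by [].
have mid : measurable_fun setT (@idfun R) by exact: measurable_id.
have fX : cintble dX f by apply: (@cintble_law _ _ _ _ _ _ _ P dX X idfun).
have gY : cintble dY g by apply: (@cintble_law _ _ _ _ _ _ _ P dY Y idfun).
have fXE : cint dX f = cint P (fun w => f (X w)).
  exact: (@cint_law _ _ _ _ _ _ _ P dX X idfun).
have gYE : cint dY g = cint P (fun w => g (Y w)).
  exact: (@cint_law _ _ _ _ _ _ _ P dY Y idfun).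
have [i e] := cint_prod fX gY.
have mXY : measurable_fun setT (fun w => (X w, Y w)) by exact: measurable_fun_pair.
have mi2 : measurable_fun setT (@idfun (R * R)) by exact: measurable_id.
have law A : measurable A -> (dX \x dY)%E (idfun @^-1` A) =
    P ((fun w => (X w, Y w)) @^-1` A).
  move=> mA.
  pose m' := measure_function_pushforward__canonical__measure_function_Measure P mXY.
  by apply: (@product_measure_unique _ _ _ _ _ dX dY m') => // B C mB mC; exact: XY.
have mfg : cmeas (fun p : R * R => f p.1 * g p.2).
  exact: (cintble_meas i).
split.
  exact: (@cintble_law _ _ _ _ _ _ _ (dX \x dY)%E P idfun (fun w => (X w, Y w))
  mi2 mXY law (fun p : R * R => f p.1 * g p.2) mfg i).
rewrite -fXE -gYE -e.
exact: (@cint_law _ _ _ _ _ _ _ (dX \x dY)%E P idfun (fun w => (X w, Y w))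
  mi2 mXY law (fun p : R * R => f p.1 * g p.2) mfg i).
Qed.

End Independence.

(** * The Wiener-Hopf equation of the queue *)

Section PositivePart.
Context {R : realType}.
Implicit Types (x a : R) (w : R[i]).

Definition ppart x : R := Num.max x 0.

Lemma ppart_ge0 x : 0 <= ppart x.
Proof. by rewrite le_max lexx orbT. Qed.

Lemma ppart_id x : 0 <= x -> ppart x = x.
Proof. by rewrite /ppart; case: ltgtP. Qed.

Lemma ppart_eq0 x : x <= 0 -> ppart x = 0.
Proof. by rewrite /ppart; case: ltgtP. Qed.

(** One of [ppart x] and [ppart (- x)] vanishes.  Integrated against the stationary
    law this identity becomes the Wiener-Hopf equation. *)
Lemma cexp_ppart w x :
  cexp (- w * (ppart x)%:C) = cexp (- w * x%:C) + 1 - cexp (w * (ppart (- x))%:C).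
Proof.
have [x0|x0] := leP 0 x.
  by rewrite ppart_id // ppart_eq0 ?oppr_le0 // mulr0 cexp0 addrK.
rewrite ppart_eq0 ?(ltW x0) // ppart_id ?oppr_ge0 ?(ltW x0) //.
by rewrite mulr0 cexp0 rmorphN mulrN mulNr [_ + 1]addrC addrK.
Qed.

Lemma measurable_ppart {d} {T : measurableType d} (Z : T -> R) :
  measurable_fun setT Z -> measurable_fun setT (fun y => ppart (Z y)).
Proof. by move=> mZ; apply: measurable_maxr. Qed.

Lemma expR_le_quadratic x : expR x <= 1 + x + x ^+ 2 * expR `|x|.
Proof.
have := cmod_cexp_rem 2 x%:C.
rewrite /cexp_rem !big_nat_recr //= big_geq // add0r expr0 expr1 !divr1.
rewrite cexpC cmodC real_normK ?num_real //.
have -> : (expR x)%:C - (1 + x%:C) = (expR x - 1 - x)%:C :> R[i].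
  by rewrite !rmorphB /= opprD addrA.
by rewrite cmodC => /(le_trans (ler_norm _)); rewrite lerBlDr lerBlDr; lra.
Qed.

End PositivePart.

Section BoundedIntegrals.
Context {d : measure_display} {T : measurableType d} {R : realType}.
Variable mu : {measure set T -> \bar R}.
Hypothesis mu1 : mu setT = 1%E.

Lemma rintble_cst (a : R) : rintble mu (fun=> a).
Proof.
apply/integrableP; split; first exact: measurable_cst.
by rewrite /= integral_cst //= mu1 mule1 ltry.
Qed.

Lemma rint_cst (a : R) : \int[mu]_x a = a.
Proof. by rewrite Rintegral_cst // mu1 /= mulr1. Qed.

Lemma cintble_cst (c : R[i]) : cintble mu (fun=> c).
Proof. by split; exact: rintble_cst. Qed.

Lemma cint_cst (c : R[i]) : cint mu (fun=> c) = c.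
Proof. by apply: complex_eq; rewrite /cint /= rint_cst. Qed.

Lemma rintble_bounded (h : T -> R) (K : R) : measurable_fun setT h ->
  (forall x, `|h x| <= K) -> rintble mu h.
Proof. by move=> mh hK; apply: (rintble_le mh hK); exact: rintble_cst. Qed.

Lemma rintble_exp_npos (Z : T -> R) (a : R) : measurable_fun setT Z ->
  (forall x, 0 <= Z x) -> a <= 0 -> rintble mu (fun x => expR (a * Z x)).
Proof.
move=> mZ Z0 a0; apply: (@rintble_bounded _ 1).
  by apply: measurable_expR_comp; exact: measurable_funM.
by move=> x; rewrite ger0_norm ?expR_ge0 // expR_le1 mulr_le0_ge0.
Qed.

Lemma cmod_expint_le1 (Z : T -> R) (w : R[i]) : measurable_fun setT Z ->
  (forall x, 0 <= Z x) -> complex.Re w <= 0 -> cmod (expint mu Z w) <= 1.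
Proof.
move=> mZ Z0 w0; rewrite -(rint_cst 1); apply: cmod_cint_le.
- by apply: cintble_cexp => //; exact: rintble_exp_npos.
- exact: rintble_cst.
- by move=> x; rewrite cmod_cexpM expR_le1 mulr_le0_ge0.
Qed.

(** Monotone convergence in the form needed for truncations: each value is
    eventually attained. *)
Lemma rintble_monotone (h_ : nat -> T -> R) (h : T -> R) (C : R) :
  measurable_fun setT h -> (forall n, rintble mu (h_ n)) ->
  (forall n x, 0 <= h_ n x) -> (forall x m n, (m <= n)%N -> h_ m x <= h_ n x) ->
  (forall x, exists N, forall n, (N <= n)%N -> h_ n x = h x) ->
  (forall n, \int[mu]_x h_ n x <= C) -> rintble mu h.
Proof.
move=> mh ih h0 hmono hlim hC.
have hl x : limn (fun n => (h_ n x)%:E) = (h x)%:E.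
  apply: cvg_lim => //; apply: cvg_near_cst.
  by have [N HN] := hlim x; exists N => // n /= Nn; rewrite HN.
apply/integrableP; split; first exact/measurable_EFinP.
have -> : (\int[mu]_x `|(EFin \o h) x| = \int[mu]_x limn (fun n => (h_ n x)%:E))%E.
  apply: eq_integral => x _; rewrite hl /= ger0_norm //.
  by have [N HN] := hlim x; rewrite -(HN N).
rewrite (@monotone_convergence _ _ _ mu setT measurableT (fun n x => (h_ n x)%:E)).
- apply: (@le_lt_trans _ _ C%:E); last exact: ltry.
  apply: lime_le.
    apply: ereal_nondecreasing_is_cvgn => m n mn.
    apply: ge0_le_integral => //; do ?[by move=> x _; rewrite lee_fin].
    + by apply/measurable_EFinP; exact: rintble_meas.
    + by apply/measurable_EFinP; exact: rintble_meas.
    + by move=> x _; rewrite lee_fin hmono.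
  apply: nearW => n; have := hC n; rewrite -lee_fin /Rintegral fineK //.
  by apply: integrable_fin_num => //; exact: ih.
- by move=> n; apply/measurable_EFinP; exact: rintble_meas.
- by move=> n x _; rewrite lee_fin.
- by move=> x _ m n mn; rewrite lee_fin hmono.
Qed.

End BoundedIntegrals.

Section Queue.
Context {d : measure_display} {T : measurableType d} {R : realType}.
Variable P : probability T R.
Variables X Y V : {RV P >-> R}.
Hypothesis X_ge0 : {ae P, forall w, 0 <= X w}.
Hypothesis indepXY : independent2 X Y.
Hypothesis stable : ('E_P[Y] < 'E_P[X])%E.
Variable eps0 : R.
Hypothesis eps0_gt0 : 0 < eps0.
Hypothesis A_analytic : laplace_analytic_on X
      [set theta | - eps0 < complex.Re theta < eps0].
Hypothesis V_ge0 : {ae P, forall w, 0 <= V w}.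
Hypothesis V_stationary : stationary_workload X Y V.
Hypothesis B_entire : laplace_analytic_on Y setT.

Implicit Types (theta : R[i]) (Z : {RV P >-> R}).

Let P1 : P setT = 1%E := probability_setT P.

Let U : {RV P >-> R} := ((Y : {mfun T >-> R}) - X)%R.
Let dV := [the probability _ R of distribution P V].
Let dU := [the probability _ R of distribution P U].
Let Pi := (dV \x dU)%E.
Let Pi1 : Pi setT = 1%E := product_setT dV dU.

Let mX : measurable_fun setT X. Proof. by []. Qed.
Let mY : measurable_fun setT Y. Proof. by []. Qed.
Let mV : measurable_fun setT V. Proof. by []. Qed.
Let mU : measurable_fun setT U. Proof. by []. Qed.

Lemma laplaceE Z theta : laplace Z theta = expint P Z (- theta).
Proof. by []. Qed.

Lemma ae_ppart Z : {ae P, forall w, 0 <= Z w} ->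
  {ae P, forall w, Z w = ppart (Z w)}.
Proof. by apply: filterS => w /ppart_id. Qed.

Lemma expint_ae (Z Z' : T -> R) theta : measurable_fun setT Z ->
  measurable_fun setT Z' -> {ae P, forall w, Z w = Z' w} ->
  expint P Z theta = expint P Z' theta.
Proof.
move=> mZ mZ' ZZ'; apply: cint_ae; [exact: cmeas_cexp | exact: cmeas_cexp |].
by apply: filterS ZZ' => w ->.
Qed.

Lemma rintble_exp_ae (Z Z' : T -> R) (a : R) : measurable_fun setT Z ->
  measurable_fun setT Z' -> {ae P, forall w, Z w = Z' w} ->
  rintble P (fun x => expR (a * Z x)) -> rintble P (fun x => expR (a * Z' x)).
Proof.
move=> mZ mZ' ZZ'; apply: rintble_ae.
- by apply: measurable_expR_comp; exact: measurable_funM.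
- by apply: measurable_expR_comp; exact: measurable_funM.
- by apply: filterS ZZ' => w ->.
Qed.

Lemma cderivable_laplace_below Z (c : R) : {ae P, forall w, 0 <= Z w} ->
  rintble P (fun w => expR (c * Z w)) ->
  (forall a : R, a <= c -> rintble P (fun w => expR (a * Z w))) /\
  forall theta, - complex.Re theta < c -> cderivable (laplace Z) theta.
Proof.
move=> Z0 iZ; have mZ : measurable_fun setT Z by [].
have mZp := measurable_ppart mZ; have ae := ae_ppart Z0.
have ea : {ae P, forall w, ppart (Z w) = Z w} by apply: filterS ae => w <-.
have iZp := rintble_exp_ae mZ mZp ae iZ.
have Zp0 w : 0 <= ppart (Z w) by exact: ppart_ge0.
split=> [a ac|theta tc].
  by apply: (rintble_exp_ae mZp mZ ea); exact: (rintble_exp_le mZp Zp0 iZp ac).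
apply: (@cderivable_local _ (fun w => expint P (fun x => ppart (Z x)) (- w))).
  by exists 1 => // w _; rewrite laplaceE; apply: expint_ae.
apply: (@cderivable_comp _ (fun w => - w)).
  by apply: cderivableN; exact: cderivable_id.
by apply: (cderivable_expint mZp Zp0 iZp); rewrite ReN.
Qed.

Lemma rintble_expX (c : R) : c < eps0 -> rintble P (fun w => expR (c * X w)).
Proof.
move=> ce; pose c' := Num.max c 0.
have c'e : c' < eps0 by rewrite gt_max ce.
have c'0 : 0 <= c' by rewrite le_max lexx orbT.
have [[i _] _] : cintble P (fun w => cexp (- (- c'%:C) * (X w)%:C)) /\
    cderivable (laplace X) (- c'%:C).
  by apply: A_analytic; rewrite /= ltrN2 c'e (le_lt_trans _ eps0_gt0) // oppr_le0.
have {}i : rintble P (fun w => expR (c' * X w)).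
  move: i; congr rintble; apply/funext => w; rewrite opprK -rmorphM.
  by rewrite Re_cexp ReC ImC cos0 mulr1.
by apply: (cderivable_laplace_below X_ge0 i).1; rewrite le_max lexx.
Qed.

Lemma cderivable_laplaceX theta : - eps0 < complex.Re theta ->
  cderivable (laplace X) theta.
Proof.
move=> te; have : - complex.Re theta < eps0 by rewrite ltrNl.
move=> /midf_lt [t1 t2].
by apply: (cderivable_laplace_below X_ge0 (rintble_expX t2)).2.
Qed.

Lemma rintble_expY (c : R) : rintble P (fun w => expR (c * Y w)).
Proof.
have [[i _] _] := B_entire (I : setT (- c%:C)).
move: i; congr rintble; apply/funext => w; rewrite opprK -rmorphM.
by rewrite Re_cexp ReC ImC cos0 mulr1.
Qed.

Lemma cderivable_characteristic theta : complex.Re theta < eps0 ->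
  cderivable (characteristic X Y) theta.
Proof.
move=> te; apply: cderivableB; last exact: cderivable_cst.
apply: cderivableM; first by have [] := B_entire (I : setT theta).
apply: (@cderivable_comp _ (fun w => - w)).
  by apply: cderivableN; exact: cderivable_id.
by apply: cderivable_laplaceX; rewrite ReN ltrN2.
Qed.

Lemma UE w : U w = Y w - X w. Proof. by []. Qed.

Lemma cint_expU theta : complex.Re theta < eps0 ->
  cintble P (fun w => cexp (- theta * (U w)%:C)) /\
  expint P U (- theta) = characteristic X Y theta + 1.
Proof.
move=> te.
have fX : cintble P (fun w => cexp (theta * (X w)%:C)).
  by apply: cintble_cexp => //; exact: rintble_expX.
have gY : cintble P (fun w => cexp (- theta * (Y w)%:C)).
  by apply: cintble_cexp => //; exact: rintble_expY.
have mid : measurable_fun setT (@idfun R) by exact: measurable_id.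
have [i e] := cint_independent indepXY (cmeas_cexp theta mid) (cmeas_cexp (- theta) mid) fX gY.
have E : (fun w => cexp (- theta * (U w)%:C)) =
    (fun w => cexp (theta * (X w)%:C) * cexp (- theta * (Y w)%:C)).
  apply/funext => w; rewrite -cexpD UE rmorphB /= mulrBr addrC.
  by rewrite [- theta * (X w)%:C]mulNr opprK.
split; first by rewrite E.
rewrite /characteristic subrK !laplaceE opprK mulrC -e.
by rewrite /expint E.
Qed.

Lemma rintble_expU (c : R) : - eps0 < c -> rintble P (fun w => expR (c * U w)).
Proof.
move=> ce; have te : complex.Re ((- c)%:C : R[i]) < eps0 by rewrite ReC ltrNl.
have [[i _] _] := cint_expU te.
move: i; congr rintble; apply/funext => w; rewrite -rmorphN opprK -rmorphM.
by rewrite Re_cexp ReC ImC cos0 mulr1.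
Qed.

(** [E exp (delta U) = 1 + delta E U + O (delta ^ 2)], where [E U < 0]. *)
Lemma drift : exists2 delta : R, 0 < delta < eps0 &
  \int[P]_w expR (delta * U w) < 1.
Proof.
pose k := eps0 / 2.
have e0 := eps0_gt0.
have k0 : 0 < k by rewrite divr_gt0.
have ke : k < eps0 by rewrite /k; lra.
have k20 : 0 < k / 2 by rewrite divr_gt0.
have iabs : rintble P (fun w => expR (k * `|U w|)).
  have i1 : rintble P (fun w => expR (k * U w)).
    by apply: rintble_expU; rewrite (lt_trans _ k0) // oppr_lt0.
  have i2 : rintble P (fun w => expR ((- k) * U w)) by apply: rintble_expU; rewrite ltrN2.
  apply: (rintble_le _ _ (rintbleD i1 i2)).
    by apply: measurable_expR_comp; apply: measurable_funM => //; apply: measurableT_comp.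
  move=> w; rewrite ger0_norm ?expR_ge0 //.
  have e1 := expR_ge0 (k * U w); have e2 := expR_ge0 (- k * U w).
  case: (leP 0 (U w)) => u0; first by rewrite ger0_norm // lerDl.
  by rewrite ltr0_norm // mulrN -mulNr lerDr.
have absle w : `|U w| <= k^-1 * expR (k * `|U w|) by apply: mulr_exp_le.
have iU : rintble P U.
  by apply: (rintble_le mU absle); exact: rintbleZ.
have sq w : U w ^+ 2 * expR (k / 2 * `|U w|) <= (k / 2) ^- 2 * 4 * expR (k * `|U w|).
  rewrite -real_normK ?num_real //.
  have := ler_wpM2r (expR_ge0 (k / 2 * `|U w|)) (sqr_exp_le k20 (normr_ge0 (U w))).
  by rewrite -[X in _ <= X -> _]mulrA -expRD -mulrDl -splitr.
pose K := \int[P]_w ((k / 2) ^- 2 * 4 * expR (k * `|U w|)).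
have K0 : 0 <= K.
  by apply: Rintegral_ge0 => w _; rewrite mulr_ge0 ?expR_ge0 // mulr_ge0 // invr_ge0 exprn_ge0 // ltW.
pose m := \int[P]_w U w.
have m0 : m < 0.
  have iY : rintble P Y.
    apply: (rintble_le (k := fun w => expR (1 * Y w) + expR (-1 * Y w)) mY).
      move=> w; rewrite mul1r mulN1r.
      have e1 := expR_ge1Dx (Y w); have e2 := expR_ge1Dx (- Y w).
      have e3 := expR_ge0 (Y w); have e4 := expR_ge0 (- Y w).
      by rewrite ler_norml; lra.
    by apply: rintbleD; exact: rintble_expY.
  have iX : rintble P X.
    have := rintbleB iY iU; congr rintble; apply/funext => w; rewrite UE; ring.
  have -> : m = \int[P]_w Y w - \int[P]_w X w by rewrite -rintB.
  rewrite subr_lt0 -lte_fin; move: stable; rewrite unlock.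
  by rewrite !fineK //; apply: integrable_fin_num.
pose delta := Num.min (k / 2) (- m / (K + 1) / 2).
have K10 : 0 < K + 1 by rewrite ltr_wpDl.
have d0 : 0 < delta by rewrite lt_min k20 !divr_gt0 // oppr_gt0.
have dk : delta <= k / 2 by rewrite ge_min lexx.
have dm : delta * (K + 1) <= - m / 2.
  rewrite -ler_pdivlMr // mulrAC ge_min [X in _ || X]lexx orbT //.
have iR : rintble P (fun w => 1 + delta * U w + delta ^+ 2 * ((k / 2) ^- 2 * 4 * expR (k * `|U w|))).
  apply: rintbleD; last by do 2 apply: rintbleZ.
  by apply: rintbleD; [exact: rintble_cst | exact: rintbleZ].
exists delta; first by rewrite d0 /=; apply: le_lt_trans dk _; rewrite /k; lra.
apply: (@le_lt_trans _ _ (1 + delta * m + delta ^+ 2 * K)).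
  have -> : 1 + delta * m + delta ^+ 2 * K = \int[P]_w (1 + delta * U w
      + delta ^+ 2 * ((k / 2) ^- 2 * 4 * expR (k * `|U w|))).
    have i1 : rintble P (fun w => 1 + delta * U w).
      by apply: rintbleD; [exact: rintble_cst | exact: rintbleZ].
    rewrite rintD //; last by do 2 apply: rintbleZ.
    rewrite (rintD (rintble_cst P1 1) (rintbleZ delta iU)).
    by rewrite (rintZ delta iU) (rintZ (delta ^+ 2) (rintbleZ _ iabs)) (rint_cst P1).
  apply: rint_le => //.
    by apply: rintble_expU; rewrite (lt_trans _ d0) // oppr_lt0.
  move=> w; apply: le_trans (expR_le_quadratic _) _.
  rewrite lerD2l exprMn -[leLHS]mulrA ler_wpM2l ?sqr_ge0 //; apply: le_trans (sq w).
  rewrite ler_wpM2l ?sqr_ge0 // ler_expR normrM ger0_norm ?(ltW d0) //.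
  by rewrite ler_wpM2r.
have : delta * (m + delta * K) < 0.
  rewrite pmulr_rlt0 //; apply: le_lt_trans (_ : m - m / 2 < 0); last by lra.
  rewrite lerD2l; apply: le_trans (_ : delta * (K + 1) <= _); last by rewrite -mulNr.
  by rewrite ler_wpM2l ?(ltW d0) // lerDl.
by rewrite mulrDr mulrA -expr2; lra.
Qed.

Let law_V (A : set R) : measurable A ->
  P (V @^-1` A) = Pi ((fun p => ppart (p.1 + p.2)) @^-1` A).
Proof. exact: V_stationary. Qed.

Let m_sum : measurable_fun setT (fun p : R * R => p.1 + p.2).
Proof. by apply: measurable_funD; [exact: measurable_fst | exact: measurable_snd]. Qed.

Let m_psum : measurable_fun setT (fun p : R * R => ppart (p.1 + p.2)).
Proof. exact: measurable_ppart m_sum. Qed.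

Let law_id Z (A : set R) : measurable A ->
  P (Z @^-1` A) = distribution P Z (idfun @^-1` A).
Proof. by []. Qed.

Let mid : measurable_fun setT (@idfun R).
Proof. exact: measurable_id. Qed.

Let rint_stat (h : R -> R) : measurable_fun setT h -> rintble P (fun w => h (V w)) ->
  rintble Pi (fun p => h (ppart (p.1 + p.2))) /\
  \int[Pi]_p h (ppart (p.1 + p.2)) = \int[P]_w h (V w).
Proof.
move=> mh ih; split.
  exact: (@rintble_law _ _ _ _ _ _ _ P Pi V (fun p => ppart (p.1 + p.2)) mV m_psum law_V h mh ih).
exact: (@rint_law _ _ _ _ _ _ _ P Pi V (fun p => ppart (p.1 + p.2)) mV m_psum law_V h mh ih).
Qed.

Let rint_dist Z (h : R -> R) : measurable_fun setT h -> rintble P (fun w => h (Z w)) ->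
  rintble (distribution P Z) h /\ \int[distribution P Z]_x h x = \int[P]_w h (Z w).
Proof.
move=> mh ih; have mZ : measurable_fun setT Z by [].
pose dZ := [the probability _ R of distribution P Z].
split.
  exact: (@rintble_law _ _ _ _ _ _ _ P dZ Z idfun mZ mid (law_id Z) h mh ih).
exact: (@rint_law _ _ _ _ _ _ _ P dZ Z idfun mZ mid (law_id Z) h mh ih).
Qed.

(** The truncated exponential [exp (delta min (v, n))] is an integrable test
    function; beyond [n] one step cannot increase it, and below [n] a step
    multiplies it on average by the factor [E exp (delta U) < 1], up to the
    error [1] made at the barrier.  Stationarity then bounds the exponential
    moment of [V] uniformly in [n]. *)
Lemma exp_moment_V : exists2 delta : R, 0 < delta & rintble P (fun w => expR (delta * V w)).
Proof.
have [delta /andP[d0 de] rho1] := drift; exists delta => //.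
set rho := Rintegral _ _ _ in rho1.
have iU : rintble P (fun w => expR (delta * U w)).
  by apply: rintble_expU; rewrite (lt_trans _ d0) // oppr_lt0.
pose f (n : nat) v := expR (delta * Num.min v n%:R).
pose g (n : nat) v := \1_(`]-oo, n%:R]) v * expR (delta * v).
have mexp : measurable_fun setT (fun v : R => expR (delta * v)).
  by apply: measurable_expR_comp; exact: measurable_funM.
have mf n : measurable_fun setT (f n).
  by apply: measurable_expR_comp; apply: measurable_funM => //; apply: measurable_minr.
have mg n : measurable_fun setT (g n).
  by apply: measurable_funM => //; apply: measurable_indic.
have gE n v : g n v = if v <= n%:R then expR (delta * v) else 0.
  by rewrite /g indicE mem_setE in_itv /=; case: ifP => _; rewrite ?mul1r ?mul0r.
have f0 n v : 0 <= f n v <= expR (delta * n%:R).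
  by rewrite expR_ge0 ler_expR ler_wpM2l ?(ltW d0) // ge_min lexx orbT.
have g0 n v : 0 <= g n v <= expR (delta * n%:R).
  rewrite gE; case: ifP => vn; rewrite ?lexx expR_ge0 //=.
  by rewrite ler_expR ler_wpM2l ?(ltW d0).
(* [g n] is the part of [f n] below the truncation level; the first summand
   treats the part above it. *)
have key n v u : f n (ppart (v + u)) <= (f n v - g n v) * 1 + 1 + g n v * expR (delta * u).
  rewrite mulr1 gE; case: ifPn => vn.
    rewrite /f [Num.min v _]min_l // subrr add0r -expRD -mulrDr.
    apply: (@le_trans _ _ (expR (delta * ppart (v + u)))).
      by rewrite ler_expR ler_wpM2l ?(ltW d0) // ge_min lexx.
    have e0 := expR_ge0 (delta * (v + u)).
    have [x0|/ltW x0] := leP 0 (v + u); first by rewrite ppart_id // lerDr.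
    by rewrite ppart_eq0 // mulr0 expR0 lerDl.
  rewrite subr0 mul0r addr0 (@le_trans _ _ (f n v)) ?lerDl //.
  rewrite /f ler_expR ler_wpM2l ?(ltW d0) // [leRHS]min_r ?ge_min ?lexx ?orbT //.
  by rewrite ltW // ltNge.
have ifV n : rintble P (fun w => f n (V w)).
  apply: (@rintble_bounded _ _ _ _ P1 _ (expR (delta * n%:R))).
    exact: (measurableT_comp (mf n) mV).
  by move=> w; have /andP[a b] := f0 n (V w); rewrite ger0_norm.
have igV n : rintble P (fun w => g n (V w)).
  apply: (@rintble_bounded _ _ _ _ P1 _ (expR (delta * n%:R))).
    exact: (measurableT_comp (mg n) mV).
  by move=> w; have /andP[a b] := g0 n (V w); rewrite ger0_norm.
have bound n : \int[P]_w g n (V w) <= (1 - rho)^-1.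
  have [s1 s2] := rint_stat (mf n) (ifV n).
  have [df1 df2] := rint_dist (mf n) (ifV n).
  have [dg1 dg2] := rint_dist (mg n) (igV n).
  have [du1 du2] := rint_dist mexp iU.
  have [p1 p2] := @rint_prod _ _ _ _ R dV dU _ _ (rintbleB df1 dg1) (rintble_cst (probability_setT dU) 1).
  have [q1 q2] := @rint_prod _ _ _ _ R dV dU _ _ dg1 du1.
  have p1' := rintbleD p1 (rintble_cst Pi1 1).
  have : \int[Pi]_p f n (ppart (p.1 + p.2)) <= \int[Pi]_p ((f n p.1 - g n p.1) * 1 + 1
      + g n p.1 * expR (delta * p.2)).
    by apply: rint_le => //; exact: rintbleD.
  rewrite (rintD p1' q1) (rintD p1 (rintble_cst Pi1 1)) (rint_cst Pi1) p2 q2.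
  rewrite (rint_cst (probability_setT dU)) (rintB df1 dg1) s2 df2 dg2 du2 -/rho.
  rewrite -[(1 - rho)^-1]mul1r ler_pdivlMr ?subr_gt0 //.
  by rewrite mulrBr mulr1; lra.
apply: (@rintble_monotone _ _ _ _ (fun n w => g n (V w)) _ (1 - rho)^-1) => //.
- exact: (measurableT_comp mexp mV).
- by move=> n w; have /andP[] := g0 n (V w).
- move=> w m n mn; rewrite !gE; case: ifP => vm.
    by rewrite (le_trans vm) // ler_nat.
  by case: ifP => // _; exact: expR_ge0.
- move=> w; exists (Num.bound `|V w|) => n Nn; rewrite gE ifT //.
  apply: le_trans (ler_norm _) _; apply: ltW; apply: lt_le_trans (archi_boundP (normr_ge0 _)) _.
  by rewrite ler_nat.
Qed.

(** The idle time of the server that ends with the arrival. *)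
Let idle (p : R * R) : R := ppart (- (p.1 + p.2)).
Let m_idle : measurable_fun setT idle.
Proof. by apply: measurable_ppart; exact: measurableT_comp m_sum. Qed.
Let idle_ge0 p : 0 <= idle p. Proof. exact: ppart_ge0. Qed.

Section Moment.
Variable delta : R.
Hypotheses (d0 : 0 < delta) (iV : rintble P (fun w => expR (delta * V w))).

Let rintble_expV (a : R) : a <= delta -> rintble P (fun w => expR (a * V w)).
Proof. exact: (cderivable_laplace_below V_ge0 iV).1. Qed.

Let cintble_expV theta : - delta <= complex.Re theta ->
  cintble P (fun w => cexp (- theta * (V w)%:C)).
Proof.
by move=> td; apply: cintble_cexp => //; apply: rintble_expV; rewrite ReN lerNl.
Qed.

Let cint_stat theta : - delta <= complex.Re theta ->
  cintble Pi (fun p => cexp (- theta * (ppart (p.1 + p.2))%:C)) /\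
  cint Pi (fun p => cexp (- theta * (ppart (p.1 + p.2))%:C)) = laplace V theta.
Proof.
move=> td; have iVt := cintble_expV td.
pose f (v : R) := cexp (- theta * v%:C).
have mf : cmeas f by exact: (@cmeas_cexp _ _ _ (- theta) idfun mid).
split.
  exact: (@cintble_law _ _ _ _ _ _ _ P Pi V (fun p => ppart (p.1 + p.2)) mV m_psum law_V f mf iVt).
exact: (@cint_law _ _ _ _ _ _ _ P Pi V (fun p => ppart (p.1 + p.2)) mV m_psum law_V f mf iVt).
Qed.

Let cint_sum theta : - delta <= complex.Re theta < eps0 ->
  cintble Pi (fun p => cexp (- theta * (p.1 + p.2)%:C)) /\
  cint Pi (fun p => cexp (- theta * (p.1 + p.2)%:C)) =
    laplace V theta * (characteristic X Y theta + 1).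
Proof.
move=> /andP[td te]; have iVt := cintble_expV td; have [iUt eU] := cint_expU te.
pose f (v : R) := cexp (- theta * v%:C).
have mf : cmeas f by exact: (@cmeas_cexp _ _ _ (- theta) idfun mid).
have fV : cintble dV f.
  exact: (@cintble_law _ _ _ _ _ _ _ P dV V idfun mV mid (law_id V) f mf iVt).
have eV' : cint dV f = laplace V theta.
  exact: (@cint_law _ _ _ _ _ _ _ P dV V idfun mV mid (law_id V) f mf iVt).
have fU : cintble dU f.
  exact: (@cintble_law _ _ _ _ _ _ _ P dU U idfun mU mid (law_id U) f mf iUt).
have eU' : cint dU f = expint P U (- theta).
  exact: (@cint_law _ _ _ _ _ _ _ P dU U idfun mU mid (law_id U) f mf iUt).
have [i e] := cint_prod fV fU.
have E : (fun p : R * R => cexp (- theta * (p.1 + p.2)%:C)) = (fun p => f p.1 * f p.2).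
  by apply/funext => p; rewrite /f -cexpD rmorphD mulrDr.
by rewrite E; split => //; rewrite e eV' eU' eU.
Qed.

Lemma cint_idle theta : - delta <= complex.Re theta < eps0 ->
  cintble Pi (fun p => cexp (theta * (idle p)%:C)) /\
  laplace V theta * characteristic X Y theta = - (1 - expint Pi idle theta).
Proof.
move=> tde; have /andP[td te] := tde.
have [i1 e1] := cint_stat td; have [i2 e2] := cint_sum tde.
have i3 := cintble_cst Pi1 1.
have E : (fun p => cexp (theta * (idle p)%:C)) = (fun p : R * R =>
    cexp (- theta * (p.1 + p.2)%:C) + 1 - cexp (- theta * (ppart (p.1 + p.2))%:C)).
  by apply/funext => p; rewrite cexp_ppart opprB addrC subrK.
split; first by rewrite E; exact: cintbleB (cintbleD i2 i3) i1.
rewrite /expint E cintB //; last exact: cintbleD.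
by rewrite cintD // e1 e2 (cint_cst Pi1); ring.
Qed.

Lemma rintble_idle (c : R) : c < eps0 -> rintble Pi (fun p => expR (c * idle p)).
Proof.
move=> ce; pose c' := Num.max c 0.
have c'e : c' < eps0 by rewrite gt_max ce.
have c'0 : 0 <= c' by rewrite le_max lexx orbT.
have [] := @cint_idle c'%:C.
  by rewrite ReC c'e andbT (le_trans _ c'0) // oppr_le0 ltW.
move=> [i _] _.
have {}i : rintble Pi (fun p => expR (c' * idle p)).
  move: i; congr rintble; apply/funext => w; rewrite -rmorphM.
  by rewrite Re_cexp ReC ImC cos0 mulr1.
by apply: (rintble_exp_le m_idle idle_ge0 i); rewrite le_max lexx.
Qed.

End Moment.

(** The Wiener-Hopf equation of the queue: the stationary equation, rewritten
    with [cexp_ppart], says that the Laplace transform of [V] is [- H / F] where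
    [1 - H] is the transform of the idle time, which is bounded on the left
    half-plane. *)
Lemma wiener_hopf : exists delta : R, exists H : R[i] -> R[i],
  [/\ 0 < delta,
      rintble P (fun w => expR (delta * V w)),
      (forall theta, complex.Re theta < eps0 -> cderivable H theta) /\
      (forall theta, complex.Re theta <= 0 -> cmod (H theta) <= 2),
      (forall theta, - delta < complex.Re theta -> cderivable (laplace V) theta) &
      (forall theta, - delta < complex.Re theta < eps0 ->
        laplace V theta * characteristic X Y theta = - H theta)].
Proof.
have [delta d0 iV] := exp_moment_V.
exists delta, (fun theta => 1 - expint Pi idle theta); split=> //; first split.
- move=> theta te; apply: cderivableB; first exact: cderivable_cst.
  have [t1 t2] := midf_lt te.
  exact: (cderivable_expint m_idle idle_ge0 (rintble_idle d0 iV t2) t1).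
- move=> theta t0; apply: le_trans (cmodD _ _) _; rewrite cmod1 cmodN.
  by have := cmod_expint_le1 Pi1 m_idle idle_ge0 t0; lra.
- move=> theta td; apply: (cderivable_laplace_below V_ge0 iV).2.
  by rewrite ltrNl.
- by move=> theta /andP[td te]; apply: (cint_idle iV _).2; rewrite te ltW.
Qed.

End Queue.

(** * Continuation of the equation and Laurent expansions *)

Section Continuation.
Context {R : realType}.
Variables (F H psi : R[i] -> R[i]) (e0 : R).
Hypothesis (e0_gt0 : 0 < e0).
Hypothesis F_der : forall w, complex.Re w < e0 -> cderivable F w.
Hypothesis H_der : forall w, complex.Re w < e0 -> cderivable H w.
Hypothesis psi_mero : forall z, meromorphic_at psi z.

(** Encodes an identity of meromorphic functions: values at [p] itself, where [psi]
    may have a pole, are disregarded. *)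
Definition equation_near (p : R[i]) : Prop :=
  exists2 d : R, 0 < d & forall w, w != p -> cmod (w - p) < d -> psi w * F w = - H w.

Lemma Re_near (p w : R[i]) : complex.Re w <= complex.Re p + cmod (w - p).
Proof. by rewrite -lerBlDl -ReN -ReD; exact: Re_le_cmod. Qed.

Lemma cmod_triangle (a b c : R[i]) : cmod (a - c) <= cmod (a - b) + cmod (b - c).
Proof. by apply: le_trans _ (cmodD _ _); rewrite addrA subrK. Qed.

Lemma equation_near_open p : equation_near p ->
  exists2 d : R, 0 < d & forall p', cmod (p' - p) < d -> equation_near p'.
Proof.
move=> [d d0 Hd]; exists d => // p' p'd.
have [->|p'p] := eqVneq p' p; first by exists d.
have c0 : 0 < cmod (p' - p) by rewrite cmod_gt0 subr_eq0.
exists (Num.min (d - cmod (p' - p)) (cmod (p' - p))); first by rewrite lt_min subr_gt0 p'd.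
move=> w _; rewrite lt_min => /andP[w1 w2]; apply: Hd.
  by apply: contraTneq w2 => ->; rewrite cmodB ltxx.
by have := cmod_triangle w p' p; lra.
Qed.

(** The singularity of [psi] at [p] is cleared by a power of [w - p], and the
    resulting derivable function vanishes near any point close to [p] at which
    the equation holds. *)
Lemma equation_near_closed p : complex.Re p < e0 ->
  exists2 r : R, 0 < r & forall p', cmod (p' - p) < r -> equation_near p' -> equation_near p.
Proof.
move=> pe; have [m [g [/near_cmodP [d1 d10 Hg] /near_dnbhs_cmodP [d2 d20 Hpsi]]]] := psi_mero p.
pose r := Num.min (Num.min d1 d2) (e0 - complex.Re p).
have r0 : 0 < r by rewrite !lt_min d10 d20 subr_gt0.
have rd1 : r <= d1 by rewrite !ge_min lexx.
have rd2 : r <= d2 by rewrite !ge_min lexx orbT.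
have re : r <= e0 - complex.Re p by rewrite ge_min lexx orbT.
exists (r / 4); first by rewrite divr_gt0.
move=> p' p'r [d d0 Hd].
have [<-|p'p] := eqVneq p' p; first by exists d.
have c0 : 0 < cmod (p' - p) by rewrite cmod_gt0 subr_eq0.
pose s := Num.min (Num.min (d / 2) (r / 8)) (cmod (p' - p) / 4).
have s0 : 0 < s by rewrite !lt_min !divr_gt0.
have sd : s <= d / 2 by rewrite !ge_min lexx.
have sr : s <= r / 8 by rewrite !ge_min lexx orbT.
have sc : s <= cmod (p' - p) / 4 by rewrite ge_min lexx orbT.
(* A disc around [a] avoids both [p] and [p'], where the equation may fail. *)
pose a := p' + s%:C.
have ap' : cmod (a - p') = s by rewrite /a addrAC subrr add0r cmodC ger0_norm ?ltW.
pose q w := g w * F w + (w - p) ^+ m * H w.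
have dq w : cmod (w - p) < r -> cderivable q w.
  move=> wr; have we : complex.Re w < e0 by have := Re_near p w; lra.
  apply: cderivableD; apply: cderivableM.
  - by apply: Hg; lra.
  - exact: F_der.
  - apply: cderivableX; apply: cderivableB; first exact: cderivable_id.
    exact: cderivable_cst.
  - exact: H_der.
have eqv w : w != p -> cmod (w - p) < r -> q w = (w - p) ^+ m * (psi w * F w + H w).
  move=> wp wr; rewrite Hpsi //; last by lra.
  by rewrite /q mulrDr !mulrA divff ?mul1r // expf_neq0 // subr_eq0.
have q0 w : cmod (w - a) < s / 2 -> q w = 0.
  move=> wa; have t1 := cmod_triangle w a p'; have t2 := cmod_triangle a w p'.
  have t3 := cmod_triangle w p' p; have t4 := cmod_triangle p' w p.
  rewrite (cmodB a w) in t2; rewrite (cmodB p' w) in t4.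
  have wp : w != p by rewrite -subr_eq0 -cmod_gt0; lra.
  have wp' : w != p' by rewrite -subr_eq0 -cmod_gt0; lra.
  by rewrite eqv //; [rewrite Hd ?addNr ?mulr0 //; lra | lra].
have ID : forall w, cmod (w - a) < r / 2 -> q w = 0.
  have s20 : 0 < s / 2 by rewrite divr_gt0.
  apply: (@identity_disc _ q a (r / 2) (s / 2) s20 _ q0) => w wa; apply: dq.
  by have := cmod_triangle w a p; have := cmod_triangle a p' p; lra.
exists (r / 8); first by rewrite divr_gt0.
move=> w wp wr; have : q w = 0.
  apply: ID; have := cmod_triangle w p a; have := cmod_triangle p p' a.
  by rewrite (cmodB p p') (cmodB p' a); lra.
rewrite eqv //; last by lra.
move=> /eqP; rewrite mulf_eq0 expf_eq0 subr_eq0 (negbTE wp) andbF /=.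
by rewrite addr_eq0 => /eqP.
Qed.

(** The parameters of the segment from [p0] to [p1] at which the equation holds
    form an open and closed set. *)
Lemma equation_continuation p0 p1 : complex.Re p0 < e0 -> complex.Re p1 < e0 ->
  equation_near p0 -> equation_near p1.
Proof.
move=> p0e p1e E0.
have [<- //|p01] := eqVneq p0 p1.
have c0 : 0 < cmod (p1 - p0) by rewrite cmod_gt0 subr_eq0 eq_sym.
pose p (s : R) := p0 + s%:C * (p1 - p0).
have pd s s' : cmod (p s - p s') = `|s - s'| * cmod (p1 - p0).
  rewrite /p opprD addrACA subrr add0r -mulrBl cmodM.
  by rewrite -rmorphB cmodC.
have pe s : 0 <= s <= 1 -> complex.Re (p s) < e0.
  move=> /andP[s0 s1]; rewrite /p ReD ReM ReC ImC mul0r subr0 ReD ReN.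
  have -> : complex.Re p0 + s * (complex.Re p1 - complex.Re p0) =
    (1 - s) * complex.Re p0 + s * complex.Re p1 by ring.
  have [->|s0'] := eqVneq s 0; first by rewrite subr0 mul1r mul0r addr0.
  have sp : 0 < s by rewrite lt0r s0' s0.
  have h1 : (1 - s) * complex.Re p0 <= (1 - s) * e0.
    by rewrite ler_wpM2l ?subr_ge0 // ltW.
  have h2 : s * complex.Re p1 < s * e0 by rewrite ltr_pM2l.
  by lra.
have near_s s d : 0 < d -> \forall s' \near s, cmod (p s' - p s) < d.
  move=> d0; apply/nbhs_ballP; exists (d / cmod (p1 - p0)); first by rewrite /= divr_gt0.
  by move=> s'; rewrite /ball /= pd ltr_pdivlMr // distrC.
pose B := [set s : R | 0 <= s <= 1 /\ equation_near (p s)].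
suff EB : B = `[0, 1]%classic.
  have : B 1 by rewrite EB /= in_itv /= ler01 lexx.
  by move=> [_]; rewrite /p mul1r addrC subrK.
apply: (@segment_connected R 0 1).
- by exists 0; split; [rewrite lexx ler01 | rewrite /p mul0r addr0].
- exists [set s | equation_near (p s)].
    rewrite openE => s /= /equation_near_open [d d0 Hd].
    by apply: filterS (near_s s d d0) => s'; exact: Hd.
  by rewrite predeqE => s; rewrite /B /= in_itv.
- exists B; last first.
    by rewrite predeqE => s; rewrite /B /= in_itv /=; split=> [[? ?]|[_ []]].
  rewrite -openC openE => s nBs; rewrite /interior.
  have [s01|s01] := boolP (s \in `[0, 1]).
    have ps : complex.Re (p s) < e0 by apply: pe; move: s01; rewrite in_itv.
    have [r r0 Hr] := equation_near_closed ps.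
    apply: filterS (near_s s r r0) => s' s'r [_ Es']; apply: nBs; split.
      by move: s01; rewrite in_itv.
    exact: Hr Es'.
  have : open (~` `[0, 1]%classic : set R).
    by apply: closed_openC; exact: interval_closed.
  rewrite openE => /(_ s); rewrite /interior /= => /(_ _) H0.
  apply: filterS (H0 _); last exact/negP.
  by move=> s' /= h [h01 _]; apply: h; rewrite in_itv.
Qed.

End Continuation.

Section Removable.
Context {R : realType}.
Implicit Types (f g : R[i] -> R[i]) (z w c : R[i]).

Definition removable f z := exists v, cderivable (fset_at f z v) z.

Lemma removable_local f g z :
  (exists2 d : R, 0 < d & forall w, w != z -> cmod (w - z) < d -> f w = g w) ->
  removable f z -> removable g z.
Proof.
move=> [d d0 H] [v Dv]; exists v; apply: cderivable_local Dv; exists d => // w wd.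
by rewrite /fset_at; case: eqVneq => // wz; apply: H.
Qed.

Lemma removable_cderivable f z : cderivable f z -> removable f z.
Proof.
move=> df; exists (f z); apply: cderivable_local df; exists 1 => // w _.
by rewrite /fset_at; case: eqVneq => // ->.
Qed.

Lemma removableD f g z : removable f z -> removable g z ->
  removable (fun w => f w + g w) z.
Proof.
move=> [v Dv] [v' Dv']; exists (v + v').
apply: cderivable_local (cderivableD Dv Dv'); exists 1 => // w _.
by rewrite /fset_at; case: eqVneq.
Qed.

Lemma removableM f g z : removable f z -> removable g z ->
  removable (fun w => f w * g w) z.
Proof.
move=> [v Dv] [v' Dv']; exists (v * v').
apply: cderivable_local (cderivableM Dv Dv'); exists 1 => // w _.
by rewrite /fset_at; case: eqVneq.
Qed.

Lemma removable_sum (I : Type) (s : seq I) (F : I -> R[i] -> R[i]) z :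
  (forall i, removable (F i) z) -> removable (fun w => \sum_(i <- s) F i w) z.
Proof.
move=> HF; elim: s => [|i s IH].
  rewrite (_ : (fun w => _) = fun=> 0).
    by apply: removable_cderivable; exact: cderivable_cst.
  by apply/funext => w; rewrite big_nil.
apply: removable_local (removableD (HF i) IH).
by exists 1 => // w _ _; rewrite big_cons.
Qed.

Lemma removable_quadratic f z v c (d K : R) : 0 < d ->
  (forall h, h != 0 -> cmod h < d -> cmod (f (z + h) - v - c * h) <= K * cmod h ^+ 2) ->
  removable f z.
Proof.
move=> d0 H; exists v; apply: (@cderivable_quadratic _ _ _ c d K d0) => h hd.
have [->|h0] := eqVneq h 0.
  by rewrite addr0 subrr sub0r mulr0 oppr0 cmod0 expr0n mulr0.
rewrite /fset_at eqxx ifN; first exact: H.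
by rewrite -subr_eq0 addrAC subrr add0r.
Qed.

(** Two more terms of the Taylor expansion exhibit the value and the derivative. *)
Lemma removable_cexp_rem (t : R) j z :
  removable (fun w => cexp_rem j ((w - z) * t%:C) / (w - z) ^+ j) z.
Proof.
apply: (@removable_quadratic _ _ ((t ^+ j / j`!%:R)%:C) ((t ^+ j.+1 / j.+1`!%:R)%:C)
  1 (`|t| ^+ j.+2 * expR `|t|)) => // h h0 h1.
have E : cexp_rem j (h * t%:C) / h ^+ j - (t ^+ j / j`!%:R)%:C - (t ^+ j.+1 / j.+1`!%:R)%:C * h
   = cexp_rem j.+2 (h * t%:C) / h ^+ j.
  have -> : cexp_rem j (h * t%:C) = cexp_rem j.+2 (h * t%:C)
     + h ^+ j * (t ^+ j / j`!%:R)%:C + h ^+ j * ((t ^+ j.+1 / j.+1`!%:R)%:C * h).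
    rewrite /cexp_rem !big_nat_recr //= !exprMn !rmorphM !fmorphV !rmorphXn !rmorph_nat /=.
    rewrite [h ^+ j.+1]exprS; ring.
  by rewrite !mulrDl ![h ^+ j * _]mulrC !mulfK ?expf_neq0 //; ring.
rewrite [z + h - z]addrAC subrr add0r E cmodM cmodV cmodX.
rewrite ler_pdivrMr ?exprn_gt0 ?cmod_gt0 //; apply: le_trans (cmod_cexp_rem _ _) _.
rewrite cmodM cmodC; set a := cmod h in h1 *; have a0 : 0 <= a by exact: cmod_ge0.
have -> : `|t| ^+ j.+2 * expR `|t| * a ^+ 2 * a ^+ j = (a * `|t|) ^+ j.+2 * expR `|t|.
  by rewrite exprMn -[in a ^+ j.+2]addn2 exprD; ring.
rewrite ler_wpM2l ?exprn_ge0 ?mulr_ge0 // ler_expR.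
by rewrite ler_piMl // ltW.
Qed.

Section Laurent.
Variables (f : R[i] -> R[i]) (z : R[i]) (c : int -> R[i]).
Hypothesis f_laurent : laurent_expansion f z c.

(** Truncations of the Laurent series approximate [f] to the order of the first
    neglected term. *)
Lemma laurent_truncation : exists m : nat, (forall k : int, k < - m%:Z -> c k = 0) /\
  exists d : R, exists2 K : R, 0 < d & forall M u, u != 0 -> cmod u < d ->
    cmod (u ^+ m * f (z + u) - \sum_(0 <= i < M) c (i%:Z - m%:Z) * u ^+ i) <=
      K * (cmod u / d) ^+ M.
Proof.
have [m [c0 /near_dnbhs_cmodP [r r0 Hr]]] := f_laurent; exists m; split=> //.
pose b (i : nat) := c (i%:Z - m%:Z).
pose p (u : R[i]) N := \sum_(0 <= i < N) b i * u ^+ i.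
have pcvg u : u != 0 -> cmod u < r -> forall e : R, 0 < e ->
    exists N : nat, forall n, (N <= n)%N -> cmod (p u n - u ^+ m * f (z + u)) < e.
  move=> u0 ur e e0.
  have zu : z + u != z by rewrite -subr_eq0 addrAC subrr add0r.
  have zur : cmod (z + u - z) < r by rewrite addrAC subrr add0r.
  have := Hr _ zu zur; rewrite cvg_cmodP => /(_ (e / cmod u ^+ m)).
  have um : 0 < cmod u ^+ m by rewrite exprn_gt0 // cmod_gt0.
  rewrite divr_gt0 // => /(_ isT) [N HN]; exists N => n /HN.
  rewrite ltr_pdivlMr // -cmodX -cmodM mulrBl [f _ * _]mulrC => /le_lt_trans; apply.
  rewrite /p mulr_suml le_eqVlt; apply/orP; left; apply/eqP; congr (cmod (_ - _)).
  apply: eq_bigr => i _; rewrite -mulrA; congr (_ * _).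
  rewrite [z + u - z]addrAC subrr add0r -[u ^+ m]/(u ^ m%:Z) -expfzDr //.
  by rewrite subrK.
(* Convergence at one point of modulus [r / 2] bounds the coefficients
   geometrically; on half that radius the tails are then summable. *)
pose u1 : R[i] := (r / 2)%:C.
have u1E : cmod u1 = r / 2 by rewrite cmodC ger0_norm // ltW // divr_gt0.
have u10 : u1 != 0 by rewrite -cmod_gt0 u1E divr_gt0.
have [N HN] := pcvg u1 u10 ltac:(rewrite u1E; lra) 1 ltr01.
have b_ge0 i : 0 <= cmod (b i) * (r / 2) ^+ i.
  by rewrite mulr_ge0 ?cmod_ge0 // exprn_ge0 // divr_ge0 // ltW.
have [K K0 HK] : exists2 K : R, 0 <= K & forall i, cmod (b i) * (r / 2) ^+ i <= K.
  exists (2 + \sum_(0 <= i < N) cmod (b i) * (r / 2) ^+ i).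
    by rewrite addr_ge0 // sumr_ge0.
  move=> i; have [Ni|iN] := leqP N i.
    apply: (@le_trans _ _ 2); last first.
      by rewrite lerDl sumr_ge0.
    have h1 := HN i Ni; have h2 := HN i.+1 (leqW Ni).
    have -> : cmod (b i) * (r / 2) ^+ i = cmod (p u1 i.+1 - p u1 i).
      by rewrite /p big_nat_recr //= addrAC subrr add0r cmodM cmodX u1E.
    have := cmod_triangle (p u1 i.+1) (u1 ^+ m * f (z + u1)) (p u1 i).
    by rewrite [cmod (u1 ^+ m * _ - _)]cmodB; lra.
  rewrite (bigD1_seq i) ?mem_index_iota ?iota_uniq //=.
  by rewrite [leRHS]addrCA lerDl addr_ge0 // sumr_ge0.
have tail u (M n : nat) : cmod u <= r / 4 -> cmod (p u (M + n)%N - p u M) <=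
    2 * K * (cmod u / (r / 4)) ^+ M.
  move=> ur.
  have cu := cmod_ge0 u.
  pose x := cmod u / (r / 2).
  have x0 : 0 <= x by rewrite divr_ge0 // divr_ge0 // ltW.
  have x1 : x <= 1 / 2 by rewrite ler_pdivrMr ?divr_gt0 //; lra.
  have xx : x <= cmod u / (r / 4).
    rewrite ler_wpM2l // lef_pV2 ?posrE ?divr_gt0 //; lra.
  apply: (@le_trans _ _ (2 * K * x ^+ M)); last first.
    by rewrite ler_wpM2l ?mulr_ge0 // lerXn2r // nnegrE ?(le_trans x0).
  suff : cmod (p u (M + n)%N - p u M) <= K * x ^+ M * (2 - (1 / 2) ^+ n * 2).
    move=> /le_trans; apply; rewrite mulrC mulrA ler_wpM2r ?exprn_ge0 //.
    by rewrite ler_wpM2r // gerBl mulr_ge0 // exprn_ge0 // divr_ge0.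
  elim: n => [|n IH]; first by rewrite addn0 subrr cmod0 expr0 mul1r subrr mulr0.
  rewrite addnS {1}/p big_nat_recr //= -/(p u (M + n)%N) addrAC.
  apply: le_trans (cmodD _ _) _; apply: le_trans (lerD IH (_ : _ <= K * x ^+ M * (1 / 2) ^+ n)) _.
    rewrite cmodM cmodX (_ : cmod u = x * (r / 2)); last first.
      by rewrite /x divfK // gt_eqF // divr_gt0.
    rewrite exprMn mulrCA -[leRHS]mulrA mulrC ler_pM ?mulr_ge0 ?cmod_ge0 ?exprn_ge0 //.
      by rewrite divr_ge0 // ltW.
    by rewrite exprD ler_wpM2l ?exprn_ge0 // lerXn2r ?nnegrE // divr_ge0.
  rewrite -mulrDr ler_wpM2l ?mulr_ge0 ?exprn_ge0 // exprS; lra.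
exists (r / 4), (2 * K); first by rewrite divr_gt0.
move=> M u u0 ur; apply/ler_addgt0Pl => e e0.
have [N' HN'] := pcvg u u0 ltac:(lra) e e0.
have h1 := HN' (M + N')%N (leq_addl _ _).
have h2 := tail u M N' (ltW ur).
have := cmod_triangle (u ^+ m * f (z + u)) (p u (M + N')) (p u M).
by rewrite [cmod (u ^+ m * _ - p u (M + N'))]cmodB /p /b in h1 h2 *; lra.
Qed.

Variables (F H g : R[i] -> R[i]) (k : nat).
Hypotheses (g_der : cderivable g z) (gz : g z != 0).
Hypothesis F_near : exists2 d : R, 0 < d &
  forall w, cmod (w - z) < d -> F w = (w - z) ^+ k * g w.
Hypothesis f_eq : exists2 d : R, 0 < d &
  forall w, w != z -> cmod (w - z) < d -> f w * F w = - H w /\ cmod (H w) <= 2.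

(** The order of the pole of [f = - H / F] is at most the order of the zero of
    [F], because [H] is bounded. *)
Lemma laurent_pole_order (j : nat) : (k < j)%N -> c (- j%:Z) = 0.
Proof.
move=> kj; have [m [c0 [d [K d0 HK]]]] := laurent_truncation.
have [jm|mj] := leqP j m; last by apply: c0; rewrite ltrN2 ltz_nat.
have [d1 d10 Hd1] := F_near; have [d2 d20 Hd2] := f_eq.
have gz2 : 0 < cmod (g z) / 2 by rewrite divr_gt0 // cmod_gt0.
have [d3 d30 Hd3] := cderivable_continuous g_der gz2.
pose C := 4 / cmod (g z).
have C0 : 0 < C by rewrite divr_gt0 // cmod_gt0.
pose r := Num.min (Num.min d1 d2) (Num.min (Num.min d d3) 1).
have r0 : 0 < r by rewrite !lt_min d10 d20 d0 d30 ltr01.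
(* Near [z] the factor [g] stays away from [0], so that [|f (z + u)|] is at
   most a multiple of [|u| ^ - k]. *)
have bound u : u != 0 -> cmod u < r -> cmod (u ^+ m * f (z + u)) <= C * cmod u ^+ (m - k).
  move=> u0; rewrite !lt_min => /andP[/andP[u1 u2] /andP[/andP[u3 u4] u5]].
  have zu : z + u - z = u by rewrite addrAC subrr add0r.
  have zu0 : z + u != z by rewrite -subr_eq0 zu.
  have [E H2] := Hd2 (z + u) zu0 ltac:(rewrite zu; exact: u2).
  rewrite Hd1 zu // in E.
  have gu : cmod (g z) / 2 < cmod (g (z + u)).
    have h := Hd3 (z + u) ltac:(rewrite zu; exact: u4).
    by have := cmod_sub_le (g z) (g (z + u)); rewrite cmodB; lra.
  have km : (k <= m)%N by rewrite (leq_trans (ltnW kj)).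
  have {}E : cmod (f (z + u)) * cmod u ^+ k * cmod (g (z + u)) <= 2.
    by rewrite -cmodX -mulrA -!cmodM E cmodN.
  rewrite cmodM cmodX -{1}(subnK km) exprD -mulrA [leRHS]mulrC.
  rewrite ler_wpM2l ?exprn_ge0 ?cmod_ge0 // mulrC.
  rewrite /C ler_pdivlMr ?cmod_gt0 //.
  set a := cmod (f _) * _ in E *; have a0 : 0 <= a by rewrite mulr_ge0 ?exprn_ge0 ?cmod_ge0.
  have : a * (cmod (g z) / 2) <= a * cmod (g (z + u)) by rewrite ler_wpM2l // ltW.
  by lra.
(* The lowest nonvanishing coefficient would dominate the expansion as [u]
   tends to [0]. *)
suff vanish i : (i < m - k)%N -> c (i%:Z - m%:Z) = 0.
  have -> : - j%:Z = (m - j)%N%:Z - m%:Z by rewrite -subzn // addrAC subrr add0r.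
  by apply: vanish; rewrite ltn_sub2l // (leq_trans kj).
elim/ltn_ind: i => i IH ik.
have S u : \sum_(0 <= l < i.+1) c (l%:Z - m%:Z) * u ^+ l = c (i%:Z - m%:Z) * u ^+ i.
  rewrite big_nat_recr //= big_nat_cond big1 ?add0r // => l /andP[/andP[_ li] _].
  by rewrite IH ?mul0r // (ltn_trans li).
apply/eqP; rewrite -cmod_eq0 eq_le cmod_ge0 andbT.
pose C' := C + K * (d^-1) ^+ i.+1.
apply/ler_addgt0Pl => e e0; rewrite addr0.
have K0 : 0 < `|C'| + 1 by rewrite ltr_wpDl.
pose x := Num.min (r / 2) (e / (`|C'| + 1)).
have x0 : 0 < x by rewrite lt_min !divr_gt0.
have ux : cmod (x%:C : R[i]) = x by rewrite cmodC ger0_norm ?ltW.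
have u0 : x%:C != 0 :> R[i] by rewrite -cmod_gt0 ux.
have xr : x < r by rewrite gt_min; apply/orP; left; lra.
have b1 := bound x%:C u0 ltac:(rewrite ux; exact: xr).
have rd : r <= d by rewrite /r !ge_min lexx !orbT.
have r1 : r <= 1 by rewrite /r !ge_min lexx !orbT.
have b2 := HK i.+1 x%:C u0 ltac:(rewrite ux; lra).
rewrite S ux in b2; rewrite ux in b1.
have b3 : C * x ^+ (m - k) <= C * x ^+ i.+1.
  by rewrite ler_wpM2l ?(ltW C0) // ler_wiXn2l ?(ltW x0) //; lra.
have b4 : cmod (c (i%:Z - m%:Z)) * x ^+ i <= C' * x ^+ i.+1.
  have -> : cmod (c (i%:Z - m%:Z)) * x ^+ i = cmod (c (i%:Z - m%:Z) * x%:C ^+ i).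
    by rewrite cmodM cmodX ux.
  have := cmod_triangle (c (i%:Z - m%:Z) * x%:C ^+ i) (x%:C ^+ m * f (z + x%:C)) 0.
  rewrite !subr0 cmodB => h.
  rewrite /C' mulrDl -[K * _ * _]mulrA -exprMn [d^-1 * x]mulrC.
  by lra.
rewrite exprS mulrA ler_pM2r ?exprn_gt0 // in b4.
apply: le_trans b4 _; apply: (@le_trans _ _ ((`|C'| + 1) * x)).
  by rewrite ler_wpM2r ?(ltW x0) // (le_trans (ler_norm _)) // lerDl.
by rewrite mulrC -ler_pdivlMr // ge_min lexx orbT.
Qed.

(** The coefficients [c 0] and [c 1] are the value and the derivative of the
    regular part. *)
Lemma removable_principal_part :
  removable (fun w => f w - \sum_(1 <= j < k.+1) c (- j%:Z) / (w - z) ^+ j) z.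
Proof.
have [m [c0 [d [K d0 HK]]]] := laurent_truncation.
apply: (@removable_quadratic _ _ (c 0) (c 1) d (K * (d^-1) ^+ m.+2)) => // h h0 hd.
rewrite [z + h - z]addrAC subrr add0r.
pose M := maxn m k.
have ext (n : nat) : (n <= M)%N -> (forall j, (n < j)%N -> c (- j%:Z) = 0) ->
    \sum_(1 <= j < n.+1) c (- j%:Z) / h ^+ j = \sum_(1 <= j < M.+1) c (- j%:Z) / h ^+ j.
  move=> nM H0; rewrite [RHS](big_cat_nat (n := n.+1)) //=.
  rewrite [X in _ + X]big_nat_cond [X in _ + X]big1 ?addr0 // => j /andP[/andP[nj _] _].
  by rewrite H0 ?mul0r.
rewrite (ext k) ?leq_maxr //; last exact: laurent_pole_order.
rewrite -(ext m) ?leq_maxl //; last by move=> j mj; apply: c0; rewrite ltrN2 ltz_nat.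
have hm : h ^+ m != 0 by rewrite expf_neq0.
rewrite -(@ler_pM2r _ (cmod (h ^+ m))) ?cmod_gt0 // -cmodM.
have S2 : \sum_(0 <= i < m.+2) c (i%:Z - m%:Z) * h ^+ i =
    \sum_(0 <= i < m) c (i%:Z - m%:Z) * h ^+ i + c 0 * h ^+ m + c 1 * h ^+ m.+1.
  have e0 : m%:Z - m%:Z = 0 by rewrite subrr.
  have e1 : m.+1%:Z - m%:Z = 1 by rewrite -addn1 PoszD addrAC subrr add0r.
  transitivity (\sum_(0 <= i < m) c (i%:Z - m%:Z) * h ^+ i + c (m%:Z - m%:Z) * h ^+ m
      + c (m.+1%:Z - m%:Z) * h ^+ m.+1); last by rewrite e0 e1.
  by rewrite big_nat_recr //= big_nat_recr.
have := HK m.+2 h h0 hd; rewrite S2.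
have -> : \sum_(0 <= i < m) c (i%:Z - m%:Z) * h ^+ i =
    (\sum_(1 <= j < m.+1) c (- j%:Z) / h ^+ j) * h ^+ m.
  rewrite mulr_suml big_add1 /= [LHS]big_nat_rev /=.
  apply: eq_big_nat => i /andP[_ im]; rewrite add0n -subzn // addrAC subrr add0r.
  by rewrite -[in h ^+ m](subnK im) exprD mulrA -!mulrA [_ * h ^+ i.+1]mulrC mulKf ?expf_neq0.
move=> b; apply: le_trans (le_trans _ b) _.
  by rewrite le_eqVlt; apply/orP; left; apply/eqP; congr cmod; rewrite exprS; ring.
rewrite cmodX exprMn -[leRHS]mulrA -exprD add2n.
by rewrite [cmod h ^+ _ * _]mulrC mulrA.
Qed.

(** The principal part of [w |-> - cexp (w t) f w] at [z].  As a combination of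
    negative powers of [w - z] it has mean zero on circles around [0] that
    enclose [z]. *)
Definition exp_principal_part (t : R) (w : R[i]) : R[i] :=
  - \sum_(1 <= j < k.+1) c (- j%:Z) *
      \sum_(0 <= l < j) cexp (z * t%:C) * (t%:C ^+ l / l`!%:R) / (w - z) ^+ (j - l).

(** The Taylor polynomial of [cexp (w t)] at [z] of degree [j - 1] produces the
    principal part of [cexp (w t) / (w - z) ^ j]. *)
Lemma removable_exp_principal_part (t : R) :
  removable (fun w => - (cexp (w * t%:C) * f w) - exp_principal_part t w) z.
Proof.
have dexp : cderivable (fun w => cexp (w * t%:C)) z.
  apply: (@cderivable_comp _ (fun w => w * t%:C) cexp); last exact: cderivable_cexp.
  by apply: cderivableM; [exact: cderivable_id | exact: cderivable_cst].
have R1 := removableM (removable_cderivable dexp) removable_principal_part.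
have R2 : removable (fun w => \sum_(1 <= j < k.+1) (c (- j%:Z) * cexp (z * t%:C)) *
    (cexp_rem j ((w - z) * t%:C) / (w - z) ^+ j)) z.
  apply: removable_sum => j; apply: removableM.
    by apply: removable_cderivable; exact: cderivable_cst.
  exact: removable_cexp_rem.
have R0 : removable (fun=> -1) z by apply: removable_cderivable; exact: cderivable_cst.
apply: removable_local (removableM R0 (removableD R1 R2)); exists 1 => // w wz _.
have u0 : w - z != 0 by rewrite subr_eq0.
rewrite /exp_principal_part opprK mulN1r mulrBr -addrA opprD; congr (- _ + _).
rewrite opprD opprK mulr_sumr -sumrN -big_split /=.
apply: eq_bigr => j _.
rewrite /cexp_rem; set u := w - z in u0 *.
have -> : cexp (w * t%:C) = cexp (z * t%:C) * cexp (u * t%:C).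
  by rewrite -cexpD -mulrDl /u addrC subrK.
have -> : \sum_(0 <= l < j) cexp (z * t%:C) * (t%:C ^+ l / l`!%:R) / u ^+ (j - l) =
   cexp (z * t%:C) * (\sum_(0 <= l < j) (u * t%:C) ^+ l / l`!%:R) / u ^+ j.
  rewrite mulr_sumr mulr_suml; apply: eq_big_nat => l /andP[_ lj].
  rewrite exprMn -!mulrA; congr (_ * _).
  rewrite [u ^+ l * _]mulrC -!mulrA; congr (_ * (_ * _)).
  rewrite -[in u ^+ j](subnK (ltnW lj)) exprD invfM mulrC.
  by rewrite divfK ?expf_neq0 // mulrC.
by ring.
Qed.

End Laurent.

End Removable.

(** * The contour integral and its residues *)

Lemma cderivable_neq0_near {R : realType} (f : R[i] -> R[i]) (z : R[i]) :
  cderivable f z -> f z != 0 ->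
  exists2 d : R, 0 < d & forall w, cmod (w - z) < d -> f w != 0.
Proof.
move=> df; rewrite -cmod_gt0 => /(cderivable_continuous df) [d d0 Hd].
exists d => // w /Hd h; rewrite -cmod_gt0.
by have := cmod_sub_le (f z) (f w); rewrite cmodB; lra.
Qed.

Section PrincipalParts.
Context {R : realType}.
Implicit Types (z w b : R[i]) (r t : R).

Lemma conjc_mul z : z * z^* = (cmod z ^+ 2)%:C.
Proof.
by rewrite sqr_cmod; case: z => x y; apply: complex_eq; rewrite /=; ring.
Qed.

Lemma Re_conj z : complex.Re z^* = complex.Re z. Proof. by case: z. Qed.

(** On the circle, [1 / (w - z)] is the conjugate of [w / (r ^ 2 - z^* w)],
    which is derivable in the disc and vanishes at its centre. *)
Lemma circle_mean_pole z r i b : 0 < r -> cmod z < r -> (0 < i)%N ->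
  cont_on 0 (2 * pi) (fun y => complex.Re (b / (circ r y - z) ^+ i)) /\
  segint 0 (2 * pi) (fun y => complex.Re (b / (circ r y - z) ^+ i)) = 0.
Proof.
move=> r0 zr i0.
pose h w := w / ((r ^+ 2)%:C - z^* * w).
have den w : cmod w <= r -> (r ^+ 2)%:C - z^* * w != 0.
  move=> wr; have := @mobius_den _ r (- z) r0; rewrite cmodN => /(_ zr w wr).
  by rewrite (_ : (- z)^* * w = - (z^* * w)) // -mulNr; case: (z).
have dh w : cmod w <= r -> cderivable (fun w => b^* * h w ^+ i) w.
  move=> wr; apply: cderivableM; first exact: cderivable_cst.
  apply: cderivableX; apply: cderivableM; first exact: cderivable_id.
  apply: cderivableV; first exact: den.
  apply: cderivableB; first exact: cderivable_cst.
  by apply: cderivableM; [exact: cderivable_cst | exact: cderivable_id].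
have E y : complex.Re (b / (circ r y - z) ^+ i) = complex.Re (b^* * h (circ r y) ^+ i).
  set w := circ r y; have wr : cmod w = r by rewrite cmod_circ // ltW.
  have w0 : w != 0 by rewrite -cmod_gt0 wr.
  have wz : w - z != 0.
    by rewrite -cmod_gt0; have := cmod_sub_le w z; rewrite wr; lra.
  rewrite -Re_conj rmorphM fmorphV rmorphXn rmorphB /= -exprVn; congr (complex.Re (_ * _ ^+ i)).
  have E2 : (r ^+ 2)%:C = w^* * w by rewrite [RHS]mulrC conjc_mul wr.
  by rewrite /h E2 -mulrBl invfM mulrCA divff ?mulr1.
have cr y : cmod (circ r y) <= r by rewrite cmod_circ // ltW.
split.
  have [C _] : cont_on 0 (2 * pi) (fun y => complex.Re (b^* * h (circ r y) ^+ i)) /\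
      cont_on 0 (2 * pi) (fun y => complex.Im (b^* * h (circ r y) ^+ i)).
    by apply: (@cont_on_circ _ (fun w => b^* * h w ^+ i)) => // y _; exact: dh.
  move=> y yI e e0; have [d d0 Hd] := C y yI e e0; exists d => // y' /Hd.
  by rewrite !E.
rewrite (eq_segint (g := fun y => complex.Re (b^* * h (circ r y) ^+ i))) //.
rewrite (mean_value_Re r0 dh) /h mul0r expr0n eqn0Ngt i0 /= mulr0.
by rewrite mulr0.
Qed.

Lemma segint_sum_eq0 (I : Type) (s : seq I) (F : I -> R -> R) (a b : R) : a <= b ->
  (forall i, cont_on a b (F i) /\ segint a b (F i) = 0) ->
  cont_on a b (fun y => \sum_(i <- s) F i y) /\
  segint a b (fun y => \sum_(i <- s) F i y) = 0.
Proof.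
move=> ab HF; elim: s => [|i s [IH1 IH2]].
  have -> : (fun y => \sum_(i <- [::]) F i y) = fun=> 0.
    by apply/funext => y; rewrite big_nil.
  by split; [exact: cont_on_cst | rewrite segint_cst // mul0r].
have -> : (fun y => \sum_(i0 <- i :: s) F i0 y) = (fun y => F i y + \sum_(j <- s) F j y).
  by apply/funext => y; rewrite big_cons.
have [h1 h2] := HF i.
by split; [exact: cont_onD | rewrite segintD // h2 IH2 addr0].
Qed.

Lemma Re_sum (I : Type) (s : seq I) (P : pred I) (f : I -> R[i]) :
  complex.Re (\sum_(i <- s | P i) f i) = \sum_(i <- s | P i) complex.Re (f i).
Proof. by elim/big_rec2: _ => // i y1 y2 _ <-; rewrite ReD. Qed.

Section OnePole.
Variables (z : R[i]) (c : int -> R[i]) (k : nat) (t : R).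

Lemma circle_mean_principal_part r b : 0 < r -> cmod z < r ->
  cont_on 0 (2 * pi) (fun y => complex.Re (b * exp_principal_part z c k t (circ r y))) /\
  segint 0 (2 * pi) (fun y => complex.Re (b * exp_principal_part z c k t (circ r y))) = 0.
Proof.
move=> r0 zr.
have E y : complex.Re (b * exp_principal_part z c k t (circ r y)) =
   \sum_(1 <= j < k.+1) \sum_(0 <= l < j)
      (if (l < j)%N then complex.Re ((- b * c (- j%:Z) * (cexp (z * t%:C) * (t%:C ^+ l / l`!%:R)))
         / (circ r y - z) ^+ (j - l)) else 0).
  rewrite /exp_principal_part mulrN -mulNr mulr_sumr Re_sum; apply: eq_bigr => j _.
  rewrite mulrA mulr_sumr Re_sum; apply: eq_big_nat => l /andP[_ ->].
  by rewrite -!mulrA.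
have [h1 h2] : cont_on 0 (2 * pi) (fun y => \sum_(1 <= j < k.+1) \sum_(0 <= l < j)
      (if (l < j)%N then complex.Re ((- b * c (- j%:Z) * (cexp (z * t%:C) * (t%:C ^+ l / l`!%:R)))
         / (circ r y - z) ^+ (j - l)) else 0)) /\
   segint 0 (2 * pi) (fun y => \sum_(1 <= j < k.+1) \sum_(0 <= l < j)
      (if (l < j)%N then complex.Re ((- b * c (- j%:Z) * (cexp (z * t%:C) * (t%:C ^+ l / l`!%:R)))
         / (circ r y - z) ^+ (j - l)) else 0)) = 0.
  apply: segint_sum_eq0 => [|j]; first exact: two_pi_ge0.
  apply: segint_sum_eq0 => [|l]; first exact: two_pi_ge0.
  case: ltnP => lj; last first.
    by split; [exact: cont_on_cst | rewrite segint_cst ?mul0r // two_pi_ge0].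
  by apply: circle_mean_pole; rewrite // subn_gt0.
have -> : (fun y => complex.Re (b * exp_principal_part z c k t (circ r y))) =
   (fun y => \sum_(1 <= j < k.+1) \sum_(0 <= l < j)
      (if (l < j)%N then complex.Re ((- b * c (- j%:Z) * (cexp (z * t%:C) * (t%:C ^+ l / l`!%:R)))
         / (circ r y - z) ^+ (j - l)) else 0)) by apply/funext => y; exact: E.
by [].
Qed.

Lemma cderivable_principal_part w : w != z ->
  cderivable (exp_principal_part z c k t) w.
Proof.
move=> wz; apply: cderivableN; apply: cderivable_sum => j _.
apply: cderivableM; first exact: cderivable_cst.
apply: cderivable_sum => l _; apply: cderivableM; first exact: cderivable_cst.
apply: cderivableV; first by rewrite expf_neq0 // subr_eq0.
apply: cderivableX; apply: cderivableB; first exact: cderivable_id.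
exact: cderivable_cst.
Qed.

(** The residue at [z] of [- exp (w t) f (w) / w], where [f] has the Laurent
    coefficients [c]. *)
Definition pole_term : R[i] :=
  \sum_(1 <= j < k.+1) (c (- j%:Z) * (- z) ^- j) *
    \sum_(0 <= l < j) cexp (z * t%:C) * ((- t%:C * z) ^+ l / l`!%:R).

Lemma principal_part0 : z != 0 -> exp_principal_part z c k t 0 = - pole_term.
Proof.
move=> z0; have nz0 : - z != 0 by rewrite oppr_eq0.
congr (- _); apply: eq_bigr => j _; rewrite -mulrA; congr (_ * _).
rewrite mulr_sumr; apply: eq_big_nat => l /andP[_ lj].
rewrite sub0r [RHS]mulrCA -[LHS]mulrA; congr (_ * _).
have -> : - t%:C * z = t%:C * - z by rewrite mulrN mulNr.
rewrite exprMn -[in (- z) ^- j](subnK (ltnW lj)) exprD.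
have A0 : (- z) ^+ (j - l) != 0 by rewrite expf_neq0.
have B0 : (- z) ^+ l != 0 by rewrite expf_neq0.
have F0 : l`!%:R != 0 :> R[i] by rewrite pnatr_eq0 -lt0n fact_gt0.
move: A0 B0 F0; move: (_ ^+ (j - l)) ((- z) ^+ l) (l`!%:R) (t%:C ^+ l) => A B F' C A0 B0 F0.
by field; rewrite A0 B0 F0.
Qed.

End OnePole.
End PrincipalParts.

Lemma cvg_expRNM {R : realType} (a : R) : 0 < a ->
  (fun x : R => expR (- (x * a))) @ +oo --> (0 : R).
Proof.
move=> a0; have h : (fun y : R => y * a) @ +oo --> +oo by apply: gt0_cvgMly.
exact: (cvg_comp _ _ h (@cvgr_expR R)).
Qed.

Section VerticalLimit.
Context {d : measure_display} {T : measurableType d} {R : realType}.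
Variables (P : probability T R) (Z : T -> R).
Hypotheses (mZ : measurable_fun setT Z) (Z0 : forall x, 0 <= Z x).

Let P1 : P setT = 1%E := probability_setT P.
Let A := [set x | Z x = 0].
Let p0 : R := fine (P A).

Let mA : measurable A.
Proof.
rewrite (_ : A = Z @^-1` [set 0]) //.
by rewrite -[X in measurable X]setTI; apply: mZ.
Qed.

Let iA : rintble P (\1_A : T -> R).
Proof.
apply: (@rintble_bounded _ _ _ _ P1 _ 1); first exact: measurable_indic.
by move=> x; rewrite indicE; case: (_ \in _); rewrite ?normr1 ?normr0.
Qed.

Let p0E : \int[P]_x \1_A x = p0.
Proof. by rewrite /Rintegral integral_indic // setIT. Qed.

Let q (x : R) := \int[P]_w (expR (x * Z w) - \1_A w).

Let i_exp (x : R) : x <= 0 -> rintble P (fun w => expR (x * Z w)).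
Proof. by move=> x0; exact: rintble_exp_npos. Qed.

(** Far to the left only the atom of [Z] at [0] contributes to its transform; the
    bound depends on the real part of [w] only. *)
Lemma expint_atom_dist (w : R[i]) : complex.Re w <= 0 ->
  cmod (expint P Z w - p0%:C) <= q (complex.Re w).
Proof.
move=> w0.
have i1 : cintble P (fun x => cexp (w * (Z x)%:C)) by apply: cintble_cexp => //; exact: i_exp.
have i2 : cintble P (fun x => (\1_A x)%:C).
  by split=> //; rewrite (_ : (fun x => _) = fun=> 0) //; exact: rintble_cst.
have -> : p0%:C = cint P (fun x => (\1_A x)%:C).
  by apply: complex_eq; rewrite /cint /= ?p0E // rint_cst.
rewrite -cintB //; apply: cmod_cint_le; first exact: cintbleB.
  by apply: rintbleB => //; exact: i_exp.
move=> x; rewrite indicE; case: (boolP (x \in A)) => [|xA].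
  by rewrite inE /A /= => ->; rewrite !mulr0 cexp0 expR0 !subrr cmod0.
by rewrite !subr0 cmod_cexpM.
Qed.

Lemma expint_atom_limit (x : nat -> R) : (forall n, 0 <= x n) -> x @ \oo --> +oo ->
  q (- x n) @[n --> \oo] --> 0.
Proof.
move=> x0 xoo.
have := @dominated_convergence _ _ _ P setT measurableT
  (fun n w => (expR (- x n * Z w) - \1_A w)%:E) (fun=> 0%E) (fun=> 1%E).
case.
- move=> n; apply/measurable_EFinP; apply: measurable_funB; last exact: measurable_indic.
  by apply: measurable_expR_comp; exact: measurable_funM.
- exact: measurable_cst.
- apply: aeW => w _; apply: cvg_EFin; first exact: nearW.
  rewrite /comp /= indicE; case: (boolP (w \in A)) => [|wA].
    rewrite inE /A /= => Zw.
    by under eq_fun do rewrite Zw mulr0 expR0 subrr; exact: cvg_cst.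
  have Zw : 0 < Z w.
    by rewrite lt0r Z0 andbT; apply: contra wA => /eqP Zw; rewrite inE.
  under eq_fun do rewrite subr0.
  under eq_fun do rewrite mulNr.
  exact: (cvg_comp _ _ xoo (cvg_expRNM Zw)).
- exact: (rintble_cst P1 1).
- apply: aeW => w n _; rewrite /= lee_fin indicE.
  have e1 : expR (- x n * Z w) <= 1 by rewrite expR_le1 mulr_le0_ge0 // oppr_le0.
  have e0 := expR_ge0 (x n * Z w).
  case: (boolP (w \in A)) => [|wA]; last by rewrite subr0 ger0_norm.
  by rewrite inE /A /= => ->; rewrite mulr0 expR0 subrr normr0.
by move=> _ _; rewrite integral0 => h; exact: (fine_cvg h).
Qed.

End VerticalLimit.

Section Tails.
Context {d : measure_display} {T : measurableType d} {R : realType}.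
Variables (P : probability T R) (V : {RV P >-> R}) (t : R).

Lemma measurable_exceeds : measurable [set w | t < V w].
Proof.
have mV : measurable_fun setT V by [].
rewrite (_ : [set w | _] = V @^-1` `]t, +oo[).
  by rewrite -[X in measurable X]setTI; apply: mV.
by apply/seteqP; split => w /=; rewrite in_itv /= andbT.
Qed.

Lemma measurable_reaches : measurable [set w | t <= V w].
Proof.
have mV : measurable_fun setT V by [].
rewrite (_ : [set w | _] = V @^-1` `[t, +oo[).
  by rewrite -[X in measurable X]setTI; apply: mV.
by apply/seteqP; split => w /=; rewrite in_itv /= andbT.
Qed.

End Tails.

Section Contour.
Context {d : measure_display} {T : measurableType d} {R : realType}.
Variables (P : probability T R) (V : {RV P >-> R}).
Hypothesis V_ge0 : {ae P, forall w, 0 <= V w}.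
Variables (F H : R[i] -> R[i]) (delta e0 : R).
Hypotheses (delta_gt0 : 0 < delta) (e0_gt0 : 0 < e0).
Hypothesis iV : rintble P (fun w => expR (delta * V w)).
Hypothesis F_der : forall w, complex.Re w < e0 -> cderivable F w.
Hypothesis H_der : forall w, complex.Re w < e0 -> cderivable H w.
Hypothesis H_bound : forall w, complex.Re w <= 0 -> cmod (H w) <= 2.
Hypothesis V_der : forall w, - delta < complex.Re w -> cderivable (laplace V) w.
Hypothesis V_eq : forall w, - delta < complex.Re w < e0 -> laplace V w * F w = - H w.
Variable t : R.
Hypothesis t_gt0 : 0 < t.

Let P1 : P setT = 1%E := probability_setT P.
Let mV : measurable_fun setT V. Proof. by []. Qed.

(** [laplace V] continued to the left by the Wiener-Hopf equation.  The overlap of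
    the two regions makes it derivable wherever [F] does not vanish. *)
Definition transform (w : R[i]) : R[i] :=
  if - delta < complex.Re w then laplace V w else - H w / F w.

Lemma transformE w : F w != 0 -> complex.Re w < e0 -> transform w = - H w / F w.
Proof.
move=> Fw we; rewrite /transform; case: ifPn => // wd.
by rewrite -V_eq ?wd // mulfK.
Qed.

Lemma cderivable_transform w : complex.Re w < e0 -> - delta < complex.Re w \/ F w != 0 ->
  cderivable transform w.
Proof.
move=> we; have [wd _|wd [|Fw]] := boolP (- delta < complex.Re w).
- apply: cderivable_local (V_der wd); exists (complex.Re w + delta); first by lra.
  move=> w' Hw'; rewrite /transform ifT //.
  by have := Re_near w' w; rewrite cmodB; lra.
- by move: wd => /negP.
- have [r r0 Hr] := cderivable_neq0_near (F_der we) Fw.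
  apply: (@cderivable_local _ (fun w => - H w / F w)).
    exists (Num.min r (e0 - complex.Re w)); first by rewrite lt_min r0 subr_gt0.
    move=> w'; rewrite lt_min => /andP[w1 w2]; rewrite transformE //.
      exact: Hr.
    by have := Re_near w w'; lra.
  apply: cderivableM; first by apply: cderivableN; exact: H_der.
  by apply: cderivableV => //; exact: F_der.
Qed.

Let Vp w := ppart (V w).
Let Zr w := ppart (Vp w - t).
Let Zl w := ppart (t - Vp w).
Let mVp : measurable_fun setT Vp. Proof. exact: measurable_ppart. Qed.
Let mZr : measurable_fun setT Zr.
Proof. by apply: measurable_ppart; apply: measurable_funB. Qed.
Let mZl : measurable_fun setT Zl.
Proof. by apply: measurable_ppart; apply: measurable_funB. Qed.
Let Zr0 w : 0 <= Zr w. Proof. exact: ppart_ge0. Qed.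
Let Zl0 w : 0 <= Zl w. Proof. exact: ppart_ge0. Qed.
Let Zlt w : Zl w <= t.
Proof. by rewrite /Zl /ppart ge_max (ltW t_gt0) gerBl ppart_ge0. Qed.

Let V_Vp : {ae P, forall w, V w = Vp w} := ae_ppart V_ge0.

Let iVp (a : R) : a <= delta -> rintble P (fun w => expR (a * Vp w)).
Proof.
move=> ad; apply: (rintble_exp_ae mV mVp V_Vp).
exact: (cderivable_laplace_below V_ge0 iV).1.
Qed.

Let iZl (a : R) : rintble P (fun w => expR (a * Zl w)).
Proof.
apply: (@rintble_bounded _ _ _ _ P1 _ (expR (`|a| * t))).
  by apply: measurable_expR_comp; exact: measurable_funM.
move=> w; rewrite ger0_norm ?expR_ge0 // ler_expR.
apply: le_trans (ler_norm _) _; rewrite normrM ler_wpM2l //.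
by rewrite ger0_norm.
Qed.

(** The first summand is entire and bounded on the left half-plane; it is chosen
    so as to make the difference bounded on the right half-plane as well. *)
Definition contour (w : R[i]) : R[i] := expint P Zl w - cexp (w * t%:C) * transform w.

(** This is [cexp_ppart] for [V - t], whose transform is [exp (w t)] times that of
    [V]. *)
Lemma contour_right w : - delta < complex.Re w -> contour w = 1 - expint P Zr (- w).
Proof.
move=> wd; rewrite /contour /transform wd.
have i1 : cintble P (fun x => cexp (w * (Zl x)%:C)) by apply: cintble_cexp.
have i2 : cintble P (fun x => cexp (- w * (Vp x)%:C)).
  by apply: cintble_cexp => //; apply: iVp; rewrite ReN lerNl ltW.
have i3 := cintbleZ (cexp (w * t%:C)) i2.
have -> : laplace V w = expint P Vp (- w) by apply: (expint_ae (- w) mV mVp V_Vp).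
have E : (fun x => cexp (- w * (Zr x)%:C)) = (fun x =>
    cexp (w * t%:C) * cexp (- w * (Vp x)%:C) + 1 - cexp (w * (Zl x)%:C)).
  apply/funext => x; rewrite cexp_ppart opprB -/(Zl x) -cexpD; congr (cexp _ + _ - _).
  by rewrite rmorphB; ring.
rewrite /expint E cintB //; last exact: cintbleD (cintble_cst P1 1).
by rewrite cintD ?cintZ ?cint_cst //; [ring | exact: cintble_cst].
Qed.

Lemma contour0 : contour 0 = 0.
Proof.
rewrite contour_right ?oppr_lt0 // /expint oppr0.
rewrite (_ : (fun x => _) = fun=> 1); last by apply/funext => x; rewrite mul0r cexp0.
by rewrite cint_cst // subrr.
Qed.

Lemma contour_bound_right w : 0 <= complex.Re w -> cmod (contour w) <= 2.
Proof.
move=> w0; rewrite contour_right; last by rewrite (lt_le_trans _ w0) // oppr_lt0.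
apply: le_trans (cmodD _ _) _; rewrite cmod1 cmodN.
have w0' : complex.Re (- w) <= 0 by rewrite ReN oppr_le0.
by have := cmod_expint_le1 P1 mZr Zr0 w0'; lra.
Qed.

Lemma contour_left_part w (eps : R) : 0 < eps -> complex.Re w < 0 -> eps < cmod (F w) ->
  cmod (cexp (w * t%:C) * transform w) <= expR (complex.Re w * t) * (2 / eps).
Proof.
move=> eps0 w0 Fw; rewrite cmodM cmod_cexpM ler_wpM2l ?expR_ge0 //.
have Fw0 : F w != 0 by rewrite -cmod_gt0 (lt_trans eps0).
rewrite transformE //; last exact: lt_trans w0 e0_gt0.
rewrite cmodM cmodN cmodV ler_pM ?cmod_ge0 ?invr_ge0 ?cmod_ge0 ?H_bound ?(ltW w0) //.
by rewrite lef_pV2 ?posrE ?cmod_gt0 // ltW.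
Qed.

Lemma contour_bound_left w (eps : R) : 0 < eps -> complex.Re w < 0 -> eps < cmod (F w) ->
  cmod (contour w) <= 1 + 2 / eps.
Proof.
move=> eps0 w0 Fw; apply: le_trans (cmodD _ _) _; rewrite cmodN lerD //.
  by apply: cmod_expint_le1 => //; exact: ltW.
apply: le_trans (contour_left_part eps0 w0 Fw) _.
by rewrite ler_piMl ?divr_ge0 ?(ltW eps0) // expR_le1 mulr_le0_ge0 ?(ltW w0) ?(ltW t_gt0).
Qed.

Lemma cderivable_contour w : complex.Re w < e0 \/ - delta < complex.Re w ->
  - delta < complex.Re w \/ F w != 0 -> cderivable contour w.
Proof.
move=> we wF; have [wd|wd] := boolP (- delta < complex.Re w).
  have dr : cderivable (fun w => 1 - expint P Zr (- w)) w.
    apply: cderivableB; first exact: cderivable_cst.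
    apply: (@cderivable_comp _ (fun w => - w)).
      by apply: cderivableN; exact: cderivable_id.
    have iZr : rintble P (fun x => expR (delta * Zr x)).
      apply: (rintble_le _ _ (iVp (lexx delta))).
        by apply: measurable_expR_comp; exact: measurable_funM.
      move=> x; rewrite ger0_norm ?expR_ge0 // ler_expR ler_wpM2l ?(ltW delta_gt0) //.
      by rewrite /Zr {1}/ppart ge_max ppart_ge0 andbT gerBl ltW.
    by apply: (cderivable_expint mZr Zr0 iZr); rewrite ReN ltrNl.
  apply: cderivable_local dr; exists (complex.Re w + delta); first by lra.
  move=> w' Hw'; rewrite contour_right //.
  by have := Re_near w' w; rewrite cmodB; lra.
have {}we : complex.Re w < e0 by case: we => // h; rewrite h in wd.
apply: cderivableB.
  have [c wc] : exists c, complex.Re w < c by exists (complex.Re w + 1); rewrite ltrDl.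
  exact: (cderivable_expint mZl Zl0 (iZl c)).
apply: cderivableM; last exact: cderivable_transform.
apply: (@cderivable_comp _ (fun w => w * t%:C) cexp); last exact: cderivable_cexp.
by apply: cderivableM; [exact: cderivable_id | exact: cderivable_cst].
Qed.

(** Near [z] the continued transform is [psi], and the other summand of [contour]
    is derivable. *)
Lemma removable_contour (psi g : R[i] -> R[i]) (z : R[i]) (c : int -> R[i]) (k : nat) :
  complex.Re z < 0 -> laurent_expansion psi z c ->
  cderivable g z -> g z != 0 ->
  (exists2 r : R, 0 < r & forall w, cmod (w - z) < r -> F w = (w - z) ^+ k * g w) ->
  equation_near F H psi z ->
  removable (fun w => contour w - exp_principal_part z c k t w) z.
Proof.
move=> z0 lz dg gz [r1 r10 HF] [r2 r20 Heq].
have f_eq : exists2 r : R, 0 < r & forall w, w != z -> cmod (w - z) < r ->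
    psi w * F w = - H w /\ cmod (H w) <= 2.
  exists (Num.min r2 (- complex.Re z)); first by rewrite lt_min r20 oppr_gt0.
  move=> w wz; rewrite lt_min => /andP[w1 w2]; split; first exact: Heq.
  by apply: H_bound; have := Re_near z w; lra.
have HF' : exists2 r : R, 0 < r & forall w, cmod (w - z) < r -> F w = (w - z) ^+ k * g w.
  by exists r1.
have R1 := removable_exp_principal_part lz dg gz HF' f_eq t.
have R2 : removable (expint P Zl) z.
  have [c' zc] : exists c, complex.Re z < c by exists (complex.Re z + 1); rewrite ltrDl.
  by apply: removable_cderivable; exact: (cderivable_expint mZl Zl0 (iZl c')).
apply: removable_local (removableD R2 R1).
have [r3 r30 Hg] := cderivable_neq0_near dg gz.
exists (Num.min (Num.min r1 r2) (Num.min r3 (- complex.Re z))).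
  by rewrite !lt_min r10 r20 r30 oppr_gt0.
move=> w wz; rewrite !lt_min => /andP[/andP[w1 w2] /andP[w3 w4]].
rewrite /contour [RHS]addrAC -[RHS]addrA; congr (_ + _).
rewrite [RHS]addrC; congr (- (_ * _) + _).
have gw : g w != 0 by exact: Hg.
have Fw : F w != 0 by rewrite HF // mulf_neq0 // expf_neq0 // subr_eq0.
have e00 := e0_gt0; rewrite transformE //; last by have := Re_near z w; lra.
by rewrite -Heq // mulfK.
Qed.

Section Poles.
Variables (psi : R[i] -> R[i]) (z : int -> R[i]) (k : int -> nat) (L : int -> int -> R[i]).
Hypothesis psi_eq : forall p, complex.Re p < 0 -> equation_near F H psi p.
Hypothesis z_left : forall n, complex.Re (z n) < 0.
Hypothesis z_inj : injective z.
Hypothesis z_all : forall w, complex.Re w < 0 -> F w = 0 -> exists n, z n = w.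
Hypothesis z_order : forall n, zero_order F (z n) (k n).
Hypothesis psi_laurent : forall n, laurent_expansion psi (z n) (L n).

Let pole n := pole_term (z n) (L n) (k n) t.
Let part n := exp_principal_part (z n) (L n) (k n) t.

(** Residue theorem for the poles inside a circle of radius [r]: subtracting the
    principal parts, whose means vanish, leaves a function to which the mean
    value property applies.  Its value at [0] is minus the sum of the values of
    the principal parts, since [contour] vanishes there. *)
Lemma circle_mean_contour (b : R[i]) (r : R) (I : seq int) : 0 < r -> uniq I ->
  (forall n, n \in I = (cmod (z n) < r)) ->
  (forall w, complex.Re w < 0 -> cmod w = r -> F w != 0) ->
  cont_on 0 (2 * pi) (fun y => complex.Re (b * contour (circ r y))) /\
  segint 0 (2 * pi) (fun y => complex.Re (b * contour (circ r y))) =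
    2 * pi * complex.Re (b * \sum_(n <- I) pole n).
Proof.
move=> r0 uI HI Fr.
have cyr y : cmod (circ r y) = r by rewrite cmod_circ // ltW.
have dJ w : cmod w <= r -> (forall n, n \in I -> w != z n) -> cderivable contour w.
  move=> wr wI; have [w0|w0] := ltP (complex.Re w) 0; last first.
    have wd : - delta < complex.Re w by rewrite (lt_le_trans _ w0) // oppr_lt0.
    by apply: cderivable_contour; [right | left].
  apply: cderivable_contour; first by left; exact: lt_trans w0 e0_gt0.
  right; apply/eqP => Fw; have [n zn] := z_all w0 Fw.
  move: wr; rewrite le_eqVlt => /orP[/eqP wr|wr].
    by have := Fr w w0 wr; rewrite Fw eqxx.
  by have := wI n; rewrite HI zn wr eqxx => /(_ isT).
have dP n w : w != z n -> cderivable (part n) w by exact: cderivable_principal_part.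
pose f w := contour w - \sum_(n <- I) part n w.
have circ_out y n : n \in I -> circ r y != z n.
  by rewrite HI => zr; apply: contraTneq zr => <-; rewrite cyr ltxx.
have Cc : cont_on 0 (2 * pi) (fun y => complex.Re (b * contour (circ r y))).
  apply: (cont_on_circ (f := fun w => b * contour w) r0 _).1 => y _.
  apply: cderivableM; first exact: cderivable_cst.
  by apply: dJ; [rewrite cyr | move=> n; exact: circ_out].
split=> //.
have mv : segint 0 (2 * pi) (fun y => complex.Re (b * f (circ r y))) =
    2 * pi * complex.Re (b * f 0).
  apply: (@mean_value_removable _ [seq z n | n <- I] f r b r0).
  - move=> w wr /negP wI; have wI' n : n \in I -> w != z n.
      by move=> nI; apply/eqP => wz; apply: wI; rewrite wz map_f.
    apply: cderivableB; first exact: dJ.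
    rewrite (_ : (fun w0 => _) = (fun w0 => \sum_(n <- I | n \in I) part n w0)); last first.
      by apply/funext => w0; rewrite big_seq.
    by apply: cderivable_sum => n nI; apply: dP; exact: wI'.
  - move=> _ /mapP[n nI ->]; split.
      by apply: contraTneq (z_left n) => ->; rewrite ltxx.
    by move: nI; rewrite HI => /lt_eqF ->.
  - move=> _ /mapP[n nI ->].
    have [g [/near_cmodP [dg dg0 Hg] gz /near_cmodP Fg]] := z_order n.
    have dgz : cderivable g (z n) by apply: Hg; rewrite subrr cmod0.
    have R1 := removable_contour (z_left n) (psi_laurent n) dgz gz Fg (psi_eq (z_left n)).
    have R2 : removable (fun w => - \sum_(n' <- I | n' != n) part n' w) (z n).
      apply: removable_cderivable; apply: cderivableN; apply: cderivable_sum => n' n'n.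
      by apply: dP; rewrite (inj_eq z_inj) eq_sym.
    apply: removable_local (removableD R1 R2); exists 1 => // w _ _.
    by rewrite /f (bigD1_seq n) //= opprD addrA.
have parts y : complex.Re (b * f (circ r y)) = complex.Re (b * contour (circ r y)) -
    \sum_(n <- I) (if cmod (z n) < r then complex.Re (b * part n (circ r y)) else 0).
  rewrite /f mulrBr ReD ReN mulr_sumr Re_sum; congr (_ - _).
  by rewrite !big_seq; apply: eq_bigr => n; rewrite HI => ->.
have [Cs Is] : cont_on 0 (2 * pi) (fun y => \sum_(n <- I)
     (if cmod (z n) < r then complex.Re (b * part n (circ r y)) else 0)) /\
   segint 0 (2 * pi) (fun y => \sum_(n <- I)
     (if cmod (z n) < r then complex.Re (b * part n (circ r y)) else 0)) = 0.
  apply: segint_sum_eq0 => [|n]; first exact: two_pi_ge0.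
  case zr: (cmod (z n) < r); first exact: circle_mean_principal_part.
  by split; [exact: cont_on_cst | rewrite segint_cst ?mul0r // two_pi_ge0].
rewrite (eq_segint (g := fun y => complex.Re (b * contour (circ r y)) - \sum_(n <- I)
     (if cmod (z n) < r then complex.Re (b * part n (circ r y)) else 0))) in mv; last first.
  by move=> y _; exact: parts.
rewrite segintB // Is subr0 in mv; rewrite mv /f contour0 sub0r -sumrN.
congr (_ * complex.Re (_ * _)); apply: eq_bigr => n _.
rewrite /part principal_part0 ?opprK //.
by apply: contraTneq (z_left n) => ->; rewrite ltxx.
Qed.

Section LargeCircles.
Variables (r : nat -> R) (eps : R).
Hypotheses (r_gt0 : forall n, 0 < r n) (eps_gt0 : 0 < eps) (r_oo : r @ \oo --> +oo).
Hypothesis F_circle : forall n w, complex.Re w < 0 -> cmod w = r n -> eps < cmod (F w).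

Let p1 : R := fine (P [set w | t < V w]).
Let p2 : R := fine (P [set w | t <= V w]).

Let mset_lt := measurable_exceeds V t.
Let mset_le := measurable_reaches V t.

Let p12 : p1 <= p2.
Proof.
rewrite /p1 /p2 fine_le ?fin_num_measure //.
by apply: le_measure; rewrite ?inE // => w /=; exact: ltW.
Qed.

Let atom_r : fine (P [set w | Zr w = 0]) = 1 - p1.
Proof.
have -> : [set w | Zr w = 0] = ~` [set w | t < V w].
  apply/seteqP; split => w /=.
    move=> Z0 tV; move: Z0; rewrite /Zr /Vp ppart_id; last first.
      by rewrite subr_ge0 ppart_id ltW // (lt_trans t_gt0).
    rewrite ppart_id ?(ltW (lt_trans t_gt0 tV)) // => /eqP.
    by rewrite subr_eq0 => /eqP E; rewrite E ltxx in tV.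
  move=> /negP; rewrite -leNgt => Vt; rewrite /Zr ppart_eq0 // subr_le0.
  by rewrite /Vp /ppart ge_max Vt ltW.
rewrite probability_setC // fineB ?fin_num_measure //.
Qed.

Let atom_l : fine (P [set w | Zl w = 0]) = p2.
Proof.
congr (fine (P _)); apply/seteqP; split => w /=.
  move=> Z0; rewrite leNgt; apply/negP => Vt; move: Z0; rewrite /Zl.
  have Vpt : Vp w < t by rewrite /Vp /ppart gt_max Vt.
  rewrite ppart_id ?subr_ge0 ?(ltW Vpt) // => /eqP; rewrite subr_eq0 => /eqP E.
  by rewrite -E ltxx in Vpt.
by move=> tV; rewrite /Zl ppart_eq0 // subr_le0 /Vp ppart_id // (le_trans (ltW t_gt0)).
Qed.

Let squeeze (b : R[i]) (u : nat -> R[i]) (p : R) (v : nat -> R) :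
  (forall n, cmod (u n - p%:C) <= v n) -> v @ \oo --> (0 : R) ->
  complex.Re (b * u n) @[n --> \oo] --> (complex.Re b * p : R).
Proof.
move=> uv v0; apply/cvgrPdist_le => e e_gt0.
have K0 : 0 < cmod b + 1 by rewrite ltr_wpDl // cmod_ge0.
have /cvgrPdist_lt /(_ _ (divr_gt0 e_gt0 K0)) := v0.
apply: filterS => n; rewrite sub0r normrN => vn.
have -> : complex.Re b * p - complex.Re (b * u n) = - complex.Re (b * (u n - p%:C)).
  by rewrite mulrBr ReD ReN [in RHS]ReM [complex.Re (b * p%:C)]ReM ReC ImC ReM; ring.
rewrite normrN; apply: le_trans (abs_Re_le_cmod _) _; rewrite cmodM.
have vn' : v n <= e / (cmod b + 1) by rewrite (le_trans (ler_norm _)) // ltW.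
apply: (@le_trans _ _ ((cmod b + 1) * (e / (cmod b + 1)))).
  by rewrite ler_pM ?cmod_ge0 ?lerDl // (le_trans (uv n)).
by rewrite mulrC divfK // gt_eqF.
Qed.

Let Re_circ n y : complex.Re (circ (r n) y) = r n * cos y. Proof. by []. Qed.

Let r_cos_oo (a : R) : 0 < a -> (fun n => r n * a) @ \oo --> +oo.
Proof.
move=> a0; have h : (fun y : R => y * a) @ +oo --> +oo by apply: gt0_cvgMly.
exact: (cvg_comp _ _ r_oo h).
Qed.

(** In these directions [contour] is [1 - E exp (- w (V - t)^+)], and only the event
    [V <= t] contributes to the limit. *)
Lemma contour_cvg_right (b : R[i]) y : 0 < cos y ->
  complex.Re (b * contour (circ (r n) y)) @[n --> \oo] --> (complex.Re b * p1 : R).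
Proof.
move=> y0; pose x n := r n * cos y.
have x0 n : 0 <= x n by rewrite mulr_ge0 // ltW.
have h0 := expint_atom_limit P mZr Zr0 x0 (r_cos_oo y0).
apply: (@squeeze b (fun n => contour (circ (r n) y)) p1 _ _ h0) => n.
have wd : - delta < complex.Re (circ (r n) y).
  by rewrite Re_circ (lt_le_trans _ (x0 n)) // oppr_lt0.
rewrite contour_right // cmodB.
have -> : p1%:C - (1 - expint P Zr (- circ (r n) y)) =
   expint P Zr (- circ (r n) y) - (fine (P [set w | Zr w = 0]))%:C.
  by rewrite atom_r rmorphB; ring.
have w0 : complex.Re (- circ (r n) y) <= 0 by rewrite ReN oppr_le0 Re_circ; exact: x0.
have := expint_atom_dist P mZr Zr0 w0; rewrite ReN Re_circ; exact.
Qed.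

(** In these directions the factor [exp (w t)] suppresses the transform, and only the
    event [V >= t] contributes to the limit of [E exp (w (t - V)^+)]. *)
Lemma contour_cvg_left (b : R[i]) y : cos y < 0 ->
  complex.Re (b * contour (circ (r n) y)) @[n --> \oo] --> (complex.Re b * p2 : R).
Proof.
move=> y0; pose x n := r n * (- cos y).
have ny0 : 0 < - cos y by rewrite oppr_gt0.
have x0 n : 0 <= x n by rewrite mulr_ge0 // ltW.
have xE n : complex.Re (circ (r n) y) = - x n by rewrite Re_circ /x mulrN opprK.
have h1 := expint_atom_limit P mZl Zl0 x0 (r_cos_oo ny0).
have h2 : (fun n => expR (- (x n * t)) * (2 / eps)) @ \oo --> (0 * (2 / eps) : R).
  apply: cvgM; last exact: cvg_cst.
  exact: (cvg_comp _ _ (r_cos_oo ny0) (cvg_expRNM t_gt0)).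
rewrite mul0r in h2.
have h3 : (fun n => \int[P]_w (expR (- x n * Zl w) - \1_[set x | Zl x = 0] w) +
    expR (- (x n * t)) * (2 / eps)) @ \oo --> (0 : R).
  by rewrite -[X in _ --> X]addr0; exact: cvgD h1 h2.
apply: (@squeeze b (fun n => contour (circ (r n) y)) p2 _ _ h3) => n; rewrite /contour.
have w0 : complex.Re (circ (r n) y) < 0 by rewrite Re_circ pmulr_rlt0.
set A := expint _ _ _; set B := cexp _ * _.
have -> : A - B - p2%:C = (A - p2%:C) - B by ring.
apply: le_trans (cmodD _ _) _; rewrite cmodN lerD //.
  by rewrite -atom_l -xE; apply: expint_atom_dist => //; exact: ltW.
have := contour_left_part eps_gt0 w0 (F_circle w0 (cmod_circ y (ltW (r_gt0 n)))).
by rewrite xE mulNr.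
Qed.

Lemma cos_zeros_null : (@lebesgue_measure R).-negligible
  [set y | 0 <= y <= 2 * pi /\ cos y = 0].
Proof.
have : (@lebesgue_measure R).-negligible ([set pi / 2] `|` [set 2 * pi - pi / 2]).
  apply: negligibleU; apply/negligibleP => //; exact: lebesgue_measure_set1.
apply: negligibleS => y /= [/andP[y0 y1] cy].
have half x : 0 <= x <= pi -> cos x = 0 -> x = pi / 2 :> R.
  move=> xI cx; apply: cos_inj; rewrite ?in_itv //=.
    by rewrite divr_ge0 ?pi_ge0 //= ler_pdivrMr // ler_peMr ?pi_ge0 // ler1n.
  by rewrite cx cos_pihalf.
have [yp|py] := leP y pi; first by left; apply: half; rewrite ?y0.
right; have := half (2 * pi - y); rewrite subr_ge0 y1 /= => h.
have -> : y = 2 * pi - (2 * pi - y) by ring.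
rewrite h //; first by lra.
by rewrite addrC -cosN opprD opprK [2 * pi]mulr_natl -cosD2pi -addrA addNr addr0.
Qed.

Let ell (y : R) : R := if 0 < cos y then p1 else p2.

Let m_ell : measurable_fun setT ell.
Proof.
apply: measurable_fun_ifT; [|exact: measurable_cst|exact: measurable_cst].
  by apply: measurable_fun_ltr => //; apply: continuous_measurable_fun; exact: continuous_cos.
Qed.

Let ell_cst (b : R) : (@lebesgue_measure R).-integrable `[0, 2 * pi] (EFin \o (fun=> b)).
Proof. by have := @cont_on_integrable R 0 (2 * pi) (fun=> b) (@cont_on_cst R 0 (2 * pi) b). Qed.

Let ell_bound y : p1 <= ell y <= p2.
Proof. by rewrite /ell; case: ifP => _; rewrite ?lexx p12. Qed.

Let p1_ge0 : 0 <= p1. Proof. by rewrite fine_ge0. Qed.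

Let i_ell : (@lebesgue_measure R).-integrable `[0, 2 * pi] (EFin \o ell).
Proof.
apply: le_integrable (ell_cst p2) => //.
  by apply/measurable_EFinP; apply: measurable_funS m_ell.
move=> y _ /=; have /andP[l1 l2] := ell_bound y.
by rewrite lee_fin !ger0_norm // (le_trans p1_ge0) // (le_trans l1).
Qed.

Let ell_mean : p1 <= segint 0 (2 * pi) ell / (2 * pi) <= p2.
Proof.
have pi2 : 0 < 2 * pi :> R by rewrite mulr_gt0 // pi_gt0.
rewrite ler_pdivlMr // ler_pdivrMr //.
have E b : segint 0 (2 * pi) (fun=> b) = b * (2 * pi) :> R.
  by rewrite segint_cst ?subr0 // ltW.
rewrite -!E; apply/andP; split; (apply: le_Rintegral => //; last by move=> y _; have /andP[] := ell_bound y).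
Qed.

Let contour_bound n (y : R) : cmod (contour (circ (r n) y)) <= 2 + 2 / eps.
Proof.
have eps_ge0 : 0 <= 2 / eps by rewrite divr_ge0 // ltW.
have [w0|w0] := ltP (complex.Re (circ (r n) y)) 0.
  apply: le_trans (contour_bound_left eps_gt0 w0 _) _.
    by apply: (@F_circle n) => //; rewrite cmod_circ // ltW.
  by rewrite lerD2r ler1n.
by apply: le_trans (contour_bound_right w0) _; rewrite lerDl.
Qed.

(** Dominated convergence on the circle; the two imaginary directions form a null
    set. *)
Lemma circle_limit (b : R[i]) :
  (forall n, cont_on 0 (2 * pi) (fun y => complex.Re (b * contour (circ (r n) y)))) ->
  segint 0 (2 * pi) (fun y => complex.Re (b * contour (circ (r n) y))) @[n --> \oo] -->
    complex.Re b * segint 0 (2 * pi) ell.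
Proof.
move=> Cc; pose K := cmod b * (2 + 2 / eps).
have KE n (y : R) : (`|(complex.Re (b * contour (circ (r n) y)))%:E| <= K%:E)%E.
  rewrite /= lee_fin; apply: le_trans (abs_Re_le_cmod _) _.
  by rewrite cmodM ler_wpM2l ?cmod_ge0.
have := @dominated_convergence _ _ _ (@lebesgue_measure R) `[0, 2 * pi]%classic
  (measurable_itv _) (fun n y => (complex.Re (b * contour (circ (r n) y)))%:E)
  (fun y => (complex.Re b * ell y)%:E) (fun=> K%:E).
case.
- by move=> n; have /integrableP[] := cont_on_integrable (Cc n).
- apply/measurable_EFinP; apply: measurable_funM; first exact: measurable_cst.
  exact: measurable_funS m_ell.
- case: cos_zeros_null => N [mN N0 sN]; exists N; split => // y /= Hy; apply: sN.
  apply: contrapT => Hc; apply: Hy; rewrite in_itv /= => yI.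
  apply: cvg_EFin; first exact: nearW.
  rewrite /comp /ell; have [y0|y0|y0] := ltrgtP 0 (cos y).
  + exact: contour_cvg_right.
  + exact: contour_cvg_left.
  + by exfalso; apply: Hc; split.
- exact: ell_cst.
- by apply: aeW => y n _; exact: (KE n y).
move=> i1 _ h; rewrite -RintegralZl //.
by apply: fine_cvg; move: h; rewrite fineK //; exact: integrable_fin_num.
Qed.

(** By [circle_mean_contour] the sum over the poles in a disc is the mean of
    [contour] on its boundary, whose limit is a mean of [P (V > t)] and
    [P (V >= t)].  An atom of [V] at [t] may separate the two. *)
Lemma contour_limit (I : nat -> seq int) :
  (forall m, uniq (I m)) -> (forall m n, n \in I m = (cmod (z n) < r m)) ->
  exists2 S : R, p1 <= S <= p2 & forall e : R, 0 < e -> exists M : nat, forall m, (M <= m)%N ->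
    cmod (\sum_(n <- I m) pole_term (z n) (L n) (k n) t - S%:C) < e.
Proof.
move=> uI HI; pose s m := \sum_(n <- I m) pole n.
pose S := segint 0 (2 * pi) ell / (2 * pi); exists S; first exact: ell_mean.
have pi2 : 2 * pi != 0 :> R by rewrite mulf_neq0 ?pnatr_eq0 // gt_eqF // pi_gt0.
have Fr m w : complex.Re w < 0 -> cmod w = r m -> F w != 0.
  by move=> w0 wr; rewrite -cmod_gt0 (lt_trans eps_gt0) // (F_circle w0 wr).
have lim b : complex.Re (b * s m) @[m --> \oo] --> complex.Re b * S.
  have C m := circle_mean_contour b (r_gt0 m) (uI m) (HI m) (Fr m).
  have h := circle_limit (fun m => (C m).1).
  rewrite /S mulrA.
  rewrite (_ : (fun m => _) = fun m =>
      segint 0 (2 * pi) (fun y => complex.Re (b * contour (circ (r m) y))) * (2 * pi)^-1).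
    exact: (cvgM h (cvg_cst (2 * pi)^-1)).
  by apply/funext => m; rewrite (C m).2 mulrAC divff // mul1r.
(* The choices [1] and [- 'i] of [b] yield the real and the imaginary part. *)
have h1 := lim 1; have h2 := lim (- 'i).
have Es m : s m - S%:C = (complex.Re (1 * s m) - complex.Re 1 * S) +i*
   (complex.Re (- 'i * s m) - complex.Re (- 'i) * S).
  by apply: complex_eq; rewrite /=; case: (s m) => x y /=; ring.
move=> e e_gt0; have e20 : 0 < e / 2 by rewrite divr_gt0.
have /cvgrPdist_lt /(_ _ e20) [M1 _ H1] := h1.
have /cvgrPdist_lt /(_ _ e20) [M2 _ H2] := h2.
exists (maxn M1 M2) => m; rewrite geq_max => /andP[m1 m2].
rewrite Es; apply: le_lt_trans (cmod_le_ReIm _) _; rewrite /= [e]splitr.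
by apply: ltrD; rewrite distrC; [exact: H1 | exact: H2].
Qed.

End LargeCircles.

End Poles.

End Contour.

(** * From circles to symmetric sums *)

Section SymmetricRange.

Definition symmetric_range (N : nat) : seq int := [seq i%:Z - N%:Z | i <- index_iota 0 N.*2.+1].

Lemma mem_symmetric_range N (n : int) : (n \in symmetric_range N) = (`|n| <= N)%N.
Proof.
apply/mapP/idP => [|nN].
  case=> i; rewrite mem_index_iota /= ltnS => iN ->; lia.
by exists `|(n + N%:Z)%R|%N; [rewrite mem_index_iota; lia | lia].
Qed.

Lemma uniq_symmetric_range N : uniq (symmetric_range N).
Proof. by rewrite map_inj_uniq ?iota_uniq // => i j; lia. Qed.

End SymmetricRange.

Section Weights.
Context {R : realType}.
Variable s : R.
Hypothesis s_gt0 : 0 < s.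

Definition weight (i : nat) : R := expR (- s * ln i%:R) / i%:R.

(** Bounds the sum of the weights beyond [i], as the integral of [x ^ (- s - 1)]
    would do. *)
Definition weight_tail (i : nat) : R := expR (- s * ln i%:R) / s.

Lemma weight_ge0 i : 0 <= weight i.
Proof. by rewrite divr_ge0 ?expR_ge0 // ler0n. Qed.

Lemma weight_tail_ge0 i : 0 <= weight_tail i.
Proof. by rewrite divr_ge0 ?expR_ge0 // ltW. Qed.

(** [ln (i + 1) - ln i >= 1 / (i + 1)], and the exponential lies above its
    tangent. *)
Lemma weight_telescope i : (0 < i)%N -> weight i.+1 <= weight_tail i - weight_tail i.+1.
Proof.
move=> i0; have x0 : 0 < i%:R :> R by rewrite ltr0n.
have y0 : 0 < i.+1%:R :> R by rewrite ltr0n.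
have lnE : ln i.+1%:R - ln i%:R >= i.+1%:R^-1 :> R.
  have -> : ln i%:R = ln (i%:R / i.+1%:R) + ln i.+1%:R :> R.
    by rewrite -lnM ?posrE ?divr_gt0 // divfK // gt_eqF.
  rewrite opprD addrCA subrr addr0.
  have xy : 0 < i%:R / i.+1%:R :> R by rewrite divr_gt0.
  have := le_ln1Dx (_ : -1 < i%:R / i.+1%:R - 1 :> R); rewrite ltrDr xy => /(_ isT).
  rewrite addrC subrK => h; rewrite lerNr; apply: le_trans h _.
  rewrite -[X in _ - X](@divff _ i.+1%:R) ?gt_eqF // -mulrBl -[i.+1]addn1 natrD.
  by rewrite opprD addrA subrr sub0r mulN1r.
rewrite /weight_tail -mulrBl ler_pdivlMr // /weight.
set a := ln _ in lnE *; set b := ln _ in lnE *.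
have -> : - s * b = - s * a + s * (a - b) by ring.
rewrite expRD -[X in _ <= _ - X]mulr1 -mulrBr mulrAC -mulrA ler_wpM2l ?expR_ge0 //.
have h1 : s * i.+1%:R^-1 <= s * (a - b) by rewrite ler_wpM2l // ltW.
by apply: le_trans h1 _; rewrite lerBrDl; exact: expR_ge1Dx.
Qed.

Lemma sum_weight N M : (0 < N)%N -> \sum_(N.+1 <= i < M) weight i <= weight_tail N.
Proof.
move=> N0; have [NM|MN] := leqP N.+1 M; last by rewrite big_geq ?weight_tail_ge0 // ltnW.
rewrite -(subnK NM); elim: (M - N.+1)%N => [|k IH]; first by rewrite add0n big_geq ?weight_tail_ge0.
suff H j : \sum_(N.+1 <= i < j + N.+1) weight i <= weight_tail N - weight_tail (j + N).
  by apply: le_trans (H _) _; rewrite gerBl weight_tail_ge0.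
elim: j => [|j IHj]; first by rewrite add0n add0n subrr big_geq.
rewrite addSn big_nat_recr /=; last exact: leq_addl.
have := @weight_telescope (j + N); rewrite addn_gt0 N0 orbT => /(_ isT); rewrite !addnS addSn.
by move: IHj; rewrite addnS; lra.
Qed.

Lemma weight_tail_cvg0 (e : R) : 0 < e -> exists N0, forall N, (N0 <= N)%N -> weight_tail N < e.
Proof.
move=> e0; have [N0 HN] : exists N0 : nat, expR (- ln (s * e) / s) < N0%:R.
  by exists (Num.bound (expR (- ln (s * e) / s))); exact: archi_boundP (expR_ge0 _).
exists N0 => N NN; rewrite /weight_tail ltr_pdivrMr // [e * s]mulrC.
have se : 0 < s * e by rewrite mulr_gt0.
have -> : s * e = expR (ln (s * e)) by rewrite lnK.
rewrite ltr_expR mulNr ltrNl -ltr_pdivrMl // mulrC.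
rewrite -[X in X < _]expRK ltr_ln ?posrE ?expR_gt0 ?(lt_le_trans HN) ?ler_nat //.
by rewrite (lt_trans (expR_gt0 _) (lt_le_trans HN _)) // ler_nat.
Qed.

(** Each absolute value is taken by at most two integers. *)
Lemma sum_weight_int (D : seq int) N : (0 < N)%N -> uniq D ->
  (forall n, n \in D -> (N < `|n|)%N) ->
  \sum_(n <- D) weight `|n|%N <= 2 * weight_tail N.
Proof.
move=> N0 uD HD; pose M := (\max_(n <- D) `|n|%N).+1.
have HM n : n \in D -> (`|n| < M)%N by move=> nD; rewrite ltnS; apply: leq_bigmax_seq.
have -> : \sum_(n <- D) weight `|n|%N =
    \sum_(n <- D) \sum_(N.+1 <= i < M | i == `|n|%N) weight i.
  rewrite !big_seq; apply: eq_bigr => n nD; rewrite big_nat1_eq ltnS.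
  by rewrite ifT // HD //=; exact: HM.
rewrite (exchange_big_dep xpredT) //=.
apply: (@le_trans _ _ (\sum_(N.+1 <= i < M) (weight i *+ 2))); last first.
  by rewrite sumrMnl mulr_natl lerMn2r; apply/orP; right; exact: sum_weight.
apply: ler_sum => i _; rewrite -big_filter big_const_seq count_predT iter_addr addr0.
rewrite -(mulr_natr _ (size _)) -(mulr_natr _ 2) ler_wpM2l ?weight_ge0 // ler_nat.
have -> : 2%N = size [:: i%:Z; - i%:Z] by [].
apply: uniq_leq_size; first exact: filter_uniq.
by move=> n; rewrite mem_filter !inE => /andP[/eqP -> _]; case: n {HD HM} => n; lia.
Qed.

End Weights.

Section Summation.
Context {R : realType}.
Variables (f : R -> int -> R[i]) (p p' : R -> R) (t C s : R) (N0 : nat) (I : nat -> seq int).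
Hypotheses (s_gt0 : 0 < s) (C_ge0 : 0 <= C).
Hypothesis f_bound : forall u n, t <= u <= t + 1 -> (N0 <= `|n|)%N ->
  cmod (f u n) <= C * weight s `|n|%N.
Hypothesis f_cont : forall n e, 0 < e ->
  exists2 d : R, 0 < d & forall u, t <= u < t + d -> cmod (f u n - f t n) < e.
Hypothesis I_uniq : forall m, uniq (I m).
Hypothesis I_exhaust : forall n, exists M, forall m, (M <= m)%N -> n \in I m.
Hypothesis p'p : forall u, t < u -> p' u <= p t.
Hypothesis I_limit : forall u, t <= u <= t + 1 ->
  exists2 S : R, p u <= S <= p' u & forall e : R, 0 < e -> exists M : nat, forall m, (M <= m)%N ->
    cmod (\sum_(n <- I m) f u n - S%:C) < e.

Let partial u N := \sum_(n <- symmetric_range N) f u n.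

Let I_exhaust_seq (l : seq int) : exists M, forall m, (M <= m)%N -> {subset l <= I m}.
Proof.
elim: l => [|n l [M HM]]; first by exists 0%N.
have [M' HM'] := I_exhaust n; exists (maxn M M') => m; rewrite geq_max => /andP[m1 m2] i.
by rewrite inE => /orP[/eqP ->|il]; [exact: HM' | exact: HM].
Qed.

Lemma partial_dist u N m : t <= u <= t + 1 -> (0 < N)%N -> (N0 <= N)%N ->
  {subset symmetric_range N <= I m} ->
  cmod (\sum_(n <- I m) f u n - partial u N) <= C * (2 * weight_tail s N).
Proof.
move=> ut N_gt0 NN sub; rewrite (bigID (fun n => `|n| <= N)%N) /= /partial.
rewrite -big_filter (perm_big (symmetric_range N)); last first.
  apply: uniq_perm; rewrite ?filter_uniq ?uniq_symmetric_range // => n.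
  rewrite mem_filter mem_symmetric_range; case: leqP => // nN.
  by rewrite sub // mem_symmetric_range.
rewrite addrAC subrr add0r -big_filter; set D := [seq n <- I m | _].
have uD : uniq D by rewrite filter_uniq.
have HD n : n \in D -> (N < `|n|)%N by rewrite mem_filter -ltnNge => /andP[].
apply: le_trans (cmod_sum _ _ _) _.
apply: (@le_trans _ _ (\sum_(n <- D) C * weight s `|n|%N)).
  rewrite big_seq [leRHS]big_seq; apply: ler_sum => n nD; apply: f_bound => //.
  by rewrite (leq_trans NN) // ltnW // HD.
by rewrite -mulr_sumr ler_wpM2l //; exact: sum_weight_int.
Qed.

Lemma partial_limit u S N : t <= u <= t + 1 -> (0 < N)%N -> (N0 <= N)%N ->
  (forall e : R, 0 < e -> exists M : nat, forall m, (M <= m)%N ->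
    cmod (\sum_(n <- I m) f u n - S%:C) < e) ->
  cmod (partial u N - S%:C) <= C * (2 * weight_tail s N).
Proof.
move=> ut N_gt0 NN HS; apply/ler_addgt0Pr => e e0.
have [M1 H1] := HS _ e0; have [M2 H2] := I_exhaust_seq (symmetric_range N).
have m1 := leq_maxl M1 M2; have m2 := leq_maxr M1 M2.
apply: le_trans (cmod_triangle _ (\sum_(n <- I (maxn M1 M2)) f u n) _) _.
rewrite lerD //; last by rewrite ltW // H1.
by rewrite cmodB; apply: partial_dist => //; exact: H2.
Qed.

Let partial_cont N e : 0 < e ->
  exists2 d : R, 0 < d & forall u, t <= u < t + d -> cmod (partial u N - partial t N) < e.
Proof.
rewrite /partial; elim: (symmetric_range N) e => [|n l IH] e e0.
  by exists 1 => // u _; rewrite !big_nil subrr cmod0.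
have e20 : 0 < e / 2 by rewrite divr_gt0.
have [d1 d10 H1] := IH _ e20; have [d2 d20 H2] := f_cont n e20.
exists (Num.min d1 d2); first by rewrite lt_min d10.
move=> u /andP[tu]; rewrite -ltrBlDl lt_min !ltrBlDl => /andP[ud1 ud2].
rewrite !big_cons opprD addrACA; apply: le_lt_trans (cmodD _ _) _.
by rewrite [e]splitr; apply: ltrD; [apply: H2 | apply: H1]; rewrite tu.
Qed.

(** The sums over the exhausting sets have at [t] a limit [S >= p t].  By the
    uniformity of the tail bound [S] is, up to [e], the limit at a slightly
    larger [u], which is at most [p' u <= p t]. *)
Lemma symmetric_sum_limit (e : R) : 0 < e ->
  exists M : nat, forall N, (M <= N)%N -> cmod (partial t N - (p t)%:C) < e.
Proof.
move=> e0; have K0 : 0 < C * 2 + 1 by rewrite ltr_wpDl // mulr_ge0.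
have e50 : 0 < e / 5 / (C * 2 + 1) by rewrite !divr_gt0.
have [M1 HM1] := weight_tail_cvg0 s_gt0 e50.
have small N : (M1 <= N)%N -> C * (2 * weight_tail s N) <= e / 5.
  move=> /HM1 /ltW h; rewrite mulrA; apply: (@le_trans _ _ ((C * 2 + 1) * (e / 5 / (C * 2 + 1)))).
    by rewrite ler_pM ?weight_tail_ge0 ?mulr_ge0 // lerDl.
  by rewrite mulrC divfK // gt_eqF.
have tt : t <= t <= t + 1 by rewrite lexx lerDl ler01.
have [S /andP[pS Sp'] HS] := I_limit tt.
have Sp : S <= p t + 3 * (e / 5).
  pose N := maxn M1 (maxn N0 1).
  have [NM NN N_gt0] : [/\ (M1 <= N)%N, (N0 <= N)%N & (0 < N)%N].
    by rewrite /N !leq_max !leqnn ?orbT.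
  have [d d0 Hd] := partial_cont N (divr_gt0 e0 (ltr0Sn R 4)).
  pose u := t + Num.min (d / 2) 1.
  have m0 : 0 < Num.min (d / 2) 1 by rewrite lt_min ltr01 divr_gt0.
  have m1 : Num.min (d / 2) 1 <= 1 by rewrite ge_min lexx orbT.
  have m2 : Num.min (d / 2) 1 <= d / 2 by rewrite ge_min lexx.
  have ut : t <= u <= t + 1 by rewrite /u lerDl lerD2l m1 ltW.
  have ud : t <= u < t + d by rewrite /u lerDl ltrD2l ltW //= (le_lt_trans m2) // gtr_pMr // invf_lt1 // ltr1n.
  have [S' /andP[_ Sp''] HS'] := I_limit ut.
  have tu : t < u by rewrite ltrDl.
  have h0 := p'p tu; have h1 := partial_limit tt N_gt0 NN HS.
  have h2 := partial_limit ut N_gt0 NN HS'; have h3 := Hd _ ud; have h4 := small _ NM.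
  have h5 : S - S' <= cmod (S%:C - S'%:C) by rewrite -(ReC S) -{1}(ReC S') -ReN -ReD Re_le_cmod.
  have h6 := cmod_triangle S%:C (partial t N) S'%:C.
  have h7 := cmod_triangle (partial t N) (partial u N) S'%:C.
  rewrite (cmodB S%:C (partial t N)) in h6; rewrite (cmodB (partial t N) (partial u N)) in h7.
  lra.
exists (maxn M1 (maxn N0 1)) => N NM.
move: NM; rewrite !geq_max => /and3P[NM NN N_gt0].
have h1 := partial_limit tt N_gt0 NN HS; have h2 := small _ NM.
apply: le_lt_trans (cmod_triangle _ S%:C _) _.
have -> : cmod (S%:C - (p t)%:C) = S - p t by rewrite -rmorphB cmodC ger0_norm // subr_ge0.
lra.
Qed.

End Summation.

(** * Multiplicities and size of the zeros *)

Section Multiplicities.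
Context {R : realType}.

(** If the order [k1] were smaller than [k2], then [g1] would be divisible by
    [w - z] near [z], although [g1 z != 0]. *)
Lemma zero_order_le (f : R[i] -> R[i]) z k1 k2 :
  zero_order f z k1 -> zero_order f z k2 -> (k2 <= k1)%N.
Proof.
move=> [g1 [/near_cmodP [d1 d10 Hg1] g1z /near_cmodP [d1' d1'0 Hf1]]].
move=> [g2 [/near_cmodP [d2 d20 Hg2] _ /near_cmodP [d2' d2'0 Hf2]]].
rewrite leqNgt; apply/negP => k12.
have dg1 : cderivable g1 z by apply: Hg1; rewrite subrr cmod0.
have dg2 : cderivable g2 z by apply: Hg2; rewrite subrr cmod0.
pose h w := (w - z) ^+ (k2 - k1) * g2 w - g1 w.
have dh : cderivable h z.
  refine (cderivableB (cderivableM _ dg2) dg1).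
  apply: (@cderivableX _ (fun w => w - z)).
  by apply: cderivableB; [exact: cderivable_id | exact: cderivable_cst].
have hz : h z != 0 by rewrite /h subrr expr0n subn_eq0 leqNgt k12 mul0r sub0r oppr_eq0.
have [r r0 Hr] := cderivable_neq0_near dh hz.
pose x : R := Num.min r (Num.min d1' d2') / 2.
have m0 : 0 < Num.min r (Num.min d1' d2') by rewrite !lt_min r0 d1'0.
have x0 : 0 < x by rewrite divr_gt0.
have [xr x1 x2] : [/\ x < r, x < d1' & x < d2'].
  have : x < Num.min r (Num.min d1' d2') by rewrite /x gtr_pMr // invf_lt1 // ltr1n.
  by rewrite !lt_min => /and3P[].
have xE : cmod (z + x%:C - z) = x by rewrite addrAC subrr add0r cmodC ger0_norm // ltW.
have := Hr (z + x%:C); rewrite xE => /(_ xr) /negP; apply.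
rewrite /h subr_eq0; have zx : z + x%:C - z != 0 by rewrite -cmod_gt0 xE.
apply/eqP/(mulfI (expf_neq0 k1 zx)).
by rewrite mulrA -exprD subnKC ?(ltnW k12) // -Hf1 ?xE // -Hf2 ?xE.
Qed.

(** Since the imaginary parts are asymptotically equidistant, coincidences are
    possible among finitely many indices only. *)
Lemma eventually_distinct (zeta : int -> R[i]) (alpha beta : R) : alpha < 0 ->
  (forall n, zeta (- n) = (zeta n)^*) ->
  complex.Im (zeta n%:Z) - (- 2 * pi * n%:R / alpha) @[n --> \oo] --> beta ->
  exists N : nat, forall m1 m2 : int, (N <= `|m1|)%N -> zeta m1 = zeta m2 -> m1 = m2.
Proof.
move=> al0 zc zI; pose q := - 2 * pi / alpha.
have q0 : 0 < q.
  have -> : q = 2 * pi / - alpha by rewrite /q invrN; ring.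
  by rewrite divr_gt0 ?oppr_gt0 // mulr_gt0 // pi_gt0.
have q40 : 0 < q / 4 by rewrite divr_gt0.
have /cvgrPdist_lt /(_ _ q40) [M0 _ HM0] := zI.
have {HM0}near_lin m : (M0 <= m)%N -> `|complex.Im (zeta m%:Z) - q * m%:R - beta| < q / 4.
  move=> /HM0; rewrite distrC; congr (`|_ - _ - _| < _).
  by rewrite /q; ring.
have ImN' m : complex.Im (zeta (- m)) = - complex.Im (zeta m) by rewrite zc; case: (zeta m).
have [B HB] : exists B : R, forall m, (m < M0)%N -> `|complex.Im (zeta m%:Z)| <= B.
  elim: M0 {near_lin} => [|M0 [B HB]]; first by exists 0.
  exists (Num.max B `|complex.Im (zeta M0%:Z)|) => m; rewrite ltnS leq_eqVlt.
  by move=> /orP[/eqP ->|/HB h]; rewrite le_max ?lexx ?orbT // h.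
(* Beyond [N] the imaginary part exceeds all those with index below [M0], and the
   shift [beta] cannot compensate for a difference of signs. *)
pose K := (`|B| + 2 * `|beta| + q) / q.
pose N := maxn M0 (Num.bound `|K|).
have NK m : (N <= m)%N -> `|B| + 2 * `|beta| + q < q * m%:R.
  rewrite geq_max => /andP[_ Nm].
  have -> : `|B| + 2 * `|beta| + q = q * K by rewrite /K [RHS]mulrC divfK // gt_eqF.
  rewrite (ltr_pM2l q0); apply: (le_lt_trans (ler_norm K)).
  by apply: (lt_le_trans (archi_boundP (normr_ge0 K))); rewrite ler_nat.
exists N.
have pos (i : nat) (m2 : int) : (N <= i)%N -> zeta i%:Z = zeta m2 -> i%:Z = m2.
  move=> Ni E; have iK := NK _ Ni.
  have iM : (M0 <= i)%N by move: Ni; rewrite geq_max => /andP[].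
  have := near_lin _ iM; rewrite ltr_norml => /andP[li1 li2].
  have bb := ler_norm beta; have bb' := ler_norm (- beta); rewrite normrN in bb'.
  have BB := ler_norm B; have B0 := normr_ge0 B.
  have TE : complex.Im (zeta i%:Z) = complex.Im (zeta m2) by rewrite E.
  case: m2 {E} TE => j.
    have [/HB|/near_lin] := ltnP j M0.
      by rewrite ler_norml => /andP[_ l1] TE; exfalso; lra.
    rewrite ltr_norml => /andP[lj1 lj2] TE; have [ij|ji|->//] := ltngtP i j.
      have : q * (i.+1)%:R <= q * j%:R by rewrite ler_wpM2l ?ler_nat // ltW.
      by rewrite -natr1 => h; exfalso; lra.
    have : q * (j.+1)%:R <= q * i%:R by rewrite ler_wpM2l ?ler_nat // ltW.
    by rewrite -natr1 => h; exfalso; lra.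
  rewrite NegzE ImN'.
  have [/HB|/near_lin] := ltnP j.+1 M0.
    by rewrite ler_norml => /andP[l1 _] TE; exfalso; lra.
  rewrite ltr_norml => /andP[lj1 lj2] TE.
  have : 0 <= q * (j.+1)%:R by rewrite mulr_ge0 // ltW.
  by move=> h; exfalso; lra.
case=> i m2 Ni E; first exact: pos.
rewrite NegzE in Ni E *; rewrite abszN /= in Ni.
have E' : zeta (i.+1)%:Z = zeta (- m2).
  by rewrite zc -E zc conjCK.
by rewrite (pos _ _ Ni E') opprK.
Qed.

Lemma multiplicity_le1 (f : R[i] -> R[i]) (D : set R[i]) (zeta : int -> R[i]) (w : R[i]) (k : nat) :
  enum_zeros_with_mult f D zeta -> D w -> zero_order f w k ->
  (forall m1 m2, zeta m1 = w -> zeta m2 = w -> m1 = m2) -> (k <= 1)%N.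
Proof.
move=> [_ /(_ w) He] Dw wk inj; have [k' wk' card_k'] := He Dw.
rewrite (@leq_trans k') //; first exact: zero_order_le wk' wk.
have [[m mw]|no] := pselect (exists m, zeta m = w).
  rewrite -card_le_II -(card_le_eql card_k') -(card_le_eqr (@card_set1 _ m)).
  by apply: subset_card_le => m' /= m'w; exact: inj.
rewrite -card_le_II -(card_le_eql card_k') -(card_le_eqr (@card_set1 _ 0%Z)).
apply: subset_card_le => m /= mw.
by case: no; exists m.
Qed.

Lemma pole_term_simple (z : R[i]) (c : int -> R[i]) (k : nat) (t A : R) : (k <= 1)%N -> 0 <= A ->
  ((1 <= k)%N -> cmod (c (- 1%:Z) * (- z) ^- 1) <= A) ->
  cmod (pole_term z c k t) <= A * expR (complex.Re z * t).
Proof.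
case: k => [|[|//]] _ A0 HA; first by rewrite /pole_term big_geq // cmod0 mulr_ge0 ?expR_ge0.
rewrite /pole_term big_nat1 big_nat1 expr0 fact0 divr1 mulr1 cmodM cmod_cexpM.
by rewrite ler_wpM2r ?expR_ge0 // HA.
Qed.

Lemma pole_term_continuous (z : R[i]) (c : int -> R[i]) (k : nat) (t e : R) : 0 < e ->
  exists2 d : R, 0 < d & forall u, t <= u < t + d ->
    cmod (pole_term z c k u - pole_term z c k t) < e.
Proof.
move=> e0; pose g (u : R[i]) := \sum_(1 <= j < k.+1) (c (- j%:Z) * (- z) ^- j) *
    \sum_(0 <= l < j) cexp (z * u) * ((- u * z) ^+ l / l`!%:R).
have dg u : cderivable g u.
  apply: cderivable_sum => j _; apply: cderivableM; first exact: cderivable_cst.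
  apply: cderivable_sum => l _; apply: cderivableM.
    apply: (@cderivable_comp _ (fun u => z * u) cexp); last exact: cderivable_cexp.
    by apply: cderivableM; [exact: cderivable_cst | exact: cderivable_id].
  apply: cderivableM; last exact: cderivable_cst.
  apply: (@cderivableX _ (fun u => - u * z)); apply: cderivableM; last exact: cderivable_cst.
  by apply: cderivableN; exact: cderivable_id.
have [d d0 Hd] := cderivable_continuous (dg t%:C) e0.
exists d => // u /andP[tu ud]; apply: (Hd u%:C).
by rewrite -rmorphB cmodC ger0_norm ?subr_ge0 // ltrBlDl.
Qed.

End Multiplicities.

Section LargeZeros.
Context {R : realType}.
Variables (z : int -> R[i]) (gamma gamma0 : R).
Hypothesis gamma_gt0 : 0 < gamma.
Hypothesis z_Re : forall e : R, 0 < e -> exists N : nat, forall n : int,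
  (N <= `|n|)%N -> `| complex.Re (z n) - (- gamma * ln (`|n|%:~R) + gamma0) | < e.

Let z_Re1 : exists N : nat, forall n : int, (N <= `|n|)%N ->
  `| complex.Re (z n) - (- gamma * ln (`|n|%N%:R) + gamma0) | < 1.
Proof.
have [N HN] := z_Re ltr01; exists N => n /HN.
by rewrite -abszE -pmulrn.
Qed.

Lemma zeros_escape (B : R) : exists N : nat, forall n, (N <= `|n|)%N -> B < cmod (z n).
Proof.
have [N HN] := z_Re1; pose K := expR ((B + `|gamma0| + 1) / gamma).
exists (maxn N (Num.bound K)) => n; rewrite geq_max => /andP[/HN + Kn].
have Kn' : K < `|n|%N%:R.
  by apply: lt_le_trans (archi_boundP (expR_ge0 _)) _; rewrite ler_nat.
have : (B + `|gamma0| + 1) / gamma < ln (`|n|%N%:R).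
  by rewrite -ltr_expR lnK // posrE (lt_trans (expR_gt0 _) Kn').
rewrite (ltr_pdivrMr _ _ gamma_gt0) mulrC ltr_norml => h /andP[_ h2].
have h3 := abs_Re_le_cmod (z n); have h4 := ler_norm (- complex.Re (z n)).
have h5 := ler_norm gamma0; rewrite normrN in h4; lra.
Qed.

Lemma zeros_decay (t : R) : 0 < t -> exists N : nat, forall u n, t <= u <= t + 1 ->
  (N <= `|n|)%N -> expR (complex.Re (z n) * u) <=
    expR ((`|gamma0| + 1) * (t + 1)) * expR (- (gamma * t) * ln `|n|%N%:R).
Proof.
move=> t0; have [N HN] := z_Re1; exists (maxn N 1) => u n /andP[tu ut].
rewrite geq_max => /andP[/HN + n1]; rewrite ltr_norml => /andP[_ h].
rewrite -expRD ler_expR; have l0 : 0 <= ln `|n|%N%:R :> R by rewrite ln_ge0 // ler1n.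
have u0 : 0 <= u by rewrite (le_trans _ tu) // ltW.
have h1 : complex.Re (z n) <= `|gamma0| + 1 - gamma * ln `|n|%N%:R.
  by have := ler_norm gamma0; lra.
apply: (le_trans (ler_wpM2r u0 h1)); rewrite mulrBl lerD //.
  by rewrite ler_wpM2l // addr_ge0.
rewrite [X in _ <= X]mulNr lerN2 [leRHS]mulrAC; apply: (ler_wpM2r l0).
by rewrite (ler_pM2l gamma_gt0).
Qed.

End LargeZeros.

Section Exhaustion.
Context {R : realType}.

Lemma disc_lists (z : int -> R[i]) (r : nat -> R) :
  (forall B : R, exists N : nat, forall n, (N <= `|n|)%N -> B < cmod (z n)) ->
  exists I : nat -> seq int, (forall m, uniq (I m)) /\
    forall m n, n \in I m = (cmod (z n) < r m).
Proof.
move=> esc; have [N HN] := choice (fun m => esc (r m)).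
exists (fun m => [seq n <- symmetric_range (N m) | cmod (z n) < r m]).
split=> m; first by rewrite filter_uniq // uniq_symmetric_range.
move=> n; rewrite mem_filter mem_symmetric_range.
case zr: (cmod (z n) < r m) => //=; rewrite leqNgt; apply/negP => /ltnW /HN.
by rewrite ltNge ltW.
Qed.

End Exhaustion.

Unset Implicit Arguments.
(** * The tail of the waiting time *)

Theorem theorem2p6 (R : realType) (d : measure_display) (T : measurableType d)
    (P : probability T R) (X Y V : {RV P >-> R}) (psi : R[i] -> R[i])
    (X_ge0 : {ae P, forall w, 0 <= X w})
    (Y_ge0 : {ae P, forall w, 0 <= Y w})
    (indepXY : independent2 X Y)
    (stable : ('E_P[Y] < 'E_P[X])%E)
    (nonlattice : ~ lattice X \/ ~ lattice Y)
    (eps0 : R) (eps0_gt0 : 0 < eps0)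
    (A_analytic : laplace_analytic_on X
      [set theta | - eps0 < complex.Re theta < eps0])
    (B_analytic : laplace_analytic_on Y
      [set theta | - eps0 < complex.Re theta < eps0])
    (V_ge0 : {ae P, forall w, 0 <= V w})
    (V_stationary : stationary_workload X Y V)
    (psi_V : meromorphic_continuation V psi)
    (B_entire : laplace_analytic_on Y setT)
    (alpha : R) (alpha_lt0 : alpha < 0)
    (F_order : exponential_order
      (fun x : R => complex.Re (characteristic X Y x%:C))
      (- alpha) (ninfty_nbhs R))
    (zeta : int -> R[i]) (beta : R)
    (zeta_enum :
      enum_zeros_with_mult (characteristic X Y) left_half_plane zeta)
    (zeta_conj : forall n, zeta (- n) = (zeta n)^*)
    (zeta_Re : (fun n : nat => complex.Re (zeta n%:Z))
                 =o_\oo (fun n : nat => Num.sqrt n%:R))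
    (zeta_Im : complex.Im (zeta n%:Z) - (- 2 * pi * n%:R / alpha)
                 @[n --> \oo] --> beta)
    (eta eps : R) (eta_gt0 : 0 < eta) (eps_gt0 : 0 < eps)
    (n1 : nat) (r : nat -> R)
    (r_sublinear : sublinear eta n1 r)
    (r_oo : r @ \oo --> +oo)
    (F_circle : forall (n : nat) (theta : R[i]), (n1 <= n)%N ->
      complex.Re theta < 0 -> cmod theta = r n ->
      eps < cmod (characteristic X Y theta))
    (z : int -> R[i]) (k : int -> nat)
    (z_enum : enum_distinct_zeros (characteristic X Y) left_half_plane z)
    (z_conj : forall n, z (- n) = (z n)^*)
    (z_mult : forall n, zero_order (characteristic X Y) (z n) (k n))
    (* L n m is the coefficient of (theta - z n) ^ m, so that A_{n,j} is
       L n (- j) *)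
    (L : int -> int -> R[i])
    (psi_laurent : forall n, laurent_expansion psi (z n) (L n))
    (a : int -> nat -> R[i])
    (a_def : forall (n : int) (j : nat),
      a n j = L n (- j%:Z) * (- z n) ^- j)
    (M1 gamma gamma0 : R) (gamma_gt0 : 0 < gamma)
    (a_bound : forall (n : int) (j : nat), n != 0 -> (1 <= j <= k n)%N ->
      cmod (a n j) <= M1 / `|n|%:~R)
    (z_Re : forall e : R, 0 < e -> exists N : nat, forall n : int,
      (N <= `|n|)%N ->
      `| complex.Re (z n) - (- gamma * ln (`|n|%:~R) + gamma0) | < e) :
  forall t : R, 0 < t ->
    (fun N : nat =>
       \sum_(0 <= i < N.*2.+1)
         let n : int := i%:Z - N%:Z in
         \sum_(1 <= j < (k n).+1)
           a n j * \sum_(0 <= l < j)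
             cexp (z n * t%:C) * ((- t%:C * z n) ^+ l / (l`!)%:R)
       : R[i]^o) @ \oo
    --> ((fine (P [set w | t < V w]))%:C : R[i]^o).
Proof.
move=> t t_gt0; apply/cvg_cmodP => e e_gt0.
have [delta [H [delta_gt0 iV [H_der H_bound] V_der V_eq]]] :=
  wiener_hopf X_ge0 indepXY stable eps0_gt0 A_analytic V_ge0 V_stationary B_entire.
have F_der := cderivable_characteristic X_ge0 eps0_gt0 A_analytic B_entire.
have [psiE psi_mero] := psi_V.
have [z_inj z_range] := z_enum.
have z_zero n : complex.Re (z n) < 0 /\ characteristic X Y (z n) = 0.
  have : range z (z n) by exists n.
  by rewrite z_range.
have z_left n : complex.Re (z n) < 0 by have [] := z_zero n.
have z_all w : complex.Re w < 0 -> characteristic X Y w = 0 -> exists n, z n = w.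
  move=> w0 Fw; have : range z w by rewrite z_range; split.
  by case=> n _ <-; exists n.
(* Right of the imaginary axis [psi] is the Laplace transform of [V]. *)
have start : equation_near (characteristic X Y) H psi (eps0 / 2)%:C.
  exists (eps0 / 2); first by rewrite divr_gt0.
  move=> w _ wd; have h1 := Re_near w (eps0 / 2)%:C; have h2 := Re_near (eps0 / 2)%:C w.
  rewrite (cmodB _ w) in h1; rewrite ReC in h1 h2.
  rewrite psiE; last by lra.
  by apply: V_eq; lra.
have psi_eq p : complex.Re p < 0 -> equation_near (characteristic X Y) H psi p.
  move=> p0; apply: (equation_continuation F_der H_der psi_mero _ _ start).
    by rewrite ReC; lra.
  by apply: lt_trans p0 _.
have esc := zeros_escape gamma_gt0 z_Re.
(* A zero of larger modulus than the finitely many exceptional [zeta m] is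
   simple; the sum of their moduli serves as an upper bound. *)
have [N1 simple] : exists N1 : nat, forall n, (N1 <= `|n|)%N -> (k n <= 1)%N.
  have [N HN] := eventually_distinct alpha_lt0 zeta_conj zeta_Im.
  have [N1 HN1] := esc (\sum_(m <- symmetric_range N) cmod (zeta m)).
  exists N1 => n /HN1 zn.
  apply: (multiplicity_le1 zeta_enum (z_left n) (z_mult n)) => m1 m2 e1 e2.
  apply: HN; last by rewrite e1 e2.
  rewrite leqNgt; apply/negP => m1N; move: zn; rewrite ltNge => /negP; apply.
  rewrite (bigD1_seq m1) ?uniq_symmetric_range ?mem_symmetric_range ?(ltnW m1N) //=.
  by rewrite e1 lerDl sumr_ge0 // => m _; exact: cmod_ge0.
have [N2 decay] := zeros_decay gamma_gt0 z_Re t_gt0.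
have /cvgryPge /(_ 1) [m0 _ Hm0] := r_oo.
(* Discarding finitely many circles makes all radii positive. *)
pose r' m := r (m + maxn m0 n1)%N.
have r'_gt0 m : 0 < r' m.
  apply: (lt_le_trans ltr01); apply: Hm0 => /=.
  by rewrite (leq_trans (leq_maxl m0 n1)) // leq_addl.
have r'_oo : r' @ \oo --> +oo by rewrite cvg_shiftn.
have F_circle' m w : complex.Re w < 0 -> cmod w = r' m -> eps < cmod (characteristic X Y w).
  by apply: F_circle; rewrite (leq_trans (leq_maxr m0 n1)) // leq_addl.
have [I [I_uniq mem_I]] := disc_lists r' esc.
pose f u n := pole_term (z n) (L n) (k n) u.
pose C := `|M1| * expR ((`|gamma0| + 1) * (t + 1)).
have f_bound u n : t <= u <= t + 1 -> (maxn (maxn N1 N2) 1 <= `|n|)%N ->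
    cmod (f u n) <= C * weight (gamma * t) `|n|%N.
  move=> ut; rewrite !geq_max => /andP[/andP[/simple kn /(decay _ _ ut) Re_n] n0].
  have nz : n != 0 by rewrite -absz_gt0.
  have A0 : 0 <= `|M1| / `|n|%N%:R :> R by rewrite divr_ge0.
  apply: le_trans (pole_term_simple u kn A0 _) _.
    move=> k1; rewrite -a_def; apply: le_trans (a_bound _ _ nz _) _; first by rewrite k1.
    by rewrite -abszE -pmulrn ler_wpM2r ?invr_ge0 ?ler_norm.
  apply: (le_trans (ler_wpM2l A0 Re_n)); rewrite /C /weight le_eqVlt; apply/orP; left.
  by apply/eqP; ring.
have C_ge0 : 0 <= C by rewrite mulr_ge0 ?expR_ge0.
have I_exhaust n : exists M, forall m, (M <= m)%N -> n \in I m.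
  have /cvgryPgt /(_ (cmod (z n))) [M _ HM] := r'_oo.
  by exists M => m /HM; rewrite mem_I.
have limits u : t <= u <= t + 1 -> exists2 S : R,
    fine (P [set w | u < V w]) <= S <= fine (P [set w | u <= V w]) &
    forall e : R, 0 < e -> exists M : nat, forall m, (M <= m)%N ->
      cmod (\sum_(n <- I m) f u n - S%:C) < e.
  move=> /andP[tu _]; have u_gt0 := lt_le_trans t_gt0 tu.
  exact: (contour_limit V_ge0 delta_gt0 eps0_gt0 iV F_der H_der H_bound V_der V_eq u_gt0
    psi_eq z_left z_inj z_all z_mult psi_laurent r'_gt0 eps_gt0 r'_oo F_circle' I_uniq mem_I).
have right u : t < u -> fine (P [set w | u <= V w]) <= fine (P [set w | t < V w]).
  move=> tu.
  have m1 := measurable_reaches V u; have m2 := measurable_exceeds V t.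
  rewrite fine_le ?fin_num_measure //.
  by apply: le_measure; rewrite ?inE // => w /= uV; exact: lt_le_trans uV.
have [N HN] := symmetric_sum_limit (mulr_gt0 gamma_gt0 t_gt0) C_ge0 f_bound
  (fun n e => pole_term_continuous (z n) (L n) (k n) t (e := e)) I_uniq I_exhaust right limits e_gt0.
exists N => M /HN; rewrite /symmetric_range big_map.
congr (cmod (_ - _) < _); apply: eq_bigr => i _.
by apply: eq_bigr => j _; rewrite a_def.
Qed.
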